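(* Let $\mathcal T_H$ be a shape regular conforming triangulation of $\Omega$. There exists a constant $C_0>0$, depending only on the shape regularity of $\mathcal T_H$, such that for every conforming refinement $\mathcal T_h$ of $\mathcal T_H$ obtained by newest vertex bisection and every $f\in L^2(\Omega)$, with $\boldsymbol\sigma_h=\mathcal L_h^{-1}f_h$ and $\tilde{\boldsymbol\sigma}_h=\mathcal L_h^{-1}f_H$, $$\|\boldsymbol\sigma_h-\tilde{\boldsymbol\sigma}_h\|\le\sqrt{C_0}\,\mathrm{osc}(f_h,\mathcal T_H).$$
   Context: $\Omega\subset\mathbb R^2$ is a polygonal, simply connected bounded domain; $\|\cdot\|$ and $(\cdot,\cdot)$ are the $L^2(\Omega)$ (or $L^2(\Omega)^2$) norm and inner product. Discrete spaces: for a conforming triangulation $\mathcal T_H$, $(\boldsymbol\Sigma_H,U_H)$ is either the Raviart–Thomas pair of a fixed order $p\ge0$: $\boldsymbol\Sigma_H=\{\boldsymbol\tau\in\boldsymbol H(\mathrm{div};\Omega):\boldsymbol\tau|_T\in \mathcal P_p(T)^2+\boldsymbol x\,\mathcal P_p(T)\ \forall T\in\mathcal T_H\}$, $U_H=\{v\in L^2(\Omega):v|_T\in\mathcal P_p(T)\ \forall T\in\mathcal T_H\}$; or the Brezzi–Douglas–Marini pair of a fixed order $p\ge1$: $\boldsymbol\Sigma_H=\{\boldsymbol\tau\in\boldsymbol H(\mathrm{div};\Omega):\boldsymbol\tau|_T\in\mathcal P_p(T)^2\ \forall T\in\mathcal T_H\}$, $U_H=\{v\in L^2(\Omega):v|_T\in\mathcal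 P_{p-1}(T)\ \forall T\in\mathcal T_H\}$. The same family and the same $p$ are used on all triangulations; $p$ is fixed, so constants may depend on $p$. $Q_H:L^2(\Omega)\to U_H$ is the $L^2$ projection and $f_H=Q_Hf$ (similarly $f_h=Q_hf$ on $\mathcal T_h$). Since $\mathcal T_h$ refines $\mathcal T_H$, $U_H\subset U_h$, so $f_H\in U_h$. Discrete problem: for $g\in U_h$, $\mathcal L_h^{-1}g$ denotes the unique pair $(\boldsymbol\sigma_h,u_h)\in\boldsymbol\Sigma_h\times U_h$ with $(\boldsymbol\sigma_h,\boldsymbol\tau_h)-(\mathrm{div}\,\boldsymbol\tau_h,u_h)=0$ for all $\boldsymbol\tau_h\in\boldsymbol\Sigma_h$ and $(\mathrm{div}\,\boldsymbol\sigma_h,v_h)=(g,v_h)$ for all $v_h\in U_h$; one writes $\boldsymbol\sigma_h=\mathcal L_h^{-1}g$ for the first component. Data oscillation: $\mathrm{osc}(f_h,\mathcal T_H)=\big(\sum_{T\in\mathcal T_H}H_T^2\|f_h-f_H\|_{L^2(T)}^2\big)^{1/2}$, with $H_T=\mathrm{diam}(T)$. *)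

(* Defs.v *)
From HB Require Import structures.
From mathcomp Require Import all_boot all_order all_algebra.
From mathcomp Require Import all_classical all_reals all_analysis.

Set Implicit Arguments.
Unset Strict Implicit.
Unset Printing Implicit Defensive.

Import Order.TTheory GRing.Theory Num.Theory.
Import numFieldNormedType.Exports.

Local Open Scope classical_set_scope.
Local Open Scope ring_scope.

(* The library norm of [R * R] is the sup norm; the topology is the same. *)
Definition edist (R : realType) (x y : R * R) : R :=
  Num.sqrt ((x.1 - y.1) ^+ 2 + (x.2 - y.2) ^+ 2).

Definition diam (R : realType) (A : set (R * R)) : R :=
  sup [set r | exists x y, [/\ A x, A y & r = edist x y]].

Definition leb2 (R : realType) :
    {measure set (measurableTypeR R * measurableTypeR R) -> \bar R} :=
  (@lebesgue_measure R \x @lebesgue_measure R)%E.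

Definition segment (R : realType) (a b : R * R) : set (R * R) :=
  [set z | exists t : R, 0 <= t <= 1 /\ z = (1 - t) *: a + t *: b].

(* Every loop is contractible, relative to its base point; connectedness is
   required separately. *)
Definition simply_connected (R : realType) (A : set (R * R)) : Prop :=
  forall c : R -> R * R,
    {within `[0, 1], continuous c} ->
    (forall t : R, 0 <= t <= 1 -> A (c t)) ->
    c 0 = c 1 ->
  exists H : R * R -> R * R,
    [/\ {within (`[0, 1]%classic `*` `[0, 1]%classic : set (R * R)),
          continuous H},
        (forall s t : R, 0 <= s <= 1 -> 0 <= t <= 1 -> A (H (s, t))),
        (forall t : R, 0 <= t <= 1 -> H (0, t) = c t),
        (forall t : R, 0 <= t <= 1 -> H (1, t) = c 0) &
        (forall s : R, 0 <= s <= 1 -> H (s, 0) = c 0 /\ H (s, 1) = c 0)].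

Definition polygonal_domain (R : realType) (Om : set (R * R)) : Prop :=
  [/\ open Om, Om !=set0, connected Om & bounded_set Om] /\
  exists E : seq ((R * R) * (R * R)),
    closure Om `\` interior Om = \bigcup_(e in [set` E]) segment e.1 e.2.

(* A triangle is the list of its vertices, the first of which is its newest
   vertex: the refinement edge joins the second and the third ones. *)
Definition triangle (R : realType) : Type := ((R * R) * (R * R) * (R * R))%type.

Definition vertices (R : realType) (T : triangle R) : seq (R * R) :=
  [:: T.1.1; T.1.2; T.2].

Definition tri (R : realType) (T : triangle R) : set (R * R) :=
  [set z | exists a b c : R,
    [/\ 0 <= a, 0 <= b, 0 <= c, a + b + c = 1 &
        z = a *: T.1.1 + b *: T.1.2 + c *: T.2]].

Definition otri (R : realType) (T : triangle R) : set (R * R) :=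
  interior (tri T).

Definition nondegenerate (R : realType) (T : triangle R) : Prop :=
  (T.1.2.1 - T.1.1.1) * (T.2.2 - T.1.1.2)
  - (T.1.2.2 - T.1.1.2) * (T.2.1 - T.1.1.1) != 0.

Definition conforming (R : realType) (TH : seq (triangle R)) : Prop :=
  forall T T' : triangle R, T \in TH -> T' \in TH -> T <> T' ->
  [\/ tri T `&` tri T' = set0,
      exists v, [/\ v \in vertices T, v \in vertices T' &
                    tri T `&` tri T' = [set v]] |
      exists a b, [/\ a != b,
                      (a \in vertices T) && (b \in vertices T),
                      (a \in vertices T') && (b \in vertices T') &
                      tri T `&` tri T' = segment a b]].

Definition conforming_triangulation (R : realType) (Om : set (R * R))
    (TH : seq (triangle R)) : Prop :=
  [/\ uniq TH,
      (forall T : triangle R, T \in TH -> nondegenerate T),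
      closure Om = \bigcup_(T in [set` TH]) tri T,
      (forall T : triangle R, T \in TH -> otri T `<=` Om) &
      conforming TH].

Definition shape_regular (R : realType) (gamma : R) (TH : seq (triangle R)) :
    Prop :=
  forall T : triangle R, T \in TH -> diam (tri T) ^+ 2 <= gamma * fine (leb2 R (tri T)).

Definition midpoint (R : realType) (a b : R * R) : R * R := 2^-1 *: (a + b).

(* The midpoint of the refinement edge is the newest vertex of both children,
   whose refinement edges are the other two edges of the parent. *)
Definition bisect (R : realType) (T : triangle R) : triangle R * triangle R :=
  let m := midpoint T.1.2 T.2 in ((m, T.1.1, T.1.2), (m, T.2, T.1.1)).

Inductive nvb_refinement (R : realType) (TH : seq (triangle R)) :
    seq (triangle R) -> Prop :=
| NvbRefl : nvb_refinement TH TH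
| NvbStep s1 T s2 :
    nvb_refinement TH (s1 ++ T :: s2) ->
    nvb_refinement TH (s1 ++ (bisect T).1 :: (bisect T).2 :: s2).

(* Elements of [L^2] are represented by functions, only their values almost
   everywhere in the domain being relevant. *)
Definition L2 (R : realType) (Om : set (R * R)) : set (R * R -> R) :=
  [set f | @measurable_fun _ _ (measurableTypeR R * measurableTypeR R)%type R Om f /\
           (leb2 R).-integrable Om (fun x => (f x ^+ 2)%:E)].

Definition L2vec (R : realType) (Om : set (R * R)) :
    set (R * R -> R * R) :=
  [set t | L2 Om (fun x => (t x).1) /\ L2 Om (fun x => (t x).2)].

Definition ip (R : realType) (Om : set (R * R)) (f g : R * R -> R) : R :=
  \int[leb2 R]_(x in Om) (f x * g x).

Definition vip (R : realType) (Om : set (R * R)) (s t : R * R -> R * R) : R :=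
  \int[leb2 R]_(x in Om) ((s x).1 * (t x).1 + (s x).2 * (t x).2).

Definition L2norm (R : realType) (Om : set (R * R)) (f : R * R -> R) : R :=
  Num.sqrt (ip Om f f).

Definition L2vnorm (R : realType) (Om : set (R * R)) (t : R * R -> R * R) : R :=
  Num.sqrt (vip Om t t).

Definition d1 (R : realType) (f : R * R -> R) : R * R -> R :=
  fun x => 'D_((1, 0) : R * R) f x.

Definition d2 (R : realType) (f : R * R -> R) : R * R -> R :=
  fun x => 'D_((0, 1) : R * R) f x.

Fixpoint Ck (R : realType) (k : nat) (f : R * R -> R) : Prop :=
  match k with
  | 0%N => continuous f
  | k'.+1 => [/\ continuous f,
                 (forall x : R * R, derivable f x ((1, 0) : R * R)),
                 (forall x : R * R, derivable f x ((0, 1) : R * R)),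
                 Ck k' (d1 f) & Ck k' (d2 f)]
  end.

Definition test_function (R : realType) (Om : set (R * R)) (phi : R * R -> R) :
    Prop :=
  [/\ (forall k, Ck k phi),
      compact (closure [set x | phi x != 0]) &
      closure [set x | phi x != 0] `<=` Om].

Definition is_weak_div (R : realType) (Om : set (R * R))
    (t : R * R -> R * R) (g : R * R -> R) : Prop :=
  L2 Om g /\
  forall phi, test_function Om phi ->
    vip Om t (fun x => (d1 phi x, d2 phi x)) = - ip Om g phi.

Definition Hdiv (R : realType) (Om : set (R * R)) : set (R * R -> R * R) :=
  [set t | L2vec Om t /\ exists g, is_weak_div Om t g].

(* The weak divergence is unique up to a null set. *)
Definition wdiv (R : realType) (Om : set (R * R)) (t : R * R -> R * R) :
    R * R -> R :=
  xget (cst 0) [set g | is_weak_div Om t g].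

Definition polynomial2 (R : realType) (p : nat) : set (R * R -> R) :=
  [set q | exists c : nat -> nat -> R, forall x,
    q x = \sum_(i < p.+1) \sum_(j < p.+1 - i) c i j * x.1 ^+ i * x.2 ^+ j].

Variant mixed_family := RT | BDM.

Definition flux_shape (R : realType) (fam : mixed_family) (p : nat) :
    set (R * R -> R * R) :=
  match fam with
  | RT => [set t | exists q1 q2 q : R * R -> R,
      [/\ polynomial2 p q1, polynomial2 p q2, polynomial2 p q &
          forall x, t x = (q1 x + x.1 * q x, q2 x + x.2 * q x)]]
  | BDM => [set t | polynomial2 p (fun x => (t x).1) /\
                    polynomial2 p (fun x => (t x).2)]
  end.

Definition flux_space (R : realType) (fam : mixed_family) (p : nat)
    (Om : set (R * R)) (TH : seq (triangle R)) : set (R * R -> R * R) :=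
  [set t | Hdiv Om t /\
    forall T : triangle R, T \in TH -> exists2 q, flux_shape fam p q &
      {ae leb2 R, forall x, otri T x -> t x = q x}].

Definition scalar_degree (fam : mixed_family) (p : nat) : nat :=
  match fam with RT => p | BDM => p.-1 end.

Definition scalar_space (R : realType) (fam : mixed_family) (p : nat)
    (Om : set (R * R)) (TH : seq (triangle R)) : set (R * R -> R) :=
  [set v | L2 Om v /\
    forall T : triangle R, T \in TH -> exists2 q, polynomial2 (scalar_degree fam p) q &
      {ae leb2 R, forall x, otri T x -> v x = q x}].

Definition is_L2_projection (R : realType) (Om : set (R * R))
    (V : set (R * R -> R)) (f g : R * R -> R) : Prop :=
  V g /\ forall v, V v -> ip Om g v = ip Om f v.

Definition mixed_solution (R : realType) (fam : mixed_family) (p : nat)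
    (Om : set (R * R)) (Th : seq (triangle R)) (g : R * R -> R)
    (s : R * R -> R * R) (u : R * R -> R) : Prop :=
  [/\ flux_space fam p Om Th s,
      scalar_space fam p Om Th u,
      (forall t, flux_space fam p Om Th t ->
         vip Om s t - ip Om (wdiv Om t) u = 0) &
      (forall v, scalar_space fam p Om Th v ->
         ip Om (wdiv Om s) v = ip Om g v)].

Definition osc (R : realType) (fh fH : R * R -> R) (TH : seq (triangle R)) : R :=
  Num.sqrt (\sum_(T <- TH)
    diam (tri T) ^+ 2 * L2norm (otri T) (fun x => fh x - fH x) ^+ 2).

(* Main.v *)
(** Let d = f_h - f_H; its mean over each triangle of the coarse triangulation
    vanishes.  If tau is a discrete flux with div tau = d, testing the two mixed
    systems with e = sigma_h - sigma~_h and with tau gives |e|^2 = (e, tau), hence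
    |e| <= |tau|, so it suffices to lift d to a flux with |tau|^2 bounded by
    K * sum_T diam(T)^2 |d|_T^2.

    The lifting is local to each coarse triangle T, with no normal trace on its
    boundary, and goes by recursion on the bisection tree of T: the means of d over
    the two children are balanced by an explicit lowest-order flux across their
    common edge, and what remains has mean zero on both children.  A weighted sum
    of the squared edges is multiplied by at most 3/4 in a bisection, so K does not
    depend on the depth of the tree.  On a leaf, explicit bubbles show that a
    polynomial of mean zero is the divergence of a Raviart-Thomas field without
    normal trace, and finite dimension bounds that field on the reference triangle.

    The weak divergence is only known through smooth test functions; smooth
    cutoffs of piecewise polynomials identify it against the discrete scalars. *)

Require Import Defs.
From HB Require Import structures.
From mathcomp Require Import all_boot all_order all_algebra.
From mathcomp Require Import all_classical all_reals all_analysis.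
From mathcomp Require Import measurable_realfun ring lra.

Import Order.TTheory GRing.Theory Num.Theory.
Import numFieldNormedType.Exports.

Local Open Scope classical_set_scope.
Local Open Scope ring_scope.

Set Implicit Arguments.
Unset Strict Implicit.
Unset Printing Implicit Defensive.

(** * Affine changes of variables in the plane *)

(** The mean of d over a coarse triangle vanishes because the indicator of that triangle lies in
    both scalar spaces, so both projections integrate to the same value there. The obstacle inside a
    triangle is the unbounded depth of its bisection tree: each level adds a flux, and each child
    inherits an edge of its parent, so that the diameter need not decrease in a single bisection.
    The inherited edge becomes the refinement edge of the child. A quadratic form giving weight 1 to
    the refinement edge and 4 to the two others therefore does decrease, and it is at most 1 + 4 + 4
    = 9 times the squared diameter. Subtracting the means on the two children is an orthogonal
    splitting; the squared means split off at each level pay for the flux sent across the median.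
    All fields are Raviart-Thomas of the scalar degree, a space contained in the flux space of
    either family. Absence of normal trace is expressed by integrating by parts against every C1
    function of the plane, without boundary term; extensions by zero can then simply be added. *)

Section affine_change_of_variables.
Context {R : realType}.

(** Measures that agree on the intervals []a, b]] coincide. A negative slope pulls such an interval
    back to one closed on the other side, of the same length. *)
Lemma lebesgue_affine (r c : R) (A : set R) : r != 0 -> measurable A ->
  (`|r|%:E * @lebesgue_measure R ((fun x : R => (r * x + c)%R) @^-1` A) =
   @lebesgue_measure R A)%E.
Proof.
move=> r0 mA.
pose f := fun x : R => r * x + c.
have mf : measurable_fun [set: R] f.
  apply: measurable_funD => //; exact: measurable_funM.
have r0' : 0 <= `|r| by [].
have [mu muE] : exists mu : {measure set (measurableTypeR R) -> \bar R},
    forall A, mu A = (`|r|%:E * @lebesgue_measure R (f @^-1` A))%E.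
  pose m := @measure_function_pushforward__canonical__measure_function_Measure
    _ _ (measurableTypeR R) (measurableTypeR R) R (@lebesgue_measure R) f mf.
  by exists (mscale (NngNum r0') m).
suff E : forall A, measurable A -> @lebesgue_measure R A = mu A by rewrite (E A mA) muE.
apply: lebesgue_measure_unique => X [[a b] /= _ <-].
rewrite muE.
have [rp|rn] : 0 < r \/ r < 0 by move: r0; rewrite neq_lt => /orP[]; [right|left].
- have -> : f @^-1` `]a, b]%classic = `](a - c) / r, (b - c) / r]%classic.
    rewrite predeqE => x /=; rewrite !in_itv /= /f.
    by rewrite ltr_pdivrMr // ler_pdivlMr // ltrBlDr lerBrDr mulrC.
  rewrite !lebesgue_measure_itv /= !lte_fin ltr_pM2r ?invr_gt0// ltrD2r.
  case: ifP => _; last by rewrite mule0.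
  by rewrite -!EFinD -EFinM gtr0_norm//; congr EFin; field.
- have -> : f @^-1` `]a, b]%classic = `[(b - c) / r, (a - c) / r[%classic.
    rewrite predeqE => x /=; rewrite !in_itv /= /f.
    by rewrite ltr_ndivlMr // ler_ndivrMr // ltrBlDr lerBrDr mulrC andbC.
  rewrite !lebesgue_measure_itv /= !lte_fin ltr_nM2r ?invr_lt0// ltrD2r.
  case: ifP => _; last by rewrite mule0.
  by rewrite -!EFinD -EFinM ltr0_norm//; congr EFin; field.
Qed.

Definition affmap (a b e c d f : R) : R * R -> R * R :=
  fun z => (a * z.1 + b * z.2 + e, c * z.1 + d * z.2 + f).

Lemma measurable_affmap a b e c d f : measurable_fun setT (affmap a b e c d f).
Proof.
apply: measurable_fun_pair => /=.
  apply: measurable_funD => //; apply: measurable_funD; apply: measurable_funM => //.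
apply: measurable_funD => //; apply: measurable_funD; apply: measurable_funM => //.
Qed.

(** The change of variables formula for sets, [k] being the determinant of the linear part; stated
    with preimages, it composes without inverting any map. *)
Definition affine_preserves (phi : R * R -> R * R) (k : R) :=
  forall X, measurable X -> (`|k|%:E * leb2 R (phi @^-1` X) = leb2 R X)%E.

Lemma affine_preserves_comp phi psi k l :
  measurable_fun setT phi -> measurable_fun setT psi ->
  affine_preserves phi k -> affine_preserves psi l ->
  affine_preserves (phi \o psi) (k * l).
Proof.
move=> mphi mpsi hphi hpsi X mX.
rewrite -(hphi X mX) normrM EFinM -muleA; congr (_ * _)%E.
rewrite comp_preimage hpsi //.
by rewrite -[_ @^-1` _]setTI; exact: mphi.
Qed.

Lemma affine_preserves_rect phi (k : R) :
  measurable_fun setT phi ->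
  (forall A B : set R, measurable A -> measurable B ->
    (`|k|%:E * leb2 R (phi @^-1` (A `*` B)) =
     @lebesgue_measure R A * @lebesgue_measure R B)%E) ->
  affine_preserves phi k.
Proof.
move=> mphi H X mX.
have r0' : 0 <= `|k| by [].
have [mu muE] : exists mu : {measure set (measurableTypeR R * measurableTypeR R) -> \bar R},
    forall A, mu A = (`|k|%:E * leb2 R (phi @^-1` A))%E.
  pose m := @measure_function_pushforward__canonical__measure_function_Measure
    _ _ (measurableTypeR R * measurableTypeR R)%type
    (measurableTypeR R * measurableTypeR R)%type R (leb2 R) phi mphi.
  by exists (mscale (NngNum r0') m).
rewrite -muE; apply/esym/product_measure_unique => // A B mA mB.
by rewrite muE; exact: H.
Qed.

(** Vertical lines go to vertical lines, so every x-section of the preimage of a rectangle is empty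
    or a one-dimensional affine preimage. *)
Lemma affine_preserves_lower (a e c d f : R) : a != 0 -> d != 0 ->
  affine_preserves (affmap a 0 e c d f) (a * d).
Proof.
move=> a0 d0; apply: affine_preserves_rect (measurable_affmap _ _ _ _ _ _) _ => A B mA mB.
set X := _ @^-1` _.
have mX : measurable X.
  by rewrite -[X]setTI; apply: (measurable_affmap a 0 e c d f) => //; exact: measurableX.
rewrite normrM EFinM -muleA /leb2 /product_measure1.
rewrite -ge0_integralZl //; last exact: measurable_fun_xsection.
pose g := fun x : R => a * x + e.
have mg : measurable_fun [set: R] g.
  by apply: measurable_funD => //; exact: measurable_funM.
have mgA : measurable (g @^-1` A) by rewrite -[_ @^-1` _]setTI; exact: mg.
rewrite (eq_integral (fun x : measurableTypeR R => @lebesgue_measure R B * (\1_(g @^-1` A) x)%:E)%E); last first.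
  move=> x _ /=; rewrite indicE.
  case: (asboolP (A (g x))) => gA.
    have -> : xsection X x = (fun y : R => (d * y + (c * x + f))%R) @^-1` B.
      rewrite predeqE => y; rewrite /xsection /= inE /X /affmap /=.
      rewrite mul0r addr0 -/(g x) (_ : _ + _ + f = d * y + (c * x + f)); last by ring.
      by split => [[]|].
    by rewrite lebesgue_affine // mem_set // mule1.
  have -> : xsection X x = set0.
    rewrite predeqE => y; rewrite /xsection /= inE /X /affmap /=.
    by rewrite mul0r addr0 -/(g x); split => // -[].
  by rewrite measure0 mule0 memNset // mule0.
rewrite ge0_integralZl //; last first.
  by apply/measurable_EFinP; exact: measurable_indic.
by rewrite integral_indic // setIT muleCA lebesgue_affine // muleC.
Qed.

Lemma affine_preserves_upper (a b e d f : R) : a != 0 -> d != 0 ->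
  affine_preserves (affmap a b e 0 d f) (a * d).
Proof.
move=> a0 d0; apply: affine_preserves_rect (measurable_affmap _ _ _ _ _ _) _ => A B mA mB.
set X := _ @^-1` _.
have mX : measurable X.
  by rewrite -[X]setTI; apply: (measurable_affmap a b e 0 d f) => //; exact: measurableX.
have -> : leb2 R X = (@lebesgue_measure R \x^ @lebesgue_measure R)%E X.
  by apply: product_measure_unique => // C D mC mD; exact: product_measure2E.
rewrite mulrC normrM EFinM -muleA /product_measure2.
rewrite -ge0_integralZl //; last exact: measurable_fun_ysection.
pose g := fun x : R => d * x + f.
have mg : measurable_fun [set: R] g.
  by apply: measurable_funD => //; exact: measurable_funM.
have mgB : measurable (g @^-1` B) by rewrite -[_ @^-1` _]setTI; exact: mg.
rewrite (eq_integral (fun x : measurableTypeR R => @lebesgue_measure R A * (\1_(g @^-1` B) x)%:E)%E); last first.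
  move=> y _ /=; rewrite indicE.
  case: (asboolP (B (g y))) => gB.
    have -> : ysection X y = (fun x : R => (a * x + (b * y + e))%R) @^-1` A.
      rewrite predeqE => x; rewrite /ysection /= inE /X /affmap /=.
      by rewrite mul0r add0r -/(g y) -addrA; split => [[]|].
    by rewrite lebesgue_affine // mem_set // mule1.
  have -> : ysection X y = set0.
    rewrite predeqE => x; rewrite /ysection /= inE /X /affmap /=.
    by rewrite mul0r add0r -/(g y); split => // -[].
  by rewrite measure0 mule0 memNset // mule0.
rewrite ge0_integralZl //; last first.
  by apply/measurable_EFinP; exact: measurable_indic.
by rewrite integral_indic // setIT muleCA lebesgue_affine // muleC.
Qed.

(** An LU factorisation reduces the map to the two triangular cases; a zero pivot is repaired by
    adding the second row to the first. *)
Lemma affine_preserves_affmap (a b e c d f : R) : a * d - b * c != 0 ->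
  affine_preserves (affmap a b e c d f) (a * d - b * c).
Proof.
have LU (a' b' e' c' d' f' : R) : a' != 0 -> a' * d' - b' * c' != 0 ->
    affine_preserves (affmap a' b' e' c' d' f') (a' * d' - b' * c').
  move=> a0 D0.
  have -> : affmap a' b' e' c' d' f' =
      affmap 1 0 0 (c' / a') 1 (f' - c' / a' * e') \o
      affmap a' b' e' 0 (d' - b' * c' / a') 0.
    by apply/funext => -[x y]; rewrite /affmap /=; congr pair; field.
  have -> : a' * d' - b' * c' = 1 * 1 * (a' * (d' - b' * c' / a')) by field.
  apply: affine_preserves_comp; try exact: measurable_affmap.
    by apply: affine_preserves_lower; exact: oner_neq0.
  apply: affine_preserves_upper => //.
  apply: contra_neq D0 => h.
  have -> : a' * d' - b' * c' = a' * (d' - b' * c' / a') by field.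
  by rewrite h mulr0.
move=> D0; have [a0|a0] := eqVneq a 0; last exact: LU.
have c0 : c != 0 by apply: contra_neq D0 => ->; rewrite a0 mul0r mulr0 subr0.
have -> : affmap a b e c d f = affmap 1 (-1) 0 0 1 0 \o affmap (a + c) (b + d) (e + f) c d f.
  by apply/funext => -[x y]; rewrite /affmap /=; congr pair; ring.
have -> : a * d - b * c = 1 * 1 * ((a + c) * d - (b + d) * c) by ring.
apply: affine_preserves_comp; try exact: measurable_affmap.
  by apply: affine_preserves_upper; exact: oner_neq0.
apply: LU; first by rewrite a0 add0r.
by rewrite (_ : _ - _ = a * d - b * c) //; ring.
Qed.

End affine_change_of_variables.

(** * Bounded measurable functions of bounded support *)

Section plane_integral.
Context {R : realType}.
Implicit Types f g : R * R -> R.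

Lemma open_measurable_plane (U : set (R * R)) : open U -> measurable U.
Proof.
move=> oU.
pose B (q : rat * rat * (rat * rat)) : set (R * R) :=
  `]ratr q.1.1, ratr q.1.2[%classic `*` `]ratr q.2.1, ratr q.2.2[%classic.
have -> : U = \bigcup_q (if `[< B q `<=` U >] then B q else set0).
  rewrite predeqE => -[x y]; split => [Uxy|[q _]]; last first.
    by case: asboolP => // + Bq; exact.
  have /nbhs_ballP[e /= e0 eU] : nbhs (x, y) U by exact: open_nbhs_nbhs.
  have [q1 Hq1] := @rat_in_itvoo R (x - e) x (ltac:(lra)).
  have [q2 Hq2] := @rat_in_itvoo R x (x + e) (ltac:(lra)).
  have [r1 Hr1] := @rat_in_itvoo R (y - e) y (ltac:(lra)).
  have [r2 Hr2] := @rat_in_itvoo R y (y + e) (ltac:(lra)).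
  move: Hq1 Hq2 Hr1 Hr2; rewrite !in_itv /= => /andP[? ?] /andP[? ?] /andP[? ?] /andP[? ?].
  exists ((q1, q2), (r1, r2)) => //; case: asboolP => [_|[]].
    by split; rewrite /= in_itv /=; apply/andP.
  move=> -[a b] [] /=; rewrite !in_itv /= => /andP[? ?] /andP[? ?].
  by apply: eU; split; rewrite /= /ball /= ltr_norml; apply/andP; split; lra.
apply: countable_bigcupT_measurable; first exact: countableP.
by move=> q; case: ifP => // _; exact: measurableX.
Qed.

Lemma continuous_measurable_plane f : continuous f -> measurable_fun setT f.
Proof.
move=> cf; apply: (measurability _ (RGenOpens.measurableE R)) => //.
move=> _ [_ [a [b ->] <-]]; rewrite setTI; apply: open_measurable_plane.
by move/continuousP : cf; apply; exact: interval_open.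
Qed.

(** Bounded measurable functions vanishing off a square, one [M] serving as both bounds. The class
    is stable under all the operations used below, so that integrals run over the whole plane with
    indicators and are always finite. *)
Definition bm f := measurable_fun setT f /\
  exists M : R, forall x, `|f x| <= M /\ (f x != 0 -> `|x.1| <= M /\ `|x.2| <= M).

Definition J f : R := \int[leb2 R]_x f x.

Definition box (M : R) : set (R * R) := `[- M, M]%classic `*` `[- M, M]%classic.

Lemma boxP M (x : R * R) : box M x <-> `|x.1| <= M /\ `|x.2| <= M.
Proof. by rewrite /box /= !in_itv /= !ler_norml. Qed.

Lemma measurable_box M : measurable (box M).
Proof. exact: measurableX. Qed.

Lemma leb2_box M : (leb2 R (box M) < +oo)%E.
Proof.
pose I : set R := `[- M, M]%classic.
have -> : leb2 R (box M) = (@lebesgue_measure R I * @lebesgue_measure R I)%E.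
  exact: product_measure1E.
rewrite {}/I.
rewrite lte_mul_pinfty ?ge0_fin_numE //.
  by rewrite lebesgue_measure_itv /=; case: ifP => // _; rewrite -EFinB ltry.
by rewrite lebesgue_measure_itv /=; case: ifP => // _; rewrite -EFinB ltry.
Qed.

Lemma bm_integrable f : bm f -> (leb2 R).-integrable setT (EFin \o f).
Proof.
move=> [mf [M HM]].
have -> : EFin \o f = (EFin \o f) \_ (box M).
  apply/funext => x; rewrite patchE; case: ifPn => // /negP nb /=.
  congr EFin; apply: contra_notP nb => /eqP f0; rewrite inE; apply/boxP.
  by have [_] := HM x; exact.
have [+ _] := @integrable_mkcond _ _ _ (leb2 R) (box M) (EFin \o f) (measurable_box M); apply.
apply: measurable_bounded_integrable; [exact: measurable_box|exact: leb2_box|exact: measurable_funTS|].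
by exists M; split; [exact: num_real|move=> y My x _ /=; apply: ltW; apply: le_lt_trans My; have [] := HM x].
Qed.

Lemma bm0 : bm (fun=> 0).
Proof. by split => //; exists 0 => x; rewrite normr0 eqxx. Qed.

Lemma bmD f g : bm f -> bm g -> bm (fun x => f x + g x).
Proof.
move=> [mf [M HM]] [mg [N HN]]; split; first exact: measurable_funD.
exists (M + N) => x; have [fM fb] := HM x; have [gN gb] := HN x.
have M0 : 0 <= M := le_trans (normr_ge0 _) fM.
have N0 : 0 <= N := le_trans (normr_ge0 _) gN.
split; first by rewrite (le_trans (ler_normD _ _)) // lerD.
have [f0|/fb[? ?] _] := eqVneq (f x) 0; last by split; rewrite ler_wpDr.
by rewrite f0 add0r => /gb[? ?]; split; rewrite ler_wpDl.
Qed.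

Lemma bmM f g : bm f -> bm g -> bm (fun x => f x * g x).
Proof.
move=> [mf [M HM]] [mg [N HN]]; split; first exact: measurable_funM.
exists (Num.max (M * N) M) => x; have [fM fb] := HM x; have [gN gb] := HN x.
split; first by rewrite le_max normrM ler_pM.
rewrite mulf_eq0 negb_or => /andP[/fb[? ?] _].
by split; rewrite le_max; apply/orP; right.
Qed.

Lemma bmZ k f : bm f -> bm (fun x => k * f x).
Proof.
move=> [mf [M HM]]; split; first exact: measurable_funM.
exists (Num.max (`|k| * M) M) => x; have [fM fb] := HM x.
split; first by rewrite le_max normrM ler_wpM2l.
rewrite mulf_eq0 negb_or => /andP[_ /fb[? ?]].
by split; rewrite le_max; apply/orP; right.
Qed.

Lemma bmB f g : bm f -> bm g -> bm (fun x => f x - g x).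
Proof.
move=> bf bg; have -> : (fun x => f x - g x) = (fun x => f x + (-1) * g x).
  by apply/funext => x; rewrite mulN1r.
by apply: bmD => //; exact: bmZ.
Qed.

Lemma bm_normr f : bm f -> bm (fun x => `|f x|).
Proof.
move=> [mf [M HM]]; split; first exact: measurableT_comp.
by exists M => x; rewrite normr_id normr_eq0.
Qed.

Lemma bm_sum (I : eqType) (s : seq I) (F : I -> R * R -> R) :
  (forall i, i \in s -> bm (F i)) -> bm (fun x => \sum_(i <- s) F i x).
Proof.
elim: s => [_|i s IH H]; first by under eq_fun do rewrite big_nil; exact: bm0.
under eq_fun do rewrite big_cons; apply: bmD; first exact: H (mem_head _ _).
by apply: IH => j sj; apply: H; rewrite inE sj orbT.
Qed.

Lemma bm_indic (A : set (R * R)) M : measurable A -> A `<=` box M -> bm \1_A.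
Proof.
move=> mA AM; split; first exact: measurable_indic.
exists (Num.max M 1) => x; rewrite indicE; split.
  by case: (x \in A); rewrite ?normr1 ?normr0 le_max ?lexx ?orbT // ler01 orbT.
case: (boolP (x \in A)) => [|_]; last by rewrite eqxx.
by rewrite inE => /AM /boxP[? ?] _; split; rewrite le_max; apply/orP; left.
Qed.

(** The continuous factor may be unbounded in the plane; only its maximum on the compact square
    carrying [f] matters. Polynomials enter the integrals this way. *)
Lemma bmM_continuous f g : bm f -> continuous g -> bm (fun x => f x * g x).
Proof.
move=> [mf [M HM]] cg; split.
  by apply: measurable_funM => //; exact: continuous_measurable_plane.
have /compact_bounded[N [_ HN]] : compact (g @` box M).
  apply: continuous_compact; first exact: continuous_subspaceT.
  by apply: compact_setX; exact: segment_compact.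
pose N' := Num.max (N + 1) 0.
have gN x : box M x -> `|g x| <= N'.
  by move=> bx; rewrite /N' le_max (HN (N + 1)) ?ltrDl //; exists x.
exists (Num.max (M * N') M) => x; have [fM fb] := HM x.
have M0 : 0 <= M := le_trans (normr_ge0 _) fM.
have N0 : 0 <= N' by rewrite /N' le_max lexx orbT.
split; last first.
  rewrite mulf_eq0 negb_or => /andP[/fb[? ?] _].
  by split; rewrite le_max; apply/orP; right.
rewrite le_max; apply/orP; left; rewrite normrM.
have [->|/fb[? ?]] := eqVneq (f x) 0; first by rewrite normr0 mul0r mulr_ge0.
by rewrite ler_pM // gN //; apply/boxP.
Qed.

Lemma JD f g : bm f -> bm g -> J (fun x => f x + g x) = J f + J g.
Proof. by move=> bf bg; rewrite /J RintegralD //; exact: bm_integrable. Qed.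

Lemma JZ k f : bm f -> J (fun x => k * f x) = k * J f.
Proof. by move=> bf; rewrite /J RintegralZl //; exact: bm_integrable. Qed.

Lemma JB f g : bm f -> bm g -> J (fun x => f x - g x) = J f - J g.
Proof. by move=> bf bg; rewrite /J RintegralB //; exact: bm_integrable. Qed.

Lemma J0 : J (fun=> 0) = 0.
Proof. by have := JZ 0 bm0; rewrite !mul0r. Qed.

Lemma Jsum (I : eqType) (s : seq I) (F : I -> R * R -> R) :
  (forall i, i \in s -> bm (F i)) -> J (fun x => \sum_(i <- s) F i x) = \sum_(i <- s) J (F i).
Proof.
elim: s => [_|i s IH H].
  by under eq_fun do rewrite big_nil; rewrite J0 big_nil.
have Hs j : j \in s -> bm (F j) by move=> sj; apply: H; rewrite inE sj orbT.
under eq_fun do rewrite big_cons.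
by rewrite (JD (H _ (mem_head _ _)) (bm_sum Hs)) (IH Hs) big_cons.
Qed.

Lemma J_ge0 f : (forall x, 0 <= f x) -> 0 <= J f.
Proof. by move=> f0; apply: Rintegral_ge0. Qed.

Lemma le_J f g : bm f -> bm g -> (forall x, f x <= g x) -> J f <= J g.
Proof. by move=> bf bg fg; apply: le_Rintegral => //; exact: bm_integrable. Qed.

Lemma ae_leb2W (P Q : R * R -> Prop) : (forall x, P x -> Q x) ->
  {ae leb2 R, forall x, P x} -> {ae leb2 R, forall x, Q x}.
Proof. by move=> PQ; apply: negligibleS => x /=; apply: contra_not; exact: PQ. Qed.

Lemma ae_leb2I (P Q : R * R -> Prop) : {ae leb2 R, forall x, P x} ->
  {ae leb2 R, forall x, Q x} -> {ae leb2 R, forall x, P x /\ Q x}.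
Proof.
move=> hP hQ; rewrite /prop_near1 /nbhs /= /almost_everywhere.
apply: negligibleS (negligibleU hP hQ) => x /= /not_andP[]; [by left|by right].
Qed.

Lemma ae_eq_J f g : bm f -> bm g -> {ae leb2 R, forall x, f x = g x} -> J f = J g.
Proof.
move=> [mf _] [mg _] fg; rewrite /J /Rintegral; congr fine.
apply: ae_eq_integral => //; try exact/measurable_EFinP.
by apply: ae_leb2W fg => x -> _.
Qed.

(** The integral of [(f + t g)^2] is a nonnegative quadratic polynomial in [t], evaluated at its
    minimum. *)
Lemma J_CauchySchwarz f g : bm f -> bm g ->
  J (fun x => f x * g x) ^+ 2 <= J (fun x => f x * f x) * J (fun x => g x * g x).
Proof.
move=> bf bg.
set a := J (fun x => f x * f x); set b := J (fun x => f x * g x).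
set c := J (fun x => g x * g x).
have q t : 0 <= a + (2 * t) * b + t ^+ 2 * c.
  have -> : a + (2 * t) * b + t ^+ 2 * c = J (fun x => f x * f x + (2 * t) * (f x * g x) + t ^+ 2 * (g x * g x)).
    by rewrite !JD ?JZ //; do ?[apply: bmD|apply: bmZ|apply: bmM].
  by apply: J_ge0 => x; rewrite (_ : _ + _ + _ = (f x + t * g x) ^+ 2) ?sqr_ge0 //; ring.
have a0 : 0 <= a by apply: J_ge0 => x; rewrite -expr2 sqr_ge0.
have c0 : 0 <= c by apply: J_ge0 => x; rewrite -expr2 sqr_ge0.
have [c00|c1] := eqVneq c 0.
  rewrite c00 mulr0.
  have [->|b0] := eqVneq b 0; first by rewrite expr0n.
  (* Without quadratic term the polynomial is affine with nonzero slope; at this point it would take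
     the value -1. *)
  have := q (- (a + 1) / (2 * b)); rewrite c00 mulr0 addr0.
  by rewrite (_ : 2 * _ * b = - (a + 1)); [lra|field].
have c1' : 0 < c by rewrite lt_def c1.
have := q (- b / c).
rewrite (_ : _ + _ + _ = (a * c - b ^+ 2) / c); last by field.
by rewrite pmulr_lge0 ?invr_gt0 // subr_ge0.
Qed.

Lemma affmap_bounded (a b e c d f' : R) M : a * d - b * c != 0 ->
  exists N, forall x, box M (affmap a b e c d f' x) -> box N x.
Proof.
set D := _ - _ => D0.
pose B := `|D^-1| * ((`|a| + `|b| + `|c| + `|d|) * (`|M| + `|e| + `|f'|)).
exists B => -[x y] /boxP[/= h1 h2]; apply/boxP => /=.
have key (p q u v s t : R) : `|u| <= M -> `|v| <= M ->
    `|D^-1 * (p * (u - s) - q * (v - t))| <= `|D^-1| * ((`|p| + `|q|) * (`|M| + `|s| + `|t|)).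
  move=> hu hv; rewrite normrM ler_wpM2l //.
  rewrite (le_trans (ler_normB _ _)) // !normrM mulrDl lerD // ler_wpM2l //.
    by have := ler_normB u s; have := ler_norm M; have := normr_ge0 t; lra.
  by have := ler_normB v t; have := ler_norm M; have := normr_ge0 s; lra.
have Ex : x = D^-1 * (d * ((a * x + b * y + e) - e) - b * ((c * x + d * y + f') - f')).
  by rewrite /D; field.
have Ey : y = D^-1 * (a * ((c * x + d * y + f') - f') - c * ((a * x + b * y + e) - e)).
  by rewrite /D; field.
have mono (p q s t : R) : 0 <= p -> 0 <= q -> p <= s -> q <= t ->
    `|D^-1| * (p * q) <= `|D^-1| * (s * t).
  by move=> *; rewrite ler_wpM2l // ler_pM.
split; [rewrite {1}Ex|rewrite {1}Ey]; (apply: le_trans; first exact: key); rewrite /B.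
  by apply: mono; rewrite ?addr_ge0 //; have := normr_ge0 a; have := normr_ge0 c; lra.
by apply: mono; rewrite ?addr_ge0 //; have := normr_ge0 b; have := normr_ge0 d; lra.
Qed.

Lemma bm_affmap (a b e c d f' : R) g : a * d - b * c != 0 ->
  bm g -> bm (g \o affmap a b e c d f').
Proof.
move=> D0 [mg [M HM]]; split.
  by apply: measurableT_comp => //; exact: measurable_affmap.
have [N HN] := @affmap_bounded a b e c d f' M D0.
exists (Num.max M N) => x /=; have [gM gb] := HM (affmap a b e c d f' x).
split; first by rewrite le_max gM.
move=> /gb gx; have /boxP[? ?] := HN x (proj2 (boxP _ _) gx).
by split; rewrite le_max; apply/orP; right.
Qed.

(** The identity of measures gives the nonnegative case; a signed [g] is the difference of the
    nonnegative functions [|g|] and [|g| - g]. *)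
Lemma J_affmap (a b e c d f' : R) g : a * d - b * c != 0 -> bm g ->
  J g = `|a * d - b * c| * J (g \o affmap a b e c d f').
Proof.
move=> D0; set phi := affmap a b e c d f'; set D := _ - _.
have pos h : bm h -> (forall x, 0 <= h x) -> J h = `|D| * J (h \o phi).
  move=> bh h0; have [mh _] := bh.
  have mphi : measurable_fun setT phi by exact: measurable_affmap.
  have r0' : 0 <= `|D| by [].
  pose m := @measure_function_pushforward__canonical__measure_function_Measure
    _ _ (measurableTypeR R * measurableTypeR R)%type
    (measurableTypeR R * measurableTypeR R)%type R (leb2 R) phi mphi.
  rewrite /J /Rintegral (@eq_measure_integral _ _ _ _ (mscale (NngNum r0') m)); last first.
    by move=> A mA _; exact: esym (affine_preserves_affmap e f' D0 mA).
  rewrite ge0_integral_mscale //; last 2 first.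
  - exact/measurable_EFinP.
  - by move=> x _; rewrite lee_fin.
  have -> : (\int[m]_x (h x)%:E = \int[leb2 R]_x ((h \o phi) x)%:E)%E.
    rewrite ge0_integral_pushforward //; first exact/measurable_EFinP.
    by move=> x _; rewrite lee_fin.
  have fin : (\int[leb2 R]_x ((h \o phi) x)%:E)%E \is a fin_num.
    exact: integrable_fin_num (bm_integrable (bm_affmap e f' D0 bh)).
  by rewrite fineM.
move=> bg.
have bn := bm_normr bg.
have E : g = (fun x => `|g x| - (`|g x| - g x)) by apply/funext => x; ring.
rewrite {1}E JB //; last exact: bmB.
rewrite (pos _ bn) // (pos (fun x => `|g x| - g x)); last 2 first.
- exact: bmB.
- by move=> x; rewrite subr_ge0 ler_norm.
rewrite -mulrBr -JB; [|exact: bm_affmap|exact: (bm_affmap e f' D0 (bmB bn bg))].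
by congr (_ * J _); apply/funext => x /=; ring.
Qed.

End plane_integral.

(** * Partial derivatives and the divergence theorem *)

Section directional_derivatives.
Context {R : realType}.
Implicit Types f g p q : R * R -> R.

Lemma continuous_pair (T : topologicalType) (u v : T -> R) :
  continuous u -> continuous v -> continuous (fun t => (u t, v t) : R * R).
Proof. by move=> cu cv t; exact: (cvg_pair (cu t) (cv t)). Qed.

Lemma continuous_comp_pair (T : topologicalType) f (u v : T -> R) :
  continuous f -> continuous u -> continuous v -> continuous (fun t => f (u t, v t)).
Proof.
move=> cf cu cv t; apply: (@continuous_comp _ _ _ (fun t => (u t, v t) : R * R) f).
  exact: continuous_pair.
exact: cf.
Qed.

Lemma continuous_fst : continuous (fst : R * R -> R).
Proof. by move=> z; exact: cvg_fst. Qed.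

Lemma continuous_snd : continuous (snd : R * R -> R).
Proof. by move=> z; exact: cvg_snd. Qed.

(** The partial derivatives are carried as data and taken along one-dimensional slices, the form to
    which the mean value theorem and the fundamental theorem of calculus apply. *)
Definition C1 f p q : Prop := [/\ continuous f, continuous p, continuous q,
  (forall z : R * R, is_derive z.1 (1 : R) (fun s : R => f (s, z.2)) (p z : R)) &
  (forall z : R * R, is_derive z.2 (1 : R) (fun s : R => f (z.1, s)) (q z : R))].

Lemma slice1_quotient f (z : R * R) :
  (fun h : R => h^-1 *: (((fun s => f (s, z.2)) \o shift z.1) (h *: (1 : R)) - f (z.1, z.2))) =
  (fun h : R => h^-1 *: ((f \o shift z) (h *: ((1, 0) : R * R)) - f z)).
Proof.
apply/funext => h; congr (_ *: (_ - _)); last by case: z.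
by rewrite /= /shift /=; congr f; congr pair => /=; rewrite scaler0 add0r.
Qed.

Lemma slice2_quotient f (z : R * R) :
  (fun h : R => h^-1 *: (((fun s => f (z.1, s)) \o shift z.2) (h *: (1 : R)) - f (z.1, z.2))) =
  (fun h : R => h^-1 *: ((f \o shift z) (h *: ((0, 1) : R * R)) - f z)).
Proof.
apply/funext => h; congr (_ *: (_ - _)); last by case: z.
by rewrite /= /shift /=; congr f; congr pair => /=; rewrite scaler0 add0r.
Qed.

Lemma Ck_C1 k f : Ck k.+1 f -> C1 f (d1 f) (d2 f).
Proof.
move=> [cf df1 df2 cd1 cd2].
have Ck0 (j : nat) (h : R * R -> R) : Ck j h -> continuous h by case: j => // j [].
have c1 := Ck0 _ _ cd1; have c2 := Ck0 _ _ cd2.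
split; [exact: cf|exact: c1|exact: c2| |] => z.
- apply: DeriveDef; first by rewrite /derivable slice1_quotient; exact: df1.
  by rewrite /d1 /derive slice1_quotient.
- apply: DeriveDef; first by rewrite /derivable slice2_quotient; exact: df2.
  by rewrite /d2 /derive slice2_quotient.
Qed.

Lemma is_derive_continuous (u du : R -> R) :
  (forall x : R, is_derive x (1 : R) u (du x)) -> continuous u.
Proof.
move=> H x; apply: differentiable_continuous; apply/derivable1_diffP.
by have [] := H x.
Qed.

Lemma MVT_dist (u du : R -> R) (a b : R) :
  (forall x : R, is_derive x (1 : R) u (du x)) ->
  exists c, `|c - a| <= `|b - a| /\ u b - u a = du c * (b - a).
Proof.
move=> H; have cu := is_derive_continuous H.
have [ab|ba] := leP a b.
- have [c + E] := @MVT_segment _ u du a b ab (fun x _ => H x) (continuous_subspaceT cu).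
  rewrite in_itv /= => /andP[? ?]; exists c; split => //.
  by rewrite !ger0_norm ?subr_ge0 // lerD2r.
- have [c + E] := @MVT_segment _ u du b a (ltW ba) (fun x _ => H x) (continuous_subspaceT cu).
  rewrite in_itv /= => /andP[? ?]; exists c; split.
    by rewrite !ler0_norm ?subr_le0 ?lerN2 ?lerD2r // ltW.
  by rewrite -[LHS]opprB E; ring.
Qed.

(** The mean value theorem in each variable separately writes the increment as [z - t] times a
    function of [z] continuous at [t], which is Caratheodory's criterion. The intermediate points
    are squeezed to the base point as [z] tends to [t]. *)
Lemma C1_chain f p q (x y a b t : R) : C1 f p q ->
  is_derive t (1 : R) (fun s : R => f (x + s * a, y + s * b) : R)
    (a * p (x + t * a, y + t * b) + b * q (x + t * a, y + t * b)).
Proof.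
move=> [cf cp cq Hp Hq].
have /choice[xi Hxi] z := @MVT_dist (fun s => f (s, y + z * b)) (fun s => p (s, y + z * b))
  (x + t * a) (x + z * a) (fun s => Hp (s, _)).
have /choice[ze Hze] z := @MVT_dist (fun s => f (x + t * a, s)) (fun s => q (x + t * a, s))
  (y + t * b) (y + z * b) (fun s => Hq (_, s)).
have cvx : xi z @[z --> t] --> x + t * a.
  apply/cvgrPdist_lt => e e0; near=> z.
  rewrite distrC; apply: le_lt_trans (proj1 (Hxi z)) _.
  rewrite (_ : _ - _ = (z - t) * a); last by ring.
  rewrite normrM; apply: (@le_lt_trans _ _ (`|z - t| * (`|a| + 1))).
    by rewrite ler_wpM2l // lerDl.
  rewrite -ltr_pdivlMr ?ltr_wpDl // distrC.
  near: z; apply/nbhs_ballP; exists (e / (`|a| + 1)) => //=.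
  by rewrite divr_gt0 // ltr_wpDl.
have cvy : ze z @[z --> t] --> y + t * b.
  apply/cvgrPdist_lt => e e0; near=> z.
  rewrite distrC; apply: le_lt_trans (proj1 (Hze z)) _.
  rewrite (_ : _ - _ = (z - t) * b); last by ring.
  rewrite normrM; apply: (@le_lt_trans _ _ (`|z - t| * (`|b| + 1))).
    by rewrite ler_wpM2l // lerDl.
  rewrite -ltr_pdivlMr ?ltr_wpDl // distrC.
  near: z; apply/nbhs_ballP; exists (e / (`|b| + 1)) => //=.
  by rewrite divr_gt0 // ltr_wpDl.
have xit : xi t = x + t * a.
  by have [+ _] := Hxi t; rewrite subrr normr0 normr_le0 subr_eq0 => /eqP.
have zet : ze t = y + t * b.
  by have [+ _] := Hze t; rewrite subrr normr0 normr_le0 subr_eq0 => /eqP.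
apply/is_derive1_caratheodory.
exists (fun z => a * p (xi z, y + z * b) + b * q (x + t * a, ze z)); split; last by rewrite xit zet.
- move=> z; rewrite -[LHS](subrKA (f (x + t * a, y + z * b))).
  rewrite (proj2 (Hxi z)) (proj2 (Hze z)); ring.
- have cz : y + z * b @[z --> t] --> y + t * b.
    by apply: cvgD; [exact: cvg_cst|apply: cvgM; [exact: cvg_id|exact: cvg_cst]].
  have cx : x + t * a @[z --> t] --> x + t * a by exact: cvg_cst.
  have K1 : p (xi z, y + z * b) @[z --> t] --> p (x + t * a, y + t * b).
    by move=> A /cp; exact: (cvg_pair cvx cz).
  have K2 : q (x + t * a, ze z) @[z --> t] --> q (x + t * a, y + t * b).
    by move=> A /cq; exact: (cvg_pair cx cvy).
  have K : (fun z => a * p (xi z, y + z * b) + b * q (x + t * a, ze z)) z @[z --> t] -->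
      a * p (x + t * a, y + t * b) + b * q (x + t * a, y + t * b).
    by apply: cvgD; apply: cvgM; [exact: cvg_cst|exact: K1|exact: cvg_cst|exact: K2].
  by rewrite -{2}xit -{2}zet in K.
Unshelve. all: by end_near. Qed.

Lemma continuous_affmap (a b e c d f' : R) : continuous (affmap a b e c d f').
Proof.
apply: continuous_pair => z; (apply: cvgD; last exact: cvg_cst); apply: cvgD; apply: cvgM;
  do ?[exact: cvg_cst|exact: continuous_fst|exact: continuous_snd].
Qed.

Lemma continuousD_plane f g : continuous f -> continuous g -> continuous (fun z => f z + g z).
Proof. by move=> cf cg z; apply: cvgD; [exact: cf|exact: cg]. Qed.

Lemma continuousM_plane f g : continuous f -> continuous g -> continuous (fun z => f z * g z).
Proof. by move=> cf cg z; apply: cvgM; [exact: cf|exact: cg]. Qed.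

Lemma C1_affmap f p q (a b e c d f' : R) : C1 f p q ->
  C1 (f \o affmap a b e c d f')
     (fun z => a * p (affmap a b e c d f' z) + c * q (affmap a b e c d f' z))
     (fun z => b * p (affmap a b e c d f' z) + d * q (affmap a b e c d f' z)).
Proof.
move=> Hf; have [cf cp cq _ _] := Hf.
have ca := @continuous_affmap a b e c d f'.
have cc (h : R * R -> R) : continuous h -> continuous (fun z => h (affmap a b e c d f' z)).
  by move=> ch z; apply: continuous_comp; [exact: ca|exact: ch].
split; do ?[exact: cc|apply: continuousD_plane; apply: continuousM_plane => //; try exact: cc; move=> ?; exact: cvg_cst] => -[x y] /=.
- have E (r : R) : affmap a b e c d f' (r, y) = (b * y + e + r * a, d * y + f' + r * c).
    by rewrite /affmap /=; congr pair; ring.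
  have -> : (fun r => f (affmap a b e c d f' (r, y))) =
      (fun r => f (b * y + e + r * a, d * y + f' + r * c)).
    by apply/funext => r; rewrite E.
  by rewrite E; exact: C1_chain.
- have E (r : R) : affmap a b e c d f' (x, r) = (a * x + e + r * b, c * x + f' + r * d).
    by rewrite /affmap /=; congr pair; ring.
  have -> : (fun r => f (affmap a b e c d f' (x, r))) =
      (fun r => f (a * x + e + r * b, c * x + f' + r * d)).
    by apply/funext => r; rewrite E.
  by rewrite E; exact: C1_chain.
Qed.

Lemma C1M f p q g (r s : R * R -> R) : C1 f p q -> C1 g r s ->
  C1 (fun z => f z * g z) (fun z => f z * r z + g z * p z) (fun z => f z * s z + g z * q z).
Proof.
move=> [cf cp cq fp fq] [cg cr cs gr gs]; split.
1-3: by do ?[apply: continuousD_plane|apply: continuousM_plane].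
- move=> z; have := is_deriveM (fp z) (gr z).
  by case: z.
- move=> z; have := is_deriveM (fq z) (gs z).
  by case: z.
Qed.

Lemma C1D f p q g (r s : R * R -> R) : C1 f p q -> C1 g r s ->
  C1 (fun z => f z + g z) (fun z => p z + r z) (fun z => q z + s z).
Proof.
move=> [cf cp cq fp fq] [cg cr cs gr gs]; split.
1-3: by do ?[apply: continuousD_plane|apply: continuousM_plane].
- by move=> z; exact: is_deriveD (fp z) (gr z).
- by move=> z; exact: is_deriveD (fq z) (gs z).
Qed.

Lemma C1_cst (k : R) : C1 (fun=> k) (fun=> 0) (fun=> 0).
Proof. by split; try (by move=> z; exact: cvg_cst); move=> z; exact: is_derive_cst. Qed.

Lemma C1_fst : C1 fst (fun=> 1) (fun=> 0).
Proof.
split; try (by move=> z; exact: cvg_cst); first exact: continuous_fst.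
- by move=> z /=; exact: is_derive_id.
- by move=> z /=; exact: is_derive_cst.
Qed.

Lemma C1_snd : C1 snd (fun=> 0) (fun=> 1).
Proof.
split; try (by move=> z; exact: cvg_cst); first exact: continuous_snd.
- by move=> z /=; exact: is_derive_cst.
- by move=> z /=; exact: is_derive_id.
Qed.

End directional_derivatives.

(** * Green's formula on the reference triangle *)

Section green_formula.
Context {R : realType}.
Implicit Types f g h : R * R -> R.

Lemma FTC_open (u du : R -> R) (a b : R) : a < b -> continuous du ->
  (forall x : R, is_derive x (1 : R) u (du x)) ->
  (\int[@lebesgue_measure R]_(x in `]a, b[) (du x)%:E = (u b - u a)%:E)%E.
Proof.
move=> ab cdu Hu; have cu := is_derive_continuous Hu.
rewrite -(@integral_itv_bndoo _ a b _ true false); last first.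
  by apply/measurable_EFinP/measurable_funTS; exact: continuous_measurable_fun.
rewrite (@continuous_FTC2 _ du u a b ab) //.
- exact: continuous_subspaceT.
- split.
  + by move=> x _; have [] := Hu x.
  + exact/cvg_at_right_filter/cu.
  + exact/cvg_at_left_filter/cu.
- by move=> x _; rewrite derive1E; have [_ ] := Hu x.
Qed.

(** The open reference triangle; its hypotenuse will correspond to the refinement edge. *)
Definition Rf : set (R * R) := [set z | [/\ 0 < z.1, 0 < z.2 & z.1 + z.2 < 1]].

Lemma open_gt0 f : continuous f -> open [set z | 0 < f z].
Proof.
move=> /continuousP cf; rewrite (_ : [set _ | _] = f @^-1` [set x | 0 < x]) //.
by apply: cf; exact: open_gt.
Qed.

Lemma open_Rf : open Rf.
Proof.
have -> : Rf = [set z | 0 < z.1] `&` ([set z | 0 < z.2] `&` [set z | 0 < 1 - (z.1 + z.2)]).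
  by rewrite predeqE => z; rewrite /Rf /= subr_gt0; split => [[]|[? []]].
apply: openI; first by apply: open_gt0; exact: continuous_fst.
apply: openI; apply: open_gt0; first exact: continuous_snd.
move=> z; apply: cvgB; first exact: cvg_cst.
by apply: cvgD; [exact: continuous_fst|exact: continuous_snd].
Qed.

Lemma bm_Rf : bm (\1_Rf : R * R -> R).
Proof.
apply: (@bm_indic _ _ 1); first exact: open_measurable_plane open_Rf.
move=> z [z1 z2 z3]; apply/boxP; rewrite !gtr0_norm //; split; lra.
Qed.

Lemma Rf_fst (x y : R) : Rf (x, y) <-> 0 < y < 1 /\ 0 < x < 1 - y.
Proof.
rewrite /Rf /=; split => [[? ? ?]|[/andP[? ?] /andP[? ?]]]; last by split; lra.
by split; apply/andP; split; lra.
Qed.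

Lemma Rf_snd (x y : R) : Rf (x, y) <-> 0 < x < 1 /\ 0 < y < 1 - x.
Proof.
rewrite /Rf /=; split => [[? ? ?]|[/andP[? ?] /andP[? ?]]]; last by split; lra.
by split; apply/andP; split; lra.
Qed.

Lemma continuous_slice1 f y : continuous f -> continuous (fun x : R => f (x, y)).
Proof. by move=> cf; apply: continuous_comp_pair => // t; [exact: cvg_id|exact: cvg_cst]. Qed.

Lemma continuous_slice2 f x : continuous f -> continuous (fun y : R => f (x, y)).
Proof. by move=> cf; apply: continuous_comp_pair => // t; [exact: cvg_cst|exact: cvg_id]. Qed.

Lemma continuous_onem : continuous (fun t : R => 1 - t).
Proof. by move=> t; apply: cvgB; [exact: cvg_cst|exact: cvg_id]. Qed.

Lemma integral_open_unit (u : R -> R) : continuous u ->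
  fine (\int[@lebesgue_measure R]_(x in `]0%R, 1%R[) (u x)%:E) =
  \int[@lebesgue_measure R]_(x in `[0, 1]) u x.
Proof.
move=> cu; rewrite /Rintegral -(@integral_itv_bndoo _ 0 1 _ true false) //.
by apply/measurable_EFinP/measurable_funTS; exact: continuous_measurable_fun.
Qed.

(** Fubini, then the fundamental theorem on each vertical slice: the lower end contributes nothing
    and the upper end lies on the hypotenuse. *)
Lemma green_snd h g : continuous h -> continuous g ->
  (forall z : R * R, is_derive z.2 (1 : R) (fun s : R => h (z.1, s)) (g z : R)) ->
  (forall x, h (x, 0) = 0) ->
  J (fun z => \1_Rf z * g z) = \int[@lebesgue_measure R]_(t in `[0, 1]) h (t, 1 - t).
Proof.
move=> ch cg Hg h0.
have bf : bm (fun z => \1_Rf z * g z) by apply: bmM_continuous => //; exact: bm_Rf.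
rewrite /J [LHS]/Rintegral -(integral12_prod_meas1 (bm_integrable bf)).
rewrite -integral_open_unit; last first.
  by apply: continuous_comp_pair => //; [move=> t; exact: cvg_id|exact: continuous_onem].
congr fine; rewrite [RHS]integral_mkcond; apply: eq_integral => x _.
rewrite /fubini_F patchE; case: ifPn => [|/negP]; rewrite inE /= in_itv /=.
  move=> /andP[x0 x1].
  have -> : (h (x, 1 - x))%:E = (h (x, 1 - x) - h (x, 0))%:E by rewrite h0 subr0.
  have x1' : 0 < 1 - x by rewrite subr_gt0.
  have /= <- := @FTC_open (fun y => h (x, y)) _ _ _ x1' (@continuous_slice2 g x cg) (fun y => Hg (x, y)).
  rewrite [RHS]integral_mkcond; apply: eq_integral => y _.
  rewrite patchE /= indicE; case: ifPn => [|/negP]; rewrite inE /= in_itv /= => H.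
    by rewrite mem_set ?mul1r //; apply/Rf_snd; rewrite x0 x1.
  by rewrite memNset ?mul0r // => /Rf_snd[].
move=> H; apply: integral0_eq => y _ /=.
by rewrite indicE memNset ?mul0r // => /Rf_snd[].
Qed.

Lemma green_fst h g : continuous h -> continuous g ->
  (forall z : R * R, is_derive z.1 (1 : R) (fun s : R => h (s, z.2)) (g z : R)) ->
  (forall y, h (0, y) = 0) ->
  J (fun z => \1_Rf z * g z) = \int[@lebesgue_measure R]_(t in `[0, 1]) h (t, 1 - t).
Proof.
move=> ch cg Hg h0.
have bf : bm (fun z => \1_Rf z * g z) by apply: bmM_continuous => //; exact: bm_Rf.
rewrite /J [LHS]/Rintegral -(integral21_prod_meas1 (bm_integrable bf)).
have cht : continuous (fun t : R => h (t, 1 - t)).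
  by apply: continuous_comp_pair => //; [move=> t; exact: cvg_id|exact: continuous_onem].
have cht' : continuous (fun t : R => h (1 - t, t)).
  by apply: continuous_comp_pair => //; [exact: continuous_onem|move=> t; exact: cvg_id].
(* Horizontal slices parametrise the hypotenuse by its second coordinate; the substitution of
   [1 - t] for [t] restores the common parametrisation. *)
transitivity (\int[@lebesgue_measure R]_(t in `[0, 1]) h (1 - t, t)); last first.
  rewrite [RHS](@Rintegration_by_substitution_onem R (fun t => h (t, 1 - t)) 1).
  - rewrite /unstable.onem subrr; apply: eq_Rintegral => t _.
    by congr h; congr pair; ring.
  - by rewrite ler01 lexx.
  - exact: continuous_subspaceT.
rewrite -integral_open_unit //.
congr fine; rewrite [RHS]integral_mkcond; apply: eq_integral => y _.
rewrite /fubini_G patchE; case: ifPn => [|/negP]; rewrite inE /= in_itv /=.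
  move=> /andP[y0 y1].
  have -> : (h (1 - y, y))%:E = (h (1 - y, y) - h (0, y))%:E by rewrite h0 subr0.
  have y1' : 0 < 1 - y by rewrite subr_gt0.
  have /= <- := @FTC_open (fun x => h (x, y)) _ _ _ y1' (@continuous_slice1 g y cg) (fun x => Hg (x, y)).
  rewrite [RHS]integral_mkcond; apply: eq_integral => x _.
  rewrite patchE /= indicE; case: ifPn => [|/negP]; rewrite inE /= in_itv /= => H.
    by rewrite mem_set ?mul1r //; apply/Rf_fst; rewrite y0 y1.
  by rewrite memNset ?mul0r // => /Rf_fst[].
move=> H; apply: integral0_eq => x _ /=.
by rewrite indicE memNset ?mul0r // => /Rf_fst[].
Qed.

Lemma continuous_itv01_integrable (u : R -> R) : continuous u ->
  (@lebesgue_measure R).-integrable `[0, 1] (EFin \o u).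
Proof.
move=> cu; apply: continuous_compact_integrable; first exact: segment_compact.
exact: continuous_subspaceT.
Qed.

(** The two vanishing conditions say that the field has no normal component on the legs; along the
    hypotenuse [(1, 1) dt] is the outer normal times arc length. *)
Lemma green_ref h1 p1 q1 h2 p2 q2 : C1 h1 p1 q1 -> C1 h2 p2 q2 ->
  (forall y, h1 (0, y) = 0) -> (forall x, h2 (x, 0) = 0) ->
  J (fun z => \1_Rf z * (p1 z + q2 z)) =
  \int[@lebesgue_measure R]_(t in `[0, 1]) (h1 (t, 1 - t) + h2 (t, 1 - t)).
Proof.
move=> [ch1 cp1 _ H1 _] [ch2 _ cq2 _ H2] h10 h20.
have cht h : continuous h -> continuous (fun t : R => h (t, 1 - t)).
  move=> ch.
  by apply: continuous_comp_pair => //; [move=> t; exact: cvg_id|exact: continuous_onem].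
rewrite RintegralD //; try by apply: continuous_itv01_integrable; exact: cht.
rewrite -(green_fst ch1 cp1) // -(green_snd ch2 cq2) // -JD; last 2 first.
- by apply: bmM_continuous => //; exact: bm_Rf.
- by apply: bmM_continuous => //; exact: bm_Rf.
by congr J; apply/funext => z; rewrite mulrDr.
Qed.

(** The divergence theorem for the field [z / 2], whose divergence is 1. *)
Lemma J_Rf : J (\1_Rf : R * R -> R) = 2^-1.
Proof.
have := @green_ref (fun z => z.1 * 2^-1) (fun z => z.1 * 0 + 2^-1 * 1) (fun z => z.1 * 0 + 2^-1 * 0)
   (fun z => z.2 * 2^-1) (fun z => z.2 * 0 + 2^-1 * 0) (fun z => z.2 * 0 + 2^-1 * 1)
   (C1M C1_fst (C1_cst _)) (C1M C1_snd (C1_cst _)).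
rewrite /= => H; have {H}/= := H (fun _ => mul0r _) (fun _ => mul0r _).
rewrite (_ : (fun z => _) = \1_Rf) => [->|]; last by apply/funext => z; field.
transitivity (\int[@lebesgue_measure R]_(t in `[0, 1]) (2^-1 : R)).
  by apply: eq_Rintegral => t _; field.
have E : fine (@lebesgue_measure R [set` `[0%R, 1%R]]) = 1.
  by rewrite lebesgue_measure_itv /= lte_fin ltr01 oppr0 adde0.
by rewrite Rintegral_cst // [X in _ * X]E mulr1.
Qed.

Lemma line_null (a b c : R) : (a != 0) || (b != 0) ->
  (leb2 R).-negligible [set z : R * R | a * z.1 + b * z.2 = c].
Proof.
move=> ab; set L := [set _ | _].
have mL : measurable L.
  have -> : L = (fun z : R * R => a * z.1 + b * z.2) @^-1` [set c] by [].
  rewrite -[_ @^-1` _]setTI; apply: (continuous_measurable_plane (f := fun z => a * z.1 + b * z.2)) => //.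
  by apply: continuousD_plane; apply: continuousM_plane;
    do ?[exact: continuous_fst|exact: continuous_snd|move=> z; exact: cvg_cst].
exists L; split => //.
have [b0|b0] := eqVneq b 0.
  have a0 : a != 0 by move: ab; rewrite b0 eqxx orbF.
  have -> : L = [set c / a] `*` setT.
    rewrite predeqE => -[x y]; rewrite /L /= b0 mul0r addr0; split => [<-|[-> _]].
      by split => //; field.
    by field.
  have -> : (leb2 R ([set (c / a)%R] `*` setT) = @lebesgue_measure R [set (c / a)%R] * @lebesgue_measure R setT)%E.
    exact: product_measure1E.
  by rewrite lebesgue_measure_set1 mul0e.
rewrite /leb2 /product_measure1; apply: integral0_eq => x _ /=.
have -> : xsection L x = [set (c - a * x) / b].
  rewrite predeqE => y; rewrite /xsection /= inE /L /=; split => [<-|->]; by field.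
by rewrite lebesgue_measure_set1.
Qed.

End green_formula.

(** * Triangles and bisection *)

Section triangles.
Context {R : realType}.
Implicit Types (T : triangle R) (x y z : R * R).

Definition det T : R :=
  (T.1.2.1 - T.1.1.1) * (T.2.2 - T.1.1.2) - (T.2.1 - T.1.1.1) * (T.1.2.2 - T.1.1.2).

Lemma nondegenerateE T : Defs.nondegenerate T <-> det T != 0.
Proof. by rewrite /Defs.nondegenerate /det [X in _ - X]mulrC. Qed.

(** The origin goes to the newest vertex, and the ends of the hypotenuse to the ends of the
    refinement edge. *)
Definition toT T : R * R -> R * R :=
  affmap (T.1.2.1 - T.1.1.1) (T.2.1 - T.1.1.1) T.1.1.1
         (T.1.2.2 - T.1.1.2) (T.2.2 - T.1.1.2) T.1.1.2.

Definition ofT T : R * R -> R * R :=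
  affmap ((T.2.2 - T.1.1.2) / det T) (- (T.2.1 - T.1.1.1) / det T)
    (((T.2.1 - T.1.1.1) * T.1.1.2 - (T.2.2 - T.1.1.2) * T.1.1.1) / det T)
    (- (T.1.2.2 - T.1.1.2) / det T) ((T.1.2.1 - T.1.1.1) / det T)
    (((T.1.2.2 - T.1.1.2) * T.1.1.1 - (T.1.2.1 - T.1.1.1) * T.1.1.2) / det T).

Lemma toTK T : det T != 0 -> cancel (toT T) (ofT T).
Proof.
by move=> D0 [u v]; rewrite /toT /ofT /affmap /=; congr pair; move: D0; rewrite /det => D0; field.
Qed.

Lemma ofTK T : det T != 0 -> cancel (ofT T) (toT T).
Proof.
by move=> D0 [u v]; rewrite /toT /ofT /affmap /=; congr pair; move: D0; rewrite /det => D0; field.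
Qed.

(** The open triangle as an affine image rather than a topological interior: membership amounts to
    three linear inequalities in reference coordinates. *)
Definition pt T : set (R * R) := toT T @` Rf.

Lemma ptE T x : det T != 0 -> pt T x <-> Rf (ofT T x).
Proof.
move=> D0; split => [[y ? <-]|?]; first by rewrite toTK.
by exists (ofT T x) => //; rewrite ofTK.
Qed.

Lemma triE T x : tri T x <->
  exists y, [/\ 0 <= y.1, 0 <= y.2, y.1 + y.2 <= 1 & x = toT T y].
Proof.
split => [[a [b [c [a0 b0 c0 abc ->]]]]|[y [y1 y2 y12 ->]]].
  exists (b, c); split => //=; first lra.
  have -> : a = 1 - b - c by lra.
  rewrite /toT /affmap; case: T => [[[p1 p2] [q1 q2]] [r1 r2]] /=; congr pair => /=;
  rewrite /GRing.scale /=; ring.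
exists (1 - y.1 - y.2), y.1, y.2; split; [lra|exact: y1|exact: y2|lra|].
rewrite /toT /affmap; case: T => [[[p1 p2] [q1 q2]] [r1 r2]] /=; congr pair => /=;
rewrite /GRing.scale /=; ring.
Qed.

Lemma continuous_ofT T : continuous (ofT T).
Proof. exact: continuous_affmap. Qed.

Lemma open_pt T : det T != 0 -> open (pt T).
Proof.
move=> D0; have -> : pt T = ofT T @^-1` Rf by rewrite predeqE => x; exact: ptE.
by move/continuousP : (@continuous_ofT T); apply; exact: open_Rf.
Qed.

Lemma pt_sub_tri T : pt T `<=` tri T.
Proof.
move=> _ [y [y1 y2 y12] <-]; apply/triE; exists y; split => //; exact: ltW.
Qed.

Lemma pt_sub_otri T : det T != 0 -> pt T `<=` otri T.
Proof.
move=> D0; rewrite /otri -open_subsetE; [exact: pt_sub_tri|exact: open_pt].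
Qed.

Lemma otri_sub_tri T : otri T `<=` tri T.
Proof. exact: interior_subset. Qed.

Lemma ofT_line_null T (p q r : R) : det T != 0 -> (p != 0) || (q != 0) ->
  (leb2 R).-negligible [set x | p * (ofT T x).1 + q * (ofT T x).2 = r].
Proof.
move=> D0 pq.
set a := T.1.2.1 - T.1.1.1; set b := T.2.1 - T.1.1.1.
set c := T.1.2.2 - T.1.1.2; set d := T.2.2 - T.1.1.2.
have DE : det T = a * d - b * c by [].
(* These are the coefficients of the pulled back line, multiplied by [det T]; an invertible matrix
   cannot send [(p, q)] to zero. *)
have ab : (p * d - q * c != 0) || (q * a - p * b != 0).
  apply: contraT; rewrite negb_or !negbK => /andP[/eqP h1 /eqP h2].
  have hp : p * det T = 0.
    have -> : p * det T = a * (p * d - q * c) + c * (q * a - p * b) by rewrite DE; ring.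
    by rewrite h1 h2; ring.
  have hq : q * det T = 0.
    have -> : q * det T = b * (p * d - q * c) + d * (q * a - p * b) by rewrite DE; ring.
    by rewrite h1 h2; ring.
  move: pq; move/eqP : hp; rewrite mulf_eq0 (negbTE D0) orbF => ->.
  by move/eqP : hq; rewrite mulf_eq0 (negbTE D0) orbF => ->.
apply: negligibleS (line_null
  (r * det T - (p * (b * T.1.1.2 - d * T.1.1.1) + q * (c * T.1.1.1 - a * T.1.1.2))) ab) => x /= <-.
rewrite /ofT /affmap /= -/a -/b -/c -/d; field; exact: D0.
Qed.

Lemma tri_pt_null T : det T != 0 -> (leb2 R).-negligible (tri T `\` pt T).
Proof.
move=> D0.
have h1 := @ofT_line_null T 1 0 0 D0; have h2 := @ofT_line_null T 0 1 0 D0.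
have h3 := @ofT_line_null T 1 1 1 D0.
apply: negligibleS (negligibleU (h1 _) (negligibleU (h2 _) (h3 _))); try by rewrite oner_neq0 ?orbT.
move=> x [/triE[y [y1 y2 y12 xE]] npt]; have E : ofT T x = y by rewrite xE toTK.
rewrite /setU /mkset E; apply: contra_notP npt => /not_orP[n1 /not_orP[n2 n3]].
exists y; rewrite ?xE //; split.
- by rewrite lt_def y1 andbT; apply/eqP => h; apply: n1; lra.
- by rewrite lt_def y2 andbT; apply/eqP => h; apply: n2; lra.
- by rewrite lt_def y12 andbT; apply/eqP => h; apply: n3; lra.
Qed.

Lemma bm_pt T : det T != 0 -> bm (\1_(pt T) : R * R -> R).
Proof.
move=> D0.
have -> : (\1_(pt T) : R * R -> R) = \1_Rf \o ofT T.
  by apply/funext => x /=; rewrite !indicE; congr (nat_of_bool _)%:R; apply/asbool_equiv_eq; exact: ptE.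
apply: bm_affmap; last exact: bm_Rf.
rewrite (_ : _ - _ = (det T)^-1); first by rewrite invr_eq0.
by move: D0; rewrite /det => D0; field.
Qed.

Lemma indic_pt_toT T y : det T != 0 -> \1_(pt T) (toT T y) = \1_Rf y :> R.
Proof.
move=> D0; rewrite !indicE; congr (nat_of_bool _)%:R; apply/asbool_equiv_eq.
by rewrite ptE // toTK.
Qed.

Lemma J_toT T h : det T != 0 -> bm h -> J h = `|det T| * J (h \o toT T).
Proof. by move=> D0 bh; exact: J_affmap. Qed.

Lemma J_pt T : det T != 0 -> J (\1_(pt T) : R * R -> R) = `|det T| / 2.
Proof.
move=> D0; rewrite (J_toT D0) ?bm_pt //; last exact: bm_pt.
rewrite -J_Rf; congr (_ * J _); apply/funext => y /=; exact: indic_pt_toT.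
Qed.

(** The contravariant Piola transform without its factor 1/det: the divergence of the image is the
    reference divergence composed with [ofT T], with no rescaling. *)
Definition piola T (h1 h2 : R * R -> R) : R * R -> R * R := fun x =>
  ((T.1.2.1 - T.1.1.1) * h1 (ofT T x) + (T.2.1 - T.1.1.1) * h2 (ofT T x),
   (T.1.2.2 - T.1.1.2) * h1 (ofT T x) + (T.2.2 - T.1.1.2) * h2 (ofT T x)).

Lemma continuous_piola T (h1 h2 : R * R -> R) : continuous h1 -> continuous h2 ->
  continuous (fun x => (piola T h1 h2 x).1) /\ continuous (fun x => (piola T h1 h2 x).2).
Proof.
have cc (h : R * R -> R) : continuous h -> continuous (fun x => h (ofT T x)).
  by move=> ch x; apply: continuous_comp; [exact: continuous_ofT|exact: ch].
by move=> /cc c1 /cc c2; split; apply: continuousD_plane; apply: continuousM_plane => // ?; exact: cvg_cst.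
Qed.

(** The field is tangential on the two sides meeting at [T.1.1], so only the opposite side keeps a
    boundary term. The Piola transform and the chain rule for [phi] make this the reference formula
    multiplied by the Jacobian. *)
Lemma green_pt T (h1 p1 q1 h2 p2 q2 phi p q : R * R -> R) : det T != 0 ->
  C1 h1 p1 q1 -> C1 h2 p2 q2 -> C1 phi p q ->
  (forall s : R, h1 (0, s) = 0) -> (forall s : R, h2 (s, 0) = 0) ->
  J (fun x => \1_(pt T) x * ((piola T h1 h2 x).1 * p x + (piola T h1 h2 x).2 * q x)) =
  `|det T| * \int[@lebesgue_measure R]_(t in `[0, 1])
    ((h1 (t, 1 - t) + h2 (t, 1 - t)) * phi (toT T (t, 1 - t)))
  - J (fun x => \1_(pt T) x * ((p1 (ofT T x) + q2 (ofT T x)) * phi x)).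
Proof.
move=> D0 Ch1 Ch2 Cphi h10 h20.
have Cphi' := C1_affmap (T.1.2.1 - T.1.1.1) (T.2.1 - T.1.1.1) T.1.1.1
         (T.1.2.2 - T.1.1.2) (T.2.2 - T.1.1.2) T.1.1.2 Cphi.
have [cphi cp cq _ _] := Cphi; have [ch1 cp1 _ _ _] := Ch1; have [ch2 _ cq2 _ _] := Ch2.
have [ct1 ct2] := continuous_piola T ch1 ch2.
have cc (h : R * R -> R) : continuous h -> continuous (fun x => h (ofT T x)).
  by move=> ch x; apply: continuous_comp; [exact: continuous_ofT|exact: ch].
have b1 : bm (fun x => \1_(pt T) x * ((piola T h1 h2 x).1 * p x + (piola T h1 h2 x).2 * q x)).
  apply: bmM_continuous; first exact: bm_pt.
  by apply: continuousD_plane; exact: continuousM_plane.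
have b2 : bm (fun x => \1_(pt T) x * ((p1 (ofT T x) + q2 (ofT T x)) * phi x)).
  apply: bmM_continuous; first exact: bm_pt.
  by apply: continuousM_plane => //; apply: continuousD_plane; exact: cc.
rewrite (J_toT D0 b1) (J_toT D0 b2) -mulrBr; congr (_ * _).
have G := green_ref (C1M Ch1 Cphi') (C1M Ch2 Cphi').
have {}G := G (fun s : R => etrans (congr1 ( *%R^~ _) (h10 s)) (mul0r _))
  (fun s : R => etrans (congr1 ( *%R^~ _) (h20 s)) (mul0r _)).
transitivity (\int[@lebesgue_measure R]_(t in `[0, 1])
    (h1 (t, 1 - t) * phi (toT T (t, 1 - t)) + h2 (t, 1 - t) * phi (toT T (t, 1 - t))) -
    J ((fun x => \1_(pt T) x * ((p1 (ofT T x) + q2 (ofT T x)) * phi x)) \o toT T)); last first.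
  by congr (_ - _); apply: eq_Rintegral => t _; rewrite mulrDl.
rewrite -G -JB.
- congr J; apply/funext => y /=; rewrite indic_pt_toT // /piola /= toTK // -/(toT T y); ring.
- apply: bmM_continuous; first exact: bm_Rf.
  have [? ? ? _ _] := Cphi'.
  by apply: continuousD_plane; apply: continuousD_plane; exact: continuousM_plane.
- exact: bm_affmap.
Qed.

End triangles.

(** * Newest vertex bisection and its trees *)

Section bisection.
Context {R : realType}.
Implicit Types (T : triangle R) (x y z : R * R).

Lemma ofT_vertices T v : det T != 0 -> v \in vertices T ->
  [\/ ofT T v = (0, 0), ofT T v = (1, 0) | ofT T v = (0, 1)].
Proof.
move=> D0; rewrite /vertices !inE => /or3P[] /eqP ->;
  [apply: Or31|apply: Or32|apply: Or33]; move: D0; rewrite /ofT /affmap /det => D0;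
  by congr pair => /=; field.
Qed.

Lemma ofT_segment T a b z : segment a b z ->
  exists t : R, [/\ 0 <= t, t <= 1, (ofT T z).1 = (1 - t) * (ofT T a).1 + t * (ofT T b).1 &
    (ofT T z).2 = (1 - t) * (ofT T a).2 + t * (ofT T b).2].
Proof.
move=> [t [/andP[t0 t1] ->]]; exists t; split => //; rewrite /ofT /affmap /=;
  case: a => a1 a2; case: b => b1 b2 /=; rewrite /GRing.scale /=; ring.
Qed.

Lemma vertex_notin_pt T v : det T != 0 -> v \in vertices T -> ~ pt T v.
Proof.
by move=> D0 /(ofT_vertices D0) H /(ptE _ D0) [h1 h2 h3]; case: H => E; rewrite E /= in h1 h2 h3; clear E; lra.
Qed.

Lemma edge_notin_pt T a b z : det T != 0 -> a \in vertices T -> b \in vertices T ->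
  a != b -> segment a b z -> ~ pt T z.
Proof.
move=> D0 /(ofT_vertices D0) Ha /(ofT_vertices D0) Hb ab.
have nab : ofT T a <> ofT T b.
  by move=> /(congr1 (toT T)); rewrite !ofTK //; apply/eqP.
move=> /(ofT_segment T)[t [t0 t1 E1 E2]] /(ptE _ D0) [].
rewrite E1 E2; move: nab.
by case: Ha => ->; case: Hb => -> //= _; lra.
Qed.

(** A point common to two distinct triangles is a vertex or lies on an edge of the first one, where
    some barycentric coordinate vanishes. *)
Lemma conforming_pt_disjoint (TH : seq (triangle R)) T T' :
  (forall S, S \in TH -> det S != 0) -> conforming TH ->
  T \in TH -> T' \in TH -> T <> T' -> forall x, pt T x -> ~ pt T' x.
Proof.
move=> nd cf iT iT' TT' x px px'.
have xI : (tri T `&` tri T') x by split; exact: pt_sub_tri.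
case: (cf T T' iT iT' TT') => [E|[v [v1 v2 E]]|[a [b [ab /andP[a1 b1] _ E]]]].
- by rewrite E in xI.
- rewrite E in xI; rewrite /set1 /= in xI.
  by apply: (vertex_notin_pt (nd _ iT) v1); rewrite -xI.
- by rewrite E in xI; exact: (edge_notin_pt (nd _ iT) a1 b1 ab xI px).
Qed.

Lemma midpointE x y : midpoint x y = (2^-1 * (x.1 + y.1), 2^-1 * (x.2 + y.2)).
Proof. by []. Qed.

Lemma det_bisect1 T : det (bisect T).1 = det T / 2.
Proof.
rewrite /det /bisect midpointE; case: T => [[[p1 p2] [q1 q2]] [r1 r2]] /=.
by field.
Qed.

Lemma det_bisect2 T : det (bisect T).2 = det T / 2.
Proof.
rewrite /det /bisect midpointE; case: T => [[[p1 p2] [q1 q2]] [r1 r2]] /=.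
by field.
Qed.

Lemma det_bisect_neq0 T : det T != 0 -> det (bisect T).1 != 0 /\ det (bisect T).2 != 0.
Proof.
by move=> D0; rewrite det_bisect1 det_bisect2 mulf_neq0 // invr_eq0 pnatr_eq0.
Qed.

Lemma toT_bisect1 T y : toT (bisect T).1 y = toT T ((1 - y.1 + y.2) / 2, (1 - y.1 - y.2) / 2).
Proof.
rewrite /toT /affmap /bisect midpointE; case: T => [[[p1 p2] [q1 q2]] [r1 r2]] /=.
by congr pair; field.
Qed.

Lemma toT_bisect2 T y : toT (bisect T).2 y = toT T ((1 - y.1 - y.2) / 2, (1 + y.1 - y.2) / 2).
Proof.
rewrite /toT /affmap /bisect midpointE; case: T => [[[p1 p2] [q1 q2]] [r1 r2]] /=.
by congr pair; field.
Qed.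

(** In reference coordinates the median is the diagonal, and the first child is the half below
    it. *)
Lemma pt_bisect1 T x : det T != 0 ->
  pt (bisect T).1 x <-> pt T x /\ (ofT T x).2 < (ofT T x).1.
Proof.
move=> D0; split.
  move=> [y [y1 y2 y12] <-]; rewrite toT_bisect1 toTK //=; split; last lra.
  by eexists; last reflexivity; split => /=; lra.
move=> [/(ptE _ D0) [h1 h2 h3] h]; move: h1 h2 h3 h (ofTK D0 x).
generalize (ofT T x) => y h1 h2 h3 h <-.
exists (1 - y.1 - y.2, y.1 - y.2); first by split => /=; lra.
rewrite toT_bisect1; congr toT.
by rewrite [RHS]surjective_pairing; congr pair => /=; field.
Qed.

Lemma pt_bisect2 T x : det T != 0 ->
  pt (bisect T).2 x <-> pt T x /\ (ofT T x).1 < (ofT T x).2.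
Proof.
move=> D0; split.
  move=> [y [y1 y2 y12] <-]; rewrite toT_bisect2 toTK //=; split; last lra.
  by eexists; last reflexivity; split => /=; lra.
move=> [/(ptE _ D0) [h1 h2 h3] h]; move: h1 h2 h3 h (ofTK D0 x).
generalize (ofT T x) => y h1 h2 h3 h <-.
exists (y.2 - y.1, 1 - y.1 - y.2); first by split => /=; lra.
rewrite toT_bisect2; congr toT.
by rewrite [RHS]surjective_pairing; congr pair => /=; field.
Qed.

Lemma indic_bisect T : det T != 0 ->
  {ae leb2 R, forall x, \1_(pt T) x = \1_(pt (bisect T).1) x + \1_(pt (bisect T).2) x :> R}.
Proof.
move=> D0; have ne : (1 != 0 :> R) || (- 1 != 0 :> R) by rewrite oner_neq0.
apply: negligibleS (@ofT_line_null _ T 1 (-1) 0 D0 ne) => x.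
rewrite /setC /mkset; apply: contra_notP => nl; rewrite !indicE.
have [px|npx] := pselect (pt T x); last first.
  rewrite !memNset ?addr0 //; first by move=> /(pt_bisect2 _ D0)[].
  by move=> /(pt_bisect1 _ D0)[].
rewrite (mem_set px); case: (ltgtP (ofT T x).1 (ofT T x).2) => h.
- rewrite memNset; last by move=> /(pt_bisect1 _ D0)[_]; lra.
  by rewrite mem_set ?add0r //; apply/pt_bisect2.
- rewrite mem_set; last by apply/pt_bisect1.
  by rewrite memNset ?addr0 // => /(pt_bisect2 _ D0)[_]; lra.
- by exfalso; apply: nl; rewrite h; ring.
Qed.

Lemma indic_bisect_sub T x : det T != 0 ->
  [/\ \1_(pt (bisect T).1) x * \1_(pt T) x = \1_(pt (bisect T).1) x :> R,
      \1_(pt (bisect T).2) x * \1_(pt T) x = \1_(pt (bisect T).2) x :> R &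
      \1_(pt (bisect T).1) x * \1_(pt (bisect T).2) x = 0 :> R].
Proof.
move=> D0; rewrite !indicE.
have [/[dup] p1 /(pt_bisect1 _ D0)[p h]|n1] := pselect (pt (bisect T).1 x).
  rewrite (mem_set p1) (mem_set p) (memNset (A := pt (bisect T).2)) ?mulr1 ?mulr0 ?mul0r //.
  by move=> /(pt_bisect2 _ D0)[_]; lra.
rewrite (memNset n1) !mul0r; split => //.
have [/[dup] p2 /(pt_bisect2 _ D0)[p h]|n2] := pselect (pt (bisect T).2 x).
  by rewrite (mem_set p) mulr1.
by rewrite (memNset n2) mul0r.
Qed.

Definition sqdist x y : R := (x.1 - y.1) ^+ 2 + (x.2 - y.2) ^+ 2.

(* Weighting the refinement edge less than the two other edges makes this
   quantity contract by 3/4 under bisection, whatever the shape of the triangle. *)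
Definition energy T : R :=
  sqdist T.1.2 T.2 + 4 * (sqdist T.1.1 T.1.2 + sqdist T.1.1 T.2).

(** Let a be the newest vertex, b and c the ends of the refinement edge and m its midpoint. The
    median formula |m - a|^2 = (|a - b|^2 + |a - c|^2)/2 - |b - c|^2/4 gives the first child the
    energy 3|a - b|^2 + 2|a - c|^2, while the bound is 3/4 |b - c|^2 + 3(|a - b|^2 + |a - c|^2). The
    second child exchanges b and c. *)
Lemma energy_bisect T :
  energy (bisect T).1 <= 3 / 4 * energy T /\ energy (bisect T).2 <= 3 / 4 * energy T.
Proof.
rewrite /energy /sqdist /bisect midpointE; case: T => [[[p1 p2] [q1 q2]] [r1 r2]] /=.
set a1 := p1 - q1; set a2 := p2 - q2; set b1 := p1 - r1; set b2 := p2 - r2.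
have h1 := sqr_ge0 (q1 - r1); have h2 := sqr_ge0 (q2 - r2).
have h3 := sqr_ge0 (p1 - q1); have h4 := sqr_ge0 (p2 - q2).
have h5 := sqr_ge0 (p1 - r1); have h6 := sqr_ge0 (p2 - r2).
split; rewrite -subr_ge0.
  rewrite (_ : _ - _ = 3 / 4 * ((q1 - r1) ^+ 2 + (q2 - r2) ^+ 2) + (b1 ^+ 2 + b2 ^+ 2)).
    by rewrite /b1 /b2; lra.
  by rewrite /a1 /a2 /b1 /b2; field.
rewrite (_ : _ - _ = 3 / 4 * ((q1 - r1) ^+ 2 + (q2 - r2) ^+ 2) + (a1 ^+ 2 + a2 ^+ 2)).
  by rewrite /a1 /a2; lra.
by rewrite /a1 /a2 /b1 /b2; field.
Qed.

Lemma energy_ge0 T : 0 <= energy T.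
Proof.
have sq x y : 0 <= sqdist x y by rewrite addr_ge0 ?sqr_ge0.
by rewrite /energy addr_ge0 // mulr_ge0 // addr_ge0.
Qed.

(** By Cauchy-Schwarz the squared matrix norm is at most the sum of the squared edges at the newest
    vertex, which the energy dominates. *)
Lemma piola_energy T h1 h2 x :
  (piola T h1 h2 x).1 ^+ 2 + (piola T h1 h2 x).2 ^+ 2 <=
  energy T * (h1 (ofT T x) ^+ 2 + h2 (ofT T x) ^+ 2).
Proof.
have CS (a b u v : R) : (a * u + b * v) ^+ 2 <= (a ^+ 2 + b ^+ 2) * (u ^+ 2 + v ^+ 2).
  rewrite -subr_ge0 (_ : _ - _ = (a * v - b * u) ^+ 2) ?sqr_ge0 //; ring.
rewrite /piola /=; set u := h1 _; set v := h2 _.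
apply: le_trans (lerD (CS _ _ _ _) (CS _ _ _ _)) _.
rewrite -mulrDl ler_wpM2r ?addr_ge0 ?sqr_ge0 // /energy /sqdist.
have h1' := sqr_ge0 (T.1.2.1 - T.2.1); have h2' := sqr_ge0 (T.1.2.2 - T.2.2).
have h3 := sqr_ge0 (T.1.1.1 - T.1.2.1); have h4 := sqr_ge0 (T.1.1.2 - T.1.2.2).
have h5 := sqr_ge0 (T.1.1.1 - T.2.1); have h6 := sqr_ge0 (T.1.1.2 - T.2.2).
rewrite (_ : (T.1.2.1 - T.1.1.1) ^+ 2 = (T.1.1.1 - T.1.2.1) ^+ 2); last by ring.
rewrite (_ : (T.2.1 - T.1.1.1) ^+ 2 = (T.1.1.1 - T.2.1) ^+ 2); last by ring.
rewrite (_ : (T.1.2.2 - T.1.1.2) ^+ 2 = (T.1.1.2 - T.1.2.2) ^+ 2); last by ring.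
rewrite (_ : (T.2.2 - T.1.1.2) ^+ 2 = (T.1.1.2 - T.2.2) ^+ 2); last by ring.
lra.
Qed.

Lemma tri_bounded T : exists M : R, forall x, tri T x -> `|x.1| <= M /\ `|x.2| <= M.
Proof.
pose B := `|T.1.1.1| + `|T.1.2.1| + `|T.2.1| + (`|T.1.1.2| + `|T.1.2.2| + `|T.2.2|).
exists B => x [a [b [c [a0 b0 c0 abc ->]]]].
have key (u v w : R) : `|a * u + b * v + c * w| <= `|u| + `|v| + `|w|.
  rewrite (le_trans (ler_normD _ _)) // lerD //.
    rewrite (le_trans (ler_normD _ _)) // lerD // normrM ger0_norm //.
      by rewrite -[leRHS]mul1r ler_wpM2r //; lra.
    by rewrite -[leRHS]mul1r ler_wpM2r //; lra.
  by rewrite normrM ger0_norm // -[leRHS]mul1r ler_wpM2r //; lra.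
split; (apply: le_trans; first exact: key); rewrite /B.
  by rewrite lerDl !addr_ge0.
by rewrite lerDr !addr_ge0.
Qed.

Lemma le_diam T x y : tri T x -> tri T y -> Defs.edist x y <= diam (tri T).
Proof.
move=> tx ty; apply: ub_le_sup; last by exists x, y.
have [M HM] := tri_bounded T.
(* The supremum is an upper bound only once the distances are known to be bounded; each coordinate
   differs by at most [2 * M]. *)
exists (Num.sqrt (8 * M ^+ 2)) => _ [u [v [/HM[u1 u2] /HM[v1 v2] ->]]].
have sq (p q : R) : `|p| <= M -> `|q| <= M -> (p - q) ^+ 2 <= 4 * M ^+ 2.
  rewrite !ler_norml => /andP[? ?] /andP[? ?].
  rewrite (_ : 4 * M ^+ 2 = (2 * M) ^+ 2); last by ring.
  by rewrite -[_ ^+ 2]real_normK ?num_real // ler_sqr ?nnegrE //; [rewrite ler_norml; apply/andP; split; lra|lra].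
by apply: ler_wsqrtr; have := sq _ _ u1 v1; have := sq _ _ u2 v2; lra.
Qed.

(** The three weights add up to 1 + 4 + 4. *)
Lemma energy_diam T : energy T <= 9 * diam (tri T) ^+ 2.
Proof.
have sq x y : tri T x -> tri T y -> sqdist x y <= diam (tri T) ^+ 2.
  move=> tx ty; have d := le_diam tx ty.
  have -> : sqdist x y = Defs.edist x y ^+ 2 by rewrite sqr_sqrtr // addr_ge0 ?sqr_ge0.
  by rewrite ler_sqr ?nnegrE ?sqrtr_ge0 // (le_trans _ d) // sqrtr_ge0.
have t0 : tri T T.1.1 by exists 1, 0, 0; split => //; rewrite ?addr0 // scale1r !scale0r !addr0.
have t1 : tri T T.1.2 by exists 0, 1, 0; split => //; rewrite ?addr0 ?add0r // scale1r !scale0r !addr0 add0r.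
have t2 : tri T T.2 by exists 0, 0, 1; split => //; rewrite ?addr0 ?add0r // scale1r !scale0r !addr0 add0r.
by rewrite /energy; have := sq _ _ t1 t2; have := sq _ _ t0 t1; have := sq _ _ t0 t2; lra.
Qed.

(** The bisection tree of a triangle, recorded through the list of its leaves; proofs by induction
    on it are recursions from the root, whereas [nvb_refinement] grows at the leaves. *)
Inductive refines : triangle R -> seq (triangle R) -> Prop :=
| RefinesLeaf T : refines T [:: T]
| RefinesNode T L1 L2 : refines (bisect T).1 L1 -> refines (bisect T).2 L2 ->
    refines T (L1 ++ L2).

Lemma cat_split (A : Type) (L1 L2 s1 : seq A) S s2 : L1 ++ L2 = s1 ++ S :: s2 ->
  (exists b, L1 = s1 ++ S :: b /\ s2 = b ++ L2) \/
  (exists a, s1 = L1 ++ a /\ L2 = a ++ S :: s2).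
Proof.
elim: L1 s1 => [|u L1 IH] [|v s1] /=; try by move=> ->; right; eexists.
  by move=> [-> <-]; left; exists L1.
by move=> [-> /IH[[b [-> ->]]|[a [-> ->]]]]; [left; exists b|right; exists a].
Qed.

Lemma refines_step T L : refines T L -> forall s1 S s2, L = s1 ++ S :: s2 ->
  refines T (s1 ++ (bisect S).1 :: (bisect S).2 :: s2).
Proof.
elim=> {T L} [T|T L1 L2 r1 IH1 r2 IH2] s1 S s2.
  case: s1 => [[-> <-]|? []] //=.
  rewrite -[[:: _; _]]/([:: (bisect S).1] ++ [:: (bisect S).2]).
  by apply: RefinesNode; exact: RefinesLeaf.
move=> E; case: (cat_split E) => [[b [E1 ->]]|[a [-> E2]]].
  by rewrite -!cat_cons catA; apply: RefinesNode r2; exact: IH1 E1.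
by rewrite -catA; apply: RefinesNode r1 _; exact: IH2 E2.
Qed.

Lemma flatten_split (A : Type) (LL : seq (seq A)) s1 S s2 :
  flatten LL = s1 ++ S :: s2 -> exists L1 a b L2,
  [/\ LL = L1 ++ (a ++ S :: b) :: L2, s1 = flatten L1 ++ a & s2 = b ++ flatten L2].
Proof.
elim: LL s1 => [|L LL IH] s1 /=; first by case: s1.
move=> E; case: (cat_split E) => [[b [-> ->]]|[a [-> /IH[L1 [a' [b [L2 [-> -> ->]]]]]]]].
  by exists [::], s1, b, LL.
by exists (L :: L1), a', b, L2; rewrite /= catA.
Qed.

(** A global sequence of bisections is sorted into one tree per coarse triangle. Children replace
    their parent in place, so each step changes a single block of the flattened list. The pairs hold
    a root and its leaves. *)
Lemma nvb_refines (TH Th : seq (triangle R)) : nvb_refinement TH Th ->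
  exists LL : seq (triangle R * seq (triangle R)),
  [/\ map fst LL = TH, (forall p, p \in LL -> refines p.1 p.2) & Th = flatten (map snd LL)].
Proof.
elim=> [|s1 T s2 _ [LL [h1 h2 h3]]].
  exists [seq (T, [:: T]) | T <- TH]; split.
  - by rewrite -map_comp map_id.
  - by move=> _ /mapP[T _ ->]; exact: RefinesLeaf.
  - by rewrite -map_comp /=; elim: TH => //= T TH {1}->.
have [L1 [a [b [L2 [e1 e2 e3]]]]] := flatten_split (esym h3).
have [K1 [K2 eK]] : exists K1 K2, [/\ LL = K1 ++ K2, map snd K1 = L1 & map snd K2 = (a ++ T :: b) :: L2].
  exists (take (size L1) LL), (drop (size L1) LL); split; first by rewrite cat_take_drop.
    by rewrite map_take e1 take_size_cat.
  by rewrite map_drop e1 drop_size_cat.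
move: eK => [eK1 eK2 eK3].
case: K2 eK1 eK3 => [|[S L] K2] eK1 //= [eL eK3].
exists (K1 ++ (S, a ++ (bisect T).1 :: (bisect T).2 :: b) :: K2); split.
- by rewrite -h1 eK1 !map_cat.
- move=> p; rewrite mem_cat inE => /or3P[pK|/eqP ->|pK].
  + by apply: h2; rewrite eK1 mem_cat pK.
  + have r : refines S L by apply: (h2 (S, L)); rewrite eK1 mem_cat mem_head orbT.
    by apply: refines_step r _ _ _ _; rewrite -eL.
  + by apply: h2; rewrite eK1 mem_cat inE pK !orbT.
- by rewrite map_cat flatten_cat /= eK2 eK3 e2 e3 -!catA.
Qed.

End bisection.

(** * Local divergence problems *)

Section polynomials.
Context {R : realType}.
Implicit Types (q : R * R -> R) (t : R * R -> R * R) (x : R * R).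

Definition mono (i j : nat) : R * R -> R := fun x => x.1 ^+ i * x.2 ^+ j.

Lemma poly2_mono k i j : (i + j <= k)%N -> polynomial2 k (mono i j).
Proof.
move=> ij; exists (fun a b => ((a == i) && (b == j))%:R) => x.
have hi : (i < k.+1)%N by rewrite ltnS (leq_trans (leq_addr j i)).
have hj : (j < k.+1 - i)%N by rewrite ltn_subRL ltnS.
rewrite (bigD1 (Ordinal hi)) //= (bigD1 (Ordinal hj)) //= !eqxx mul1r big1 ?addr0; last first.
  by move=> b /negbTE nb; rewrite -val_eqE /= in nb; rewrite nb !mul0r.
rewrite big1 ?addr0 // => a /negbTE na; rewrite -val_eqE /= in na.
by apply: big1 => b _; rewrite na !mul0r.
Qed.

Lemma poly2_ext k q q' : polynomial2 k q -> q =1 q' -> polynomial2 k q'.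
Proof. by move=> pq /funext <-. Qed.

Lemma poly2_0 k : polynomial2 k (fun=> 0 : R).
Proof.
exists (fun _ _ => 0) => x; rewrite big1 // => i _; rewrite big1 // => j _.
by rewrite !mul0r.
Qed.

Lemma poly2D k q q' : polynomial2 k q -> polynomial2 k q' -> polynomial2 k (fun x => q x + q' x).
Proof.
move=> [c Hc] [c' Hc']; exists (fun i j => c i j + c' i j) => x.
rewrite Hc Hc' -big_split; apply: eq_bigr => i _; rewrite -big_split; apply: eq_bigr => j _.
by rewrite !mulrDl.
Qed.

Lemma poly2Z k a q : polynomial2 k q -> polynomial2 k (fun x => a * q x).
Proof.
move=> [c Hc]; exists (fun i j => a * c i j) => x.
rewrite Hc mulr_sumr; apply: eq_bigr => i _; rewrite mulr_sumr; apply: eq_bigr => j _.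
by rewrite !mulrA.
Qed.

(** Properties stable under linear combinations are checked on monomials, away from the double sum
    over coefficients. *)
Lemma poly2_ind k (Q : (R * R -> R) -> Prop) :
  Q (fun=> 0) -> (forall q q', Q q -> Q q' -> Q (fun x => q x + q' x)) ->
  (forall a q, Q q -> Q (fun x => a * q x)) ->
  (forall i j, (i + j <= k)%N -> Q (mono i j)) ->
  forall q, polynomial2 k q -> Q q.
Proof.
move=> Q0 QD QZ Qm q [c Hc].
have Qsum n (F : 'I_n -> R * R -> R) : (forall i, Q (F i)) -> Q (fun x => \sum_(i < n) F i x).
  elim: n F => [|n IH] F HF.
    by rewrite (_ : (fun x => _) = fun=> 0) //; apply/funext => x; rewrite big_ord0.
  rewrite (_ : (fun x => _) = (fun x => F ord0 x + \sum_(i < n) F (lift ord0 i) x)).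
    by apply: QD => //; exact: IH.
  by apply/funext => x; rewrite big_ord_recl.
rewrite (_ : q = fun x => \sum_(i < k.+1) \sum_(j < k.+1 - i) c i j * mono i j x).
  apply: (Qsum) => i; apply: (Qsum) => j; apply: QZ; apply: Qm.
  by have := ltn_ord j; rewrite ltn_subRL ltnS.
by apply/funext => x; rewrite Hc; apply: eq_bigr => i _; apply: eq_bigr => j _; rewrite /mono mulrA.
Qed.

Lemma poly2_le k l q : (k <= l)%N -> polynomial2 k q -> polynomial2 l q.
Proof.
move=> kl; apply: poly2_ind; [exact: poly2_0|exact: poly2D|exact: poly2Z|].
by move=> i j ij; apply: poly2_mono; exact: leq_trans kl.
Qed.

Lemma poly2M_affine k q (a b e : R) : polynomial2 k q ->
  polynomial2 k.+1 (fun x => (a * x.1 + b * x.2 + e) * q x).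
Proof.
apply: (@poly2_ind k (fun q => polynomial2 k.+1 (fun x => (a * x.1 + b * x.2 + e) * q x))).
- by apply: poly2_ext (poly2_0 _) _ => x; rewrite mulr0.
- by move=> u v hu hv; apply: poly2_ext (poly2D hu hv) _ => x; rewrite mulrDr.
- by move=> r u hu; apply: poly2_ext (poly2Z r hu) _ => x; rewrite mulrCA.
- move=> i j ij.
  have h1 : polynomial2 k.+1 (mono i.+1 j) by exact: poly2_mono.
  have h2 : polynomial2 k.+1 (mono i j.+1) by apply: poly2_mono; rewrite addnS.
  have h3 : polynomial2 k.+1 (mono i j) by apply: poly2_mono; exact: leq_trans (leqnSn _).
  apply: poly2_ext (poly2D (poly2D (poly2Z a h1) (poly2Z b h2)) (poly2Z e h3)) _ => x.
  by rewrite /mono !exprS; ring.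
Qed.

Lemma poly2_affmap k q (a b e c d f : R) : polynomial2 k q ->
  polynomial2 k (q \o affmap a b e c d f).
Proof.
apply: (@poly2_ind k (fun q => polynomial2 k (q \o affmap a b e c d f))).
- exact: poly2_0.
- by move=> u v; exact: poly2D.
- by move=> r u; exact: poly2Z.
- move=> i j ij; apply: poly2_le ij _.
  elim: i => [|i IH] /=.
    elim: j => [|j IH] /=.
      by apply: poly2_ext (@poly2_mono 0 0 0 isT) _ => x; rewrite /mono /= !expr0.
    rewrite add0n in IH *.
    apply: poly2_ext (poly2M_affine c d f IH) _ => x.
    by rewrite /mono /affmap /= !expr0 exprS; ring.
  apply: poly2_ext (poly2M_affine a b e IH) _ => x.
  by rewrite /mono /affmap /= exprS; ring.
Qed.

Lemma C1_ext (f f' p p' r r' : R * R -> R) : C1 f p r -> f =1 f' -> p =1 p' -> r =1 r' -> C1 f' p' r'.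
Proof. by move=> H /funext <- /funext <- /funext <-. Qed.

Lemma C1_fstX n : C1 (fun x => x.1 ^+ n) (fun x => n%:R * x.1 ^+ n.-1) (fun=> 0 : R).
Proof.
elim: n => [|n IH]; first by apply: C1_ext (C1_cst 1) _ _ _ => x; rewrite ?mul0r.
apply: C1_ext (C1M C1_fst IH) _ _ _ => x; first by rewrite exprS.
  by case: n {IH} => [|n] /=; rewrite ?exprS -?natr1; ring.
by ring.
Qed.

Lemma C1_sndX n : C1 (fun x => x.2 ^+ n) (fun=> 0 : R) (fun x => n%:R * x.2 ^+ n.-1).
Proof.
elim: n => [|n IH]; first by apply: C1_ext (C1_cst 1) _ _ _ => x; rewrite ?mul0r.
apply: C1_ext (C1M C1_snd IH) _ _ _ => x; first by rewrite exprS.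
  by ring.
by case: n {IH} => [|n] /=; rewrite ?exprS -?natr1; ring.
Qed.

Lemma C1_mono i j : C1 (mono i j) (fun x => i%:R * x.1 ^+ i.-1 * x.2 ^+ j)
  (fun x => j%:R * x.1 ^+ i * x.2 ^+ j.-1).
Proof. by apply: C1_ext (C1M (C1_fstX i) (C1_sndX j)) _ _ _ => x; rewrite /mono //; ring. Qed.

Lemma C1Z (a : R) f p r : C1 f p r -> C1 (fun x => a * f x) (fun x => a * p x) (fun x => a * r x).
Proof. by move=> H; apply: C1_ext (C1M (C1_cst a) H) _ _ _ => x //; ring. Qed.

Lemma poly2_continuous k q : polynomial2 k q -> continuous q.
Proof.
apply: (@poly2_ind k (fun q => continuous q)).
- by move=> z; exact: cvg_cst.
- by move=> u v; exact: continuousD_plane.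
- by move=> a u cu; apply: continuousM_plane => // z; exact: cvg_cst.
- by move=> i j _; have [] := C1_mono i j.
Qed.

Lemma RT_continuous k t : flux_shape RT k t ->
  continuous (fun x => (t x).1) /\ continuous (fun x => (t x).2).
Proof.
move=> [q1 [q2 [q [/poly2_continuous c1 /poly2_continuous c2 /poly2_continuous c tE]]]].
split.
  rewrite (_ : (fun x => _) = fun x => q1 x + x.1 * q x); last by apply/funext => x; rewrite tE.
  by apply: continuousD_plane => //; apply: continuousM_plane => //; exact: continuous_fst.
rewrite (_ : (fun x => _) = fun x => q2 x + x.2 * q x); last by apply/funext => x; rewrite tE.
by apply: continuousD_plane => //; apply: continuousM_plane => //; exact: continuous_snd.
Qed.

(** For [BDM] the scalar degree is one less than the order, and the radial part of a Raviart-Thomas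
    field raises the degree by just one. A single construction thus serves both families. *)
Lemma RT_sub_flux fam p t : (fam = BDM -> (1 <= p)%N) ->
  flux_shape RT (scalar_degree fam p) t -> flux_shape fam p t.
Proof.
case: fam => //= /(_ erefl); case: p => //= p _ [q1 [q2 [q [h1 h2 h tE]]]]; split.
  apply: poly2_ext (poly2D (poly2_le (leqnSn p) h1) (poly2M_affine 1 0 0 h)) _ => x.
  by rewrite tE /=; ring.
apply: poly2_ext (poly2D (poly2_le (leqnSn p) h2) (poly2M_affine 0 1 0 h)) _ => x.
by rewrite tE /=; ring.
Qed.

Lemma RT_0 k : @flux_shape R RT k (fun=> (0, 0)).
Proof.
by exists (fun=> 0), (fun=> 0), (fun=> 0); split; try exact: poly2_0; move=> x; rewrite !mulr0 !addr0.
Qed.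

Lemma RT_D k t t' : flux_shape RT k t -> flux_shape RT k t' ->
  flux_shape RT k (fun x => ((t x).1 + (t' x).1, (t x).2 + (t' x).2)).
Proof.
move=> [q1 [q2 [q [h1 h2 h tE]]]] [q1' [q2' [q' [h1' h2' h' tE']]]].
exists (fun x => q1 x + q1' x), (fun x => q2 x + q2' x), (fun x => q x + q' x).
by split; try exact: poly2D; move=> x; rewrite tE tE' /=; congr pair; ring.
Qed.

Lemma RT_Z k a t : flux_shape RT k t -> flux_shape RT k (fun x => (a * (t x).1, a * (t x).2)).
Proof.
move=> [q1 [q2 [q [h1 h2 h tE]]]].
exists (fun x => a * q1 x), (fun x => a * q2 x), (fun x => a * q x).
by split; try exact: poly2Z; move=> x; rewrite tE /=; congr pair; ring.
Qed.

(** With x = a + B y, the radial part B (y s(y)) is (x - a) s: the shape is kept, the term - a s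
    joining the polynomial part. *)
Lemma RT_piola k (T : triangle R) h1 h2 : det T != 0 ->
  flux_shape RT k (fun x => (h1 x, h2 x)) -> flux_shape RT k (piola T h1 h2).
Proof.
move=> D0 [r1 [r2 [s [p1 p2 ps hE]]]].
have aff q : polynomial2 k q -> polynomial2 k (q \o ofT T) by exact: poly2_affmap.
exists (fun x => (T.1.2.1 - T.1.1.1) * r1 (ofT T x) + (T.2.1 - T.1.1.1) * r2 (ofT T x) + - T.1.1.1 * s (ofT T x)),
       (fun x => (T.1.2.2 - T.1.1.2) * r1 (ofT T x) + (T.2.2 - T.1.1.2) * r2 (ofT T x) + - T.1.1.2 * s (ofT T x)),
       (s \o ofT T); split; try by apply: poly2D; [apply: poly2D|]; apply: poly2Z; exact: aff.
  exact: aff.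
move=> x; rewrite /piola.
have hE1 y : h1 y = r1 y + y.1 * s y by have [] := hE y.
have hE2 y : h2 y = r2 y + y.2 * s y by have [] := hE y.
rewrite hE1 hE2 /comp; have := ofTK D0 x.
move: (ofT T x) => y <-; rewrite /toT /affmap /=; congr pair; ring.
Qed.

End polynomials.

(** * Polynomials as divergences on the reference triangle *)

Section reference_problem.
Context {R : realType}.
Implicit Types (q h : R * R -> R).

(** The boundary conditions cancel the normal component on the side x = 0, on the side y = 0 and on
    the hypotenuse. *)
Definition refsol k q h1 h2 :=
  flux_shape RT k (fun x => (h1 x, h2 x)) /\
  exists p1 r1 p2 r2, [/\ C1 h1 p1 r1, C1 h2 p2 r2, (forall x, p1 x + r2 x = q x),
    (forall s : R, h1 (0, s) = 0) /\ (forall s : R, h2 (s, 0) = 0) &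
    forall s : R, h1 (s, 1 - s) + h2 (s, 1 - s) = 0].

Lemma refsol_0 k : refsol k (fun=> 0) (fun=> 0) (fun=> 0).
Proof.
split; first exact: RT_0.
exists (fun=> 0), (fun=> 0), (fun=> 0), (fun=> 0); split => //; try exact: C1_cst;
by move=> *; rewrite addr0.
Qed.

Lemma refsolD k q h1 h2 q' h1' h2' : refsol k q h1 h2 -> refsol k q' h1' h2' ->
  refsol k (fun x => q x + q' x) (fun x => h1 x + h1' x) (fun x => h2 x + h2' x).
Proof.
move=> [t [p1 [r1 [p2 [r2 [c1 c2 d [b1 b2] b3]]]]]] [t' [p1' [r1' [p2' [r2' [c1' c2' d' [b1' b2'] b3']]]]]].
split; first exact: (RT_D t t').
exists (fun x => p1 x + p1' x), (fun x => r1 x + r1' x), (fun x => p2 x + p2' x), (fun x => r2 x + r2' x).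
split; try exact: C1D.
- by move=> x; rewrite -d -d'; ring.
- by split=> s; rewrite ?b1 ?b1' ?b2 ?b2' addr0.
- by move=> s; rewrite addrACA b3 b3' addr0.
Qed.

Lemma refsolZ k a q h1 h2 : refsol k q h1 h2 ->
  refsol k (fun x => a * q x) (fun x => a * h1 x) (fun x => a * h2 x).
Proof.
move=> [t [p1 [r1 [p2 [r2 [c1 c2 d [b1 b2] b3]]]]]].
split; first exact: (RT_Z a t).
exists (fun x => a * p1 x), (fun x => a * r1 x), (fun x => a * p2 x), (fun x => a * r2 x).
split; try exact: C1Z.
- by move=> x; rewrite -d; ring.
- by split=> s; rewrite ?b1 ?b2 mulr0.
- by move=> s; rewrite -mulrDr b3 mulr0.
Qed.

(* The bubble x^(i+1) y^j (x - 1, y) points away from the vertex (1, 0) and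
   vanishes on the opposite edge, so it has no normal trace at all. *)
Lemma refsol_bubble1 k i j : (i.+1 + j <= k)%N ->
  exists h1 h2, refsol k (fun x => (i + j + 3)%:R * mono i.+1 j x - i.+1%:R * mono i j x) h1 h2.
Proof.
move=> ijk; have m := @C1_mono R i.+1 j.
exists (fun x => (x.1 + -1) * mono i.+1 j x), (fun x => x.2 * mono i.+1 j x).
have pm : polynomial2 k (@mono R i.+1 j) by exact: poly2_mono.
split.
  exists (fun x => (-1) * mono i.+1 j x), (fun=> 0), (mono i.+1 j); split => //.
  - exact: poly2Z.
  - exact: poly2_0.
  - by move=> x; congr pair; ring.
do 4 eexists; split.
- exact: (C1M (C1D C1_fst (C1_cst (-1))) m).
- exact: (C1M C1_snd m).
- move=> x /=; rewrite /mono /=; case: j {ijk m pm} => [|j] /=; rewrite ?addn0 ?addnS -!natr1 ?natrD ?exprS; ring.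
- by split=> s; rewrite /mono /= ?exprS; ring.
- by move=> s /=; rewrite -mulrDl addrC subrKA subrr mul0r.
Qed.

Lemma refsol_bubble2 k i j : (i + j.+1 <= k)%N ->
  exists h1 h2, refsol k (fun x => (i + j + 3)%:R * mono i j.+1 x - j.+1%:R * mono i j x) h1 h2.
Proof.
move=> ijk; have m := @C1_mono R i j.+1.
exists (fun x => x.1 * mono i j.+1 x), (fun x => (x.2 + -1) * mono i j.+1 x).
have pm : polynomial2 k (@mono R i j.+1) by exact: poly2_mono.
split.
  exists (fun=> 0), (fun x => (-1) * mono i j.+1 x), (mono i j.+1); split => //.
  - exact: poly2_0.
  - exact: poly2Z.
  - by move=> x; congr pair; ring.
do 4 eexists; split.
- exact: (C1M C1_fst m).
- exact: (C1M (C1D C1_snd (C1_cst (-1))) m).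
- move=> x /=; rewrite /mono /=; case: i {ijk m pm} => [|i] /=; rewrite ?add0n ?addSn ?addnS -!natr1 ?natrD ?exprS; ring.
- by split=> s; rewrite /mono /= ?exprS; ring.
- by move=> s /=; rewrite -mulrDl (_ : s + _ = 0) ?mul0r //; ring.
Qed.

(** Modulo divergences of bubbles, a monomial is a multiple of the one with an exponent lowered by
    one, with ratio [i.+1 / (i + j + 3)] or its analogue in [j]. The descent ends at a constant,
    collected in [a]. *)
Lemma refsol_mono k i j : (i + j <= k)%N ->
  exists a h1 h2, refsol k (fun x => mono i j x - a) h1 h2.
Proof.
have n3 (n : nat) : (n + 3)%:R != 0 :> R by rewrite pnatr_eq0 addnS.
elim: i => [|i IH] ij.
  elim: j ij => [|j IH] ij.
    exists 1, (fun=> 0), (fun=> 0).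
    rewrite (_ : (fun x => _) = fun=> 0); first exact: refsol_0.
    by apply/funext => x; rewrite /mono !expr0; ring.
  have [a [h1 [h2 H]]] := IH (leq_trans (leqnSn _) ij).
  have [g1 [g2 G]] := @refsol_bubble2 k 0 j ij.
  have := refsolD (refsolZ ((0 + j + 3)%:R)^-1 G) (refsolZ (((0 + j + 3)%:R)^-1 * j.+1%:R) H).
  move=> K; exists (((0 + j + 3)%:R)^-1 * j.+1%:R * a); do 2 eexists.
  rewrite (_ : (fun x => mono 0 j.+1 x - _) = (fun x => (0 + j + 3)%:R^-1 *
     ((0 + j + 3)%:R * mono 0 j.+1 x - j.+1%:R * mono 0 j x) +
     (0 + j + 3)%:R^-1 * j.+1%:R * (mono 0 j x - a))); first exact: K.
  apply/funext => x; move: (n3 (0 + j)%N); move: ((0 + j + 3)%:R : R) => N N0; by field.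
have [a [h1 [h2 H]]] := IH (leq_trans (leqnSn _) ij).
have [g1 [g2 G]] := refsol_bubble1 ij.
have := refsolD (refsolZ ((i + j + 3)%:R)^-1 G) (refsolZ (((i + j + 3)%:R)^-1 * i.+1%:R) H).
move=> K; exists (((i + j + 3)%:R)^-1 * i.+1%:R * a); do 2 eexists.
rewrite (_ : (fun x => mono i.+1 j x - _) = (fun x => (i + j + 3)%:R^-1 *
   ((i + j + 3)%:R * mono i.+1 j x - i.+1%:R * mono i j x) +
   (i + j + 3)%:R^-1 * i.+1%:R * (mono i j x - a))); first exact: K.
apply/funext => x; move: (n3 (i + j)%N); move: ((i + j + 3)%:R : R) => N N0; by field.
Qed.

Lemma refsol_weak k q h1 h2 phi p r : refsol k q h1 h2 -> C1 phi p r ->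
  J (fun x => \1_Rf x * (h1 x * p x + h2 x * r x)) = - J (fun x => \1_Rf x * (q x * phi x)).
Proof.
move=> [_ [p1 [r1 [p2 [r2 [c1 c2 d [b1 b2] b3]]]]]] cphi.
have G := green_ref (C1M c1 cphi) (C1M c2 cphi).
have {}G := G (fun s : R => etrans (congr1 ( *%R^~ _) (b1 s)) (mul0r _))
  (fun s : R => etrans (congr1 ( *%R^~ _) (b2 s)) (mul0r _)).
have [ch1 cp1 _ _ _] := c1; have [ch2 _ cr2 _ _] := c2; have [cf cp cr _ _] := cphi.
have Z : \int[@lebesgue_measure R]_(t in `[0, 1])
    (h1 (t, 1 - t) * phi (t, 1 - t) + h2 (t, 1 - t) * phi (t, 1 - t)) = 0.
  transitivity (\int[@lebesgue_measure R]_(t in `[0, 1]) (0 : R)).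
    by apply: eq_Rintegral => t _; rewrite -mulrDl b3 mul0r.
  by rewrite /Rintegral integral0.
apply/eqP; rewrite -subr_eq0 opprK -JD.
- rewrite -[X in _ == X]Z -G; apply/eqP; congr J; apply/funext => x.
  by rewrite -d; ring.
- by apply: bmM_continuous; [exact: bm_Rf|apply: continuousD_plane; exact: continuousM_plane].
- apply: bmM_continuous; first exact: bm_Rf.
  apply: continuousM_plane => //.
  rewrite (_ : q = fun x => p1 x + r2 x); last by apply/funext => x; rewrite d.
  exact: continuousD_plane.
Qed.

End reference_problem.

(** * Bounding coefficients by the Gram matrix *)

Section finite_dimensional_bound.
Context {R : realType}.

(** The family may be dependent, so the given coefficients cannot be bounded and are replaced. With
    [G] the Gram matrix, [c G] times a pseudo-inverse has the same product with [G] as [c], hence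
    represents the same function in L^2. The entries of [c G] are inner products with the [f i],
    controlled by Cauchy-Schwarz. *)
Lemma gram_bound (I : finType) (f : I -> R * R -> R) : (forall i, bm (f i)) ->
  exists C : R, 0 <= C /\ forall c : I -> R, exists c' : I -> R,
    J (fun x => (\sum_i (c i - c' i) * f i x) * (\sum_i (c i - c' i) * f i x)) = 0 /\
    forall i, c' i ^+ 2 <= C * J (fun x => (\sum_i c i * f i x) * (\sum_i c i * f i x)).
Proof.
move=> bf; pose n := #|I|; pose F (j : 'I_n) := f (enum_val j).
have bF j : bm (F j) by exact: bf.
have reind (d : I -> R) x : \sum_i d i * f i x = \sum_(j < n) d (enum_val j) * F j x.
  by rewrite (reindex (@enum_val I I)) //=; exact: onW_bij (enum_val_bij I).
pose G : 'M[R]_n := \matrix_(i, j) J (fun x => F i x * F j x).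
have bsum (d : 'I_n -> R) : bm (fun x => \sum_j d j * F j x).
  by apply: bm_sum => j _; exact: bmZ.
have JG (d : 'I_n -> R) i :
    J (fun x => (\sum_j d j * F j x) * F i x) = ((\row_j d j) *m G) 0 i.
  rewrite mxE (_ : (fun x => _) = fun x => \sum_j d j * (F j x * F i x)).
    rewrite Jsum; last by move=> j _; apply: bmZ; exact: bmM.
    by apply: eq_bigr => j _; rewrite JZ ?mxE //; exact: bmM.
  by apply/funext => x; rewrite mulr_suml; apply: eq_bigr => j _; rewrite mulrA.
pose M j := \sum_i Num.sqrt (G i i) * `|pinvmx G i j|.
exists (\sum_j M j ^+ 2); split; first by apply: sumr_ge0 => j _; exact: sqr_ge0.
move=> c; pose cr : 'rV[R]_n := \row_j c (enum_val j).
pose d : 'rV[R]_n := cr *m G *m pinvmx G.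
have dG : d *m G = cr *m G by rewrite mulmxKpV // submxMl.
exists (fun i => d 0 (enum_rank i)).
set Q := J (fun x => (\sum_i c i * f i x) * (\sum_i c i * f i x)).
split.
  pose e j := cr 0 j - d 0 j.
  rewrite (_ : (fun x => _) = fun x => \sum_j e j * ((\sum_k e k * F k x) * F j x)).
    rewrite Jsum; last by move=> j _; apply: bmZ; exact: bmM.
    rewrite big1 // => j _; rewrite JZ; last exact: bmM.
    have -> : J (fun x => (\sum_k e k * F k x) * F j x) = ((cr - d) *m G) 0 j.
      rewrite JG; congr ((_ *m _) 0 j); apply/rowP => k.
      by rewrite mxE /e [RHS]mxE; congr (_ + _); rewrite [RHS]mxE.
    by rewrite mulmxBl dG subrr mxE mulr0.
  apply/funext => x; rewrite (reind (fun i => c i - d 0 (enum_rank i))).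
  have -> : \sum_(j < n) (c (enum_val j) - d 0 (enum_rank (enum_val j))) * F j x = \sum_j e j * F j x.
    by apply: eq_bigr => k _; rewrite enum_valK /e [cr 0 k]mxE.
  rewrite mulr_sumr.
  by apply: eq_bigr => j _; rewrite mulrCA.
move=> i; set j := enum_rank i.
have QE : Q = J (fun x => (\sum_k cr 0 k * F k x) * (\sum_k cr 0 k * F k x)).
  rewrite /Q; congr J; apply/funext => x; rewrite reind.
  by congr (_ * _); apply: eq_bigr => k _; rewrite mxE.
have Q0 : 0 <= Q by apply: J_ge0 => x; rewrite -expr2 sqr_ge0.
have crG k : `|(cr *m G) 0 k| <= Num.sqrt Q * Num.sqrt (G k k).
  have -> : (cr *m G) 0 k = J (fun x => (\sum_j cr 0 j * F j x) * F k x).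
    by rewrite JG; congr ((_ *m _) 0 k); apply/rowP => l; rewrite !mxE.
  have Gkk : 0 <= G k k by rewrite mxE; apply: J_ge0 => x; rewrite -expr2 sqr_ge0.
  rewrite -sqrtrM // -[leLHS]sqrtr_sqr; apply: ler_wsqrtr.
  by rewrite QE mxE; apply: J_CauchySchwarz.
have dj : `|d 0 j| <= Num.sqrt Q * M j.
  rewrite /d mxE (le_trans (ler_norm_sum _ _ _)) // /M mulr_sumr ler_sum // => k _.
  by rewrite normrM mulrA ler_wpM2r.
have Mj0 : 0 <= M j by apply: sumr_ge0 => k _; rewrite mulr_ge0 ?sqrtr_ge0.
rewrite -[leLHS]real_normK ?num_real //.
apply: (@le_trans _ _ (M j ^+ 2 * Q)).
  rewrite -[X in _ * X](sqr_sqrtr Q0) -exprMn [X in _ <= X ^+ 2]mulrC.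
  by rewrite ler_sqr ?nnegrE ?mulr_ge0 ?sqrtr_ge0.
rewrite ler_wpM2r // (bigD1 j) //= lerDl.
by apply: sumr_ge0 => k _; exact: sqr_ge0.
Qed.

End finite_dimensional_bound.

(** * The reference problem with a bound *)

Section local_problems.
Context {R : realType}.
Implicit Types (T : triangle R) (q g : R * R -> R) (x : R * R).

Lemma J_sqr0 (f h : R * R -> R) : bm f -> bm h -> J (fun x => f x * f x) = 0 ->
  J (fun x => f x * h x) = 0.
Proof.
move=> bf bh f0; have := J_CauchySchwarz bf bh.
by rewrite f0 mul0r => h2; apply/eqP; rewrite -sqrf_eq0 eq_le h2 sqr_ge0.
Qed.

Lemma bm_RfM q : continuous q -> bm (fun x => \1_Rf x * q x).
Proof. by move=> cq; apply: bmM_continuous => //; exact: bm_Rf. Qed.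

(** Fixed solutions for finitely many mean-zero polynomials are combined linearly, with coefficients
    bounded by the norm of the datum. *)
Lemma reference_problem k : exists C : R, 0 <= C /\
  forall q, polynomial2 k q -> J (fun x => \1_Rf x * q x) = 0 ->
  exists h1 h2, [/\ flux_shape RT k (fun x => (h1 x, h2 x)),
    (forall phi p r, C1 phi p r ->
       J (fun x => \1_Rf x * (h1 x * p x + h2 x * r x)) = - J (fun x => \1_Rf x * (q x * phi x))) &
    J (fun x => \1_Rf x * (h1 x ^+ 2 + h2 x ^+ 2)) <= C * J (fun x => \1_Rf x * q x ^+ 2)].
Proof.
pose I : finType := ('I_k.+1 * 'I_k.+1)%type.
(* Indices run over a full square; those of degree above [k] receive the zero function, which a
   possibly dependent family tolerates. *)
pose ok (i : I) := (i.1 + i.2 <= k)%N.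
have /choice[a Ha] (i : I) : exists a : R, exists h1 h2 : R * R -> R,
    refsol k (fun x => if ok i then mono i.1 i.2 x - a else 0) h1 h2.
  rewrite /ok; case: (boolP (i.1 + i.2 <= k)%N) => ij; first exact: refsol_mono.
  by exists 0, (fun=> 0), (fun=> 0); exact: refsol_0.
have /choice[h1 {}Ha] := Ha; have /choice[h2 {}Ha] := Ha.
pose b (i : I) x := if ok i then mono i.1 i.2 x - a i else 0.
have cb i : continuous (b i).
  rewrite /b; case: (ok i); last by move=> z; exact: cvg_cst.
  have [cm _ _ _ _] := @C1_mono R i.1 i.2.
  by move=> z; apply: cvgB; [exact: cm|exact: cvg_cst].
pose f (i : I) x := \1_Rf x * b i x.
have bf i : bm (f i) by exact: bm_RfM.
have [C [C0 HC]] := gram_bound bf.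
have ch i : continuous (h1 i) /\ continuous (h2 i) by have [/RT_continuous] := Ha i.
have bh i : bm (fun x => \1_Rf x * h1 i x) /\ bm (fun x => \1_Rf x * h2 i x).
  by have [? ?] := ch i; split; exact: bm_RfM.
pose N i := J (fun x => \1_Rf x * (h1 i x ^+ 2 + h2 i x ^+ 2)).
have N0 i : 0 <= N i.
  by apply: J_ge0 => x; rewrite mulr_ge0 ?indicE ?ler0n // addr_ge0 ?sqr_ge0.
have wk i phi p r : C1 phi p r ->
    J (fun x => \1_Rf x * (h1 i x * p x + h2 i x * r x)) = - J (fun x => \1_Rf x * (b i x * phi x)).
  exact: refsol_weak (Ha i).
(* Testing with the constant 1 shows that every [b i] has mean zero. *)
have Jf0 i : J (f i) = 0.
  have := wk i _ _ _ (C1_cst 1).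
  rewrite (_ : (fun x => _ * (_ + _)) = fun=> 0); last by apply/funext => x; ring.
  by rewrite J0 (_ : (fun x => _ * (b i x * 1)) = f i); [lra|apply/funext => x; rewrite /f mulr1].
exists (#|I|%:R * (\sum_i C * N i)); split.
  by rewrite mulr_ge0 // sumr_ge0 // => i _; rewrite mulr_ge0.
move=> q pq q0.
have cq := poly2_continuous pq.
have [c Hc] : exists c : I -> R, forall x, \1_Rf x * q x = \sum_i c i * f i x.
  have [c Hc] := pq.
  pose c' (i : I) : R := if ok i then c i.1 i.2 else 0.
  have E x : q x = (\sum_i c' i * b i x) + \sum_i c' i * a i.
    rewrite -big_split /= Hc.
    transitivity (\sum_(i < k.+1) \sum_(j < k.+1) (c' (i, j) * b (i, j) x + c' (i, j) * a (i, j))); last first.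
      by rewrite pair_bigA; apply: eq_bigr => -[i j] _.
    apply: eq_bigr => i _; rewrite (big_ord_widen k.+1 (fun j => c i j * x.1 ^+ i * x.2 ^+ j)) ?leq_subr //.
    rewrite big_mkcond; apply: eq_bigr => j _; rewrite /c' /b /ok /= ltn_subRL ltnS.
    by case: ifP => _; rewrite /mono; ring.
  exists c'.
  have E2 x : \1_Rf x * q x = (\sum_i c' i * f i x) + (\sum_i c' i * a i) * \1_Rf x.
    rewrite E mulrDr mulr_sumr [in RHS]mulrC; congr (_ + _).
    by apply: eq_bigr => i _; rewrite /f mulrCA.
  (* The mean of [q] only sees the constants left over by the monomials, so they cancel; 1/2 is the
     area. *)
  have : J (fun x => \1_Rf x * q x) = (\sum_i c' i * a i) * 2^-1.
    rewrite (_ : (fun x => _) = fun x => (\sum_i c' i * f i x) + (\sum_i c' i * a i) * \1_Rf x); last exact/funext.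
    rewrite JD; last 2 first.
    - by apply: bm_sum => i _; exact: bmZ.
    - by apply: bmZ; exact: bm_Rf.
    rewrite JZ ?J_Rf; last exact: bm_Rf.
    rewrite Jsum; last by move=> i _; exact: bmZ.
    by rewrite big1 ?add0r // => i _; rewrite JZ // Jf0 mulr0.
  rewrite q0 => /esym/eqP; rewrite mulf_eq0 invr_eq0 pnatr_eq0 orbF => /eqP z x.
  by rewrite E2 z mul0r addr0.
have [c' [c'0 c'b]] := HC c.
pose g1 x := \sum_i c' i * h1 i x; pose g2 x := \sum_i c' i * h2 i x.
(* The error of exchanging [c] for [c']. It has norm zero, so it disappears from every integral
   against a [bm] function. *)
pose D x := \sum_i (c i - c' i) * f i x.
have bD : bm D by apply: bm_sum => i _; exact: bmZ.
exists g1, g2; split.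
- rewrite /g1 /g2; elim: (index_enum I) => [|i s IH].
    rewrite (_ : (fun x => _) = fun=> (0, 0)); first exact: RT_0.
    by apply/funext => x; rewrite !big_nil.
  have [Hi _] := Ha i; have := RT_D (RT_Z (c' i) Hi) IH.
  rewrite (_ : (fun x => _) = (fun x => (\sum_(i <- i :: s) c' i * h1 i x, \sum_(i <- i :: s) c' i * h2 i x))) //.
  by apply/funext => x; rewrite !big_cons.
- move=> phi p r cphi; have [cf cp cr _ _] := cphi.
  have bphi : bm (fun x => \1_Rf x * phi x) by exact: bm_RfM.
  transitivity (\sum_i c' i * J (fun x => \1_Rf x * (h1 i x * p x + h2 i x * r x))).
    rewrite (_ : (fun x => \1_Rf x * (g1 x * p x + g2 x * r x)) =
       fun x => \sum_i c' i * (\1_Rf x * (h1 i x * p x + h2 i x * r x))); last first.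
      apply/funext => x; rewrite /g1 /g2 !mulr_suml -big_split mulr_sumr.
      by apply: eq_bigr => i _ /=; ring.
    have bi i : bm (fun x => \1_Rf x * (h1 i x * p x + h2 i x * r x)).
      have [? ?] := ch i.
      by apply: bm_RfM; apply: continuousD_plane; exact: continuousM_plane.
    rewrite Jsum; last by move=> i _; exact: bmZ.
    by apply: eq_bigr => i _; rewrite JZ.
  transitivity (- \sum_i c' i * J (fun x => \1_Rf x * (b i x * phi x))).
    by rewrite -sumrN; apply: eq_bigr => i _; rewrite (wk _ _ _ _ cphi) mulrN.
  congr (- _).
  have bbp i : bm (fun x => \1_Rf x * (b i x * phi x)) by apply: bm_RfM; exact: continuousM_plane.
  have -> : J (fun x => \1_Rf x * (q x * phi x)) =
     J (fun x => (\sum_i c' i * (\1_Rf x * (b i x * phi x))) + D x * (\1_Rf x * phi x)).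
    congr J; apply/funext => x.
    have i2 : \1_Rf x * \1_Rf x = \1_Rf x :> R by rewrite indicE; case: (_ \in _); rewrite ?mulr1 ?mulr0.
    rewrite mulrA Hc -{1}(mulr1 (\sum_i _)) /D.
    rewrite [in RHS]mulr_suml -big_split mulr1 mulr_suml; apply: eq_bigr => i _; rewrite /f.
    rewrite /= (_ : (c i - c' i) * _ * _ = (c i - c' i) * (\1_Rf x * \1_Rf x) * b i x * phi x); last by ring.
    by rewrite i2; ring.
  have s1 : bm (fun x => \sum_i c' i * (\1_Rf x * (b i x * phi x))).
    by apply: bm_sum => i _; exact: bmZ.
  have e0 : J (fun x => D x * (\1_Rf x * phi x)) = 0 := J_sqr0 bD bphi c'0.
  rewrite (JD s1 (bmM bD bphi)) e0 addr0 Jsum; last by move=> i _; exact: bmZ.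
  by apply: eq_bigr => i _; rewrite JZ.
- set Q := J (fun x => \1_Rf x * q x ^+ 2).
  have QE : J (fun x => (\sum_i c i * f i x) * (\sum_i c i * f i x)) = Q.
    congr J; apply/funext => x; rewrite -Hc.
    by rewrite indicE; case: (_ \in _) => /=; ring.
  rewrite QE in c'b.
  (* Cauchy-Schwarz for finite sums, the origin of the factor [#|I|] in the constant. *)
  have CS (s : seq I) (u : I -> R) : (\sum_(i <- s) u i) ^+ 2 <= (size s)%:R * \sum_(i <- s) u i ^+ 2.
    elim: s => [|i s IH]; first by rewrite !big_nil expr0n mul0r.
    rewrite !big_cons /= -natr1; set n : R := _%:R; set A := \sum_(_ <- _) _; set B := \sum_(_ <- _) _ ^+ 2.
    have n0 : 0 <= n by rewrite ler0n.
    have B0 : 0 <= B by apply: sumr_ge0 => j _; exact: sqr_ge0.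
    have [s0|s0] := eqVneq s [::].
      by rewrite /A /B /n s0 !big_nil /=; lra.
    have n1 : 0 < n by rewrite ltr0n lt0n size_eq0.
    have sq : 0 <= (n * u i - A) ^+ 2 by exact: sqr_ge0.
    have key : 0 <= n * ((n + 1) * (u i ^+ 2 + B) - (u i + A) ^+ 2).
      rewrite (_ : n * _ = (n * u i - A) ^+ 2 + (n + 1) * (n * B - A ^+ 2)); last by ring.
      have IH' : 0 <= n * B - A ^+ 2 by rewrite subr_ge0.
      by apply: addr_ge0 => //; apply: mulr_ge0 => //; apply: addr_ge0.
    by move: key; rewrite pmulr_rge0 // subr_ge0.
  have Ns : size (index_enum I) = #|I| by rewrite cardE /enum_mem size_filter; apply/esym/eqP; rewrite -all_count; exact/allP.
  have bN i : bm (fun x => \1_Rf x * (h1 i x ^+ 2 + h2 i x ^+ 2)).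
    have [? ?] := ch i; apply: bm_RfM.
    rewrite (_ : (fun x => _) = fun x => h1 i x * h1 i x + h2 i x * h2 i x); last by apply/funext => x; ring.
    by apply: continuousD_plane; exact: continuousM_plane.
  have cg : continuous g1 /\ continuous g2.
    rewrite /g1 /g2; split; elim: (index_enum I) => [|i s IH].
    + by under eq_fun do rewrite big_nil; move=> z; exact: cvg_cst.
    + under eq_fun do rewrite big_cons; apply: continuousD_plane => //.
      by apply: continuousM_plane; [move=> z; exact: cvg_cst|exact: (ch i).1].
    + by under eq_fun do rewrite big_nil; move=> z; exact: cvg_cst.
    + under eq_fun do rewrite big_cons; apply: continuousD_plane => //.
      by apply: continuousM_plane; [move=> z; exact: cvg_cst|exact: (ch i).2].
  apply: (@le_trans _ _ (J (fun x => #|I|%:R * \sum_i c' i ^+ 2 * (\1_Rf x * (h1 i x ^+ 2 + h2 i x ^+ 2))))).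
    apply: le_J.
    + apply: bm_RfM.
      rewrite (_ : (fun x => _) = fun x => g1 x * g1 x + g2 x * g2 x); last by apply/funext => x; ring.
      by apply: continuousD_plane; apply: continuousM_plane; apply cg.
    + by apply: bmZ; apply: bm_sum => i _; exact: bmZ.
    + move=> x; rewrite (_ : #|I|%:R * _ = \1_Rf x * (#|I|%:R * \sum_i (c' i * h1 i x) ^+ 2 +
        #|I|%:R * \sum_i (c' i * h2 i x) ^+ 2)); last first.
        rewrite -mulrDr -big_split [RHS]mulrCA; congr (_ * _); rewrite mulr_sumr.
        by apply: eq_bigr => i _; rewrite /= !exprMn; ring.
      rewrite ler_wpM2l ?indicE ?ler0n // -Ns.
      by apply: lerD; exact: CS.
  rewrite JZ; last by apply: bm_sum => i _; exact: bmZ.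
  rewrite Jsum; last by move=> i _; exact: bmZ.
  rewrite -mulrA ler_wpM2l // mulr_suml; apply: ler_sum => i _.
  rewrite (JZ _ (bN i)) -/(N i) [leRHS]mulrAC; apply: ler_wpM2r => //; exact: c'b.
Qed.

End local_problems.

(** * Recursion on the bisection tree *)

Section tree_problem.
Context {R : realType}.
Implicit Types (T S : triangle R) (q g : R * R -> R) (x : R * R).

Lemma eq_ler (a b : R) : a = b -> a <= b.
Proof. by move=> ->. Qed.

Lemma bm_sqr q : bm q -> bm (fun x => q x ^+ 2).
Proof. by move=> bq; have := bmM bq bq; under eq_fun do rewrite -expr2. Qed.

Lemma bm_ptM T q : det T != 0 -> continuous q -> bm (fun x => \1_(pt T) x * q x).
Proof. by move=> D0 cq; apply: bmM_continuous => //; exact: bm_pt. Qed.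

Lemma indic_eq (A : set (R * R)) (a b : R) x : (A x -> a = b) -> \1_A x * a = \1_A x * b.
Proof.
rewrite indicE; case: (boolP (x \in A)) => [|_ _]; last by rewrite !mul0r.
by rewrite inE => Ax /(_ Ax) ->.
Qed.

(** The identity holds for every C1 function [phi], not only for those supported in [T]: the field,
    zero outside [T], has divergence [g] on [T] and 0 elsewhere as a field on the plane. This
    encodes the absence of normal trace on the boundary of [T] and the continuity of normal
    components between leaves. *)
Definition localsol k T (L : seq (triangle R)) g (t1 t2 : R * R -> R) (B : R) :=
  [/\ bm t1 /\ bm t2, (forall x, ~ pt T x -> t1 x = 0 /\ t2 x = 0),
  (forall S, S \in L -> exists2 t, flux_shape RT k t & forall x, pt S x -> (t1 x, t2 x) = t x),
  (forall phi p r, C1 phi p r -> J (fun x => t1 x * p x + t2 x * r x) =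
     - J (fun x => \1_(pt T) x * (g x * phi x))) &
  J (fun x => t1 x ^+ 2 + t2 x ^+ 2) <= B].

(** The Piola transform carries the reference solution to [T]. The Jacobian multiplies both sides of
    the estimate and cancels, so the energy is the only scale left. *)
Lemma leaf_solve k : exists C : R, 0 <= C /\ forall T g, det T != 0 ->
  (exists2 q, polynomial2 k q & forall x, pt T x -> g x = q x) ->
  J (fun x => \1_(pt T) x * g x) = 0 ->
  exists t1 t2, localsol k T [:: T] g t1 t2 (C * energy T * J (fun x => \1_(pt T) x * g x ^+ 2)).
Proof.
have [C [C0 HC]] := @reference_problem R k.
exists C; split => // T g D0 [q pq gq] g0.
have gE : (fun x => \1_(pt T) x * g x) = (fun x => \1_(pt T) x * q x).
  by apply/funext => x; exact: indic_eq (gq x).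
have g2E : (fun x => \1_(pt T) x * g x ^+ 2) = (fun x => \1_(pt T) x * q x ^+ 2).
  by apply/funext => x; apply: indic_eq => /gq ->.
have ghE (phi : R * R -> R) : (fun x => \1_(pt T) x * (g x * phi x)) = (fun x => \1_(pt T) x * (q x * phi x)).
  by apply/funext => x; apply: indic_eq => /gq ->.
have cq := poly2_continuous pq.
have pqh : polynomial2 k (q \o toT T) by exact: poly2_affmap.
have JE (u : R * R -> R) : continuous u -> J (fun x => \1_(pt T) x * u x) = `|det T| * J (fun y => \1_Rf y * u (toT T y)).
  move=> cu; rewrite (J_toT D0 (bm_ptM D0 cu)); congr (_ * J _).
  by apply/funext => y /=; rewrite indic_pt_toT.
have nd0 : `|det T| != 0 by rewrite normr_eq0.
have q0 : J (fun x => \1_Rf x * (q \o toT T) x) = 0.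
  by move: g0; rewrite gE JE // => /eqP; rewrite mulf_eq0 (negbTE nd0) => /eqP.
have [h1 [h2 [fs wk bd]]] := HC _ pqh q0.
have [/= ch1 ch2] := RT_continuous fs.
have [ct1 ct2] := continuous_piola T ch1 ch2.
exists (fun x => \1_(pt T) x * (piola T h1 h2 x).1), (fun x => \1_(pt T) x * (piola T h1 h2 x).2); split.
- by split; exact: bm_ptM.
- by move=> x nx; rewrite indicE memNset // !mul0r.
- move=> S; rewrite inE => /eqP ->; exists (piola T h1 h2); first exact: RT_piola.
  by move=> x px; rewrite indicE mem_set // !mul1r -surjective_pairing.
- move=> phi p r cphi; have [cf cp cr _ _] := cphi.
  rewrite (_ : (fun x => _ + _) = (fun x => \1_(pt T) x * ((piola T h1 h2 x).1 * p x + (piola T h1 h2 x).2 * r x))); last first.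
    by apply/funext => x; ring.
  rewrite ghE JE; last by apply: continuousD_plane; exact: continuousM_plane.
  rewrite JE; last exact: continuousM_plane.
  rewrite -mulrN; congr (_ * _).
  have cphi' := C1_affmap (T.1.2.1 - T.1.1.1) (T.2.1 - T.1.1.1) T.1.1.1
         (T.1.2.2 - T.1.1.2) (T.2.2 - T.1.1.2) T.1.1.2 cphi.
  rewrite -(wk _ _ _ cphi'); congr J; apply/funext => y.
  rewrite /piola toTK //= -/(toT T y); ring.
- rewrite g2E.
  have c2 : continuous (fun x => h1 x * h1 x + h2 x * h2 x).
    by apply: continuousD_plane; exact: continuousM_plane.
  have cc (h : R * R -> R) : continuous h -> continuous (fun x => h (ofT T x)).
    by move=> ch x; apply: continuous_comp; [exact: continuous_ofT|exact: ch].
  apply: (@le_trans _ _ (J (fun x => energy T * (\1_(pt T) x * (h1 (ofT T x) * h1 (ofT T x) + h2 (ofT T x) * h2 (ofT T x)))))).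
    apply: le_J.
    + by apply: bmD; apply: bm_sqr; exact: bm_ptM.
    + by apply: bmZ; apply: bm_ptM => //; exact: (cc _ c2).
    + move=> x; rewrite indicE; case: (_ \in _); last by rewrite !mul0r expr0n addr0 mulr0.
      by rewrite !mul1r -!expr2; exact: piola_energy.
  rewrite JZ; last by apply: bm_ptM => //; exact: (cc _ c2).
  rewrite JE; last exact: (cc _ c2).
  rewrite [X in _ <= _ * X](_ : _ = J (fun x => \1_(pt T) x * (q x * q x))); last by under eq_fun do rewrite expr2.
  rewrite JE; last exact: continuousM_plane.
  rewrite [leRHS](_ : _ = energy T * (`|det T| * (C * J (fun x => \1_Rf x * (q \o toT T) x ^+ 2)))); last first.
    by under [in RHS]eq_fun do rewrite expr2; rewrite /=; ring.
  rewrite ler_wpM2l ?energy_ge0 // ler_wpM2l //.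
  apply: le_trans bd; apply: eq_ler.
  by congr J; apply/funext => y; rewrite toTK // !expr2.
Qed.

(* A multiple of x - a has no flux through the two sides meeting at the vertex a,
   only through the median which the two children share. *)
Definition apexT (a : R * R) T : triangle R := (a, midpoint T.1.2 T.2, T.1.1).

Lemma pt_apex1 T : pt (apexT T.1.2 T) = pt (bisect T).1.
Proof.
have tE y : toT (apexT T.1.2 T) y = toT (bisect T).1 (y.2, 1 - y.1 - y.2).
  by rewrite /toT /affmap /=; congr pair; ring.
have tE' y : toT (bisect T).1 y = toT (apexT T.1.2 T) (1 - y.1 - y.2, y.1).
  by rewrite /toT /affmap /=; congr pair; ring.
rewrite predeqE => x; split=> [[y [y1 y2 y3] <-]|[y [y1 y2 y3] <-]].
  by rewrite tE; eexists; last reflexivity; split => /=; lra.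
by rewrite tE'; eexists; last reflexivity; split => /=; lra.
Qed.

Lemma pt_apex2 T : pt (apexT T.2 T) = pt (bisect T).2.
Proof.
have tE y : toT (apexT T.2 T) y = toT (bisect T).2 (1 - y.1 - y.2, y.2).
  by rewrite /toT /affmap /=; congr pair; ring.
have tE' y : toT (bisect T).2 y = toT (apexT T.2 T) (1 - y.1 - y.2, y.2).
  by rewrite /toT /affmap /=; congr pair; ring.
rewrite predeqE => x; split=> [[y [y1 y2 y3] <-]|[y [y1 y2 y3] <-]].
  by rewrite tE; eexists; last reflexivity; split => /=; lra.
by rewrite tE'; eexists; last reflexivity; split => /=; lra.
Qed.

Lemma det_apex1 T : det (apexT T.1.2 T) = det T / 2.
Proof.
rewrite /det /apexT midpointE; case: T => [[[p1 p2] [q1 q2]] [r1 r2]] /=.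
by field.
Qed.

Lemma det_apex2 T : det (apexT T.2 T) = - (det T / 2).
Proof.
rewrite /det /apexT midpointE; case: T => [[[p1 p2] [q1 q2]] [r1 r2]] /=.
by field.
Qed.

Lemma energy_apex T : energy (apexT T.1.2 T) <= 2 * energy T /\ energy (apexT T.2 T) <= 2 * energy T.
Proof.
rewrite /energy /sqdist /apexT midpointE; case: T => [[[p1 p2] [q1 q2]] [r1 r2]] /=.
have h1 := sqr_ge0 (q1 - r1); have h2 := sqr_ge0 (q2 - r2).
have h3 := sqr_ge0 (p1 - q1); have h4 := sqr_ge0 (p2 - q2).
have h5 := sqr_ge0 (p1 - r1); have h6 := sqr_ge0 (p2 - r2).
split; rewrite -subr_ge0.
  rewrite (_ : _ - _ = 5 / 4 * ((q1 - r1) ^+ 2 + (q2 - r2) ^+ 2) +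
     7 / 2 * ((p1 - q1) ^+ 2 + (p2 - q2) ^+ 2) + 15 / 2 * ((p1 - r1) ^+ 2 + (p2 - r2) ^+ 2)).
    by lra.
  by field.
rewrite (_ : _ - _ = 5 / 4 * ((q1 - r1) ^+ 2 + (q2 - r2) ^+ 2) +
   15 / 2 * ((p1 - q1) ^+ 2 + (p2 - q2) ^+ 2) + 7 / 2 * ((p1 - r1) ^+ 2 + (p2 - r2) ^+ 2)).
  by lra.
by field.
Qed.

Lemma C1_scaled (c : R) : C1 (fun x => c * x.1) (fun=> c) (fun=> 0) /\ C1 (fun x => c * x.2) (fun=> 0) (fun=> c).
Proof.
split; first by apply: C1_ext (C1Z c C1_fst) _ _ _ => x //; ring.
by apply: C1_ext (C1Z c C1_snd) _ _ _ => x //; ring.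
Qed.

Lemma RT_scaled k (c : R) : flux_shape RT k (fun x : R * R => (c * x.1, c * x.2)).
Proof.
exists (fun=> 0), (fun=> 0), (fun=> c); split; try exact: poly2_0.
  apply: poly2_ext (poly2Z c (@poly2_mono R k 0 0 (leq0n k))) _ => x.
  by rewrite /mono; ring.
by move=> x; congr pair; ring.
Qed.

Lemma apex_bound (A : triangle R) (c e : R) : det A != 0 -> energy A <= e ->
  J (fun x => (\1_(pt A) x * (piola A (fun y => c * y.1) (fun y => c * y.2) x).1) ^+ 2 +
              (\1_(pt A) x * (piola A (fun y => c * y.1) (fun y => c * y.2) x).2) ^+ 2)
  <= e * c ^+ 2 * (`|det A| / 2).
Proof.
move=> D0 Ae.
have [[c1 _ _ _ _] [c2 _ _ _ _]] := C1_scaled c.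
have [ct1 ct2] := continuous_piola A c1 c2.
have bP := bm_pt D0.
rewrite -(J_pt D0) -JZ //; apply: le_J.
- by apply: bmD; apply: bm_sqr; exact: bm_ptM.
- exact: bmZ.
move=> x; rewrite indicE; case: (boolP (x \in pt A)) => [|_]; last by rewrite !mul0r expr0n addr0 mulr0.
rewrite inE => /(ptE _ D0)[]; rewrite !mul1r mulr1 => y1 y2 y3.
apply: le_trans (piola_energy _ _ _ _) _.
move: (ofT A x) y1 y2 y3 => y y1 y2 y3 /=.
have E0 : 0 <= e := le_trans (energy_ge0 _) Ae.
apply: (@le_trans _ _ (e * ((c * y.1) ^+ 2 + (c * y.2) ^+ 2))).
  by rewrite ler_wpM2r // addr_ge0 // sqr_ge0.
rewrite ler_wpM2l // !exprMn -mulrDr -[leRHS]mulr1 ler_wpM2l ?sqr_ge0 //.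
by nra.
Qed.

(** With a the end of the refinement edge belonging to a child, the field is c/2 (x - a) on the
    first child and - c/2 (x - a) on the second: its divergences are [c] and [- c]. The children
    have equal areas, so what leaves one through the median enters the other. *)
Lemma node_solve k T (c : R) : det T != 0 ->
  exists t1 t2, localsol k T [:: (bisect T).1; (bisect T).2]
    (fun x => c * \1_(pt (bisect T).1) x - c * \1_(pt (bisect T).2) x) t1 t2
    (energy T * c ^+ 2 * `|det T|).
Proof.
move=> D0; set T1 := (bisect T).1; set T2 := (bisect T).2.
pose A1 := apexT T.1.2 T; pose A2 := apexT T.2 T.
have half0 : det T / 2 != 0 by rewrite mulf_neq0 // invr_eq0 pnatr_eq0.
have dA1 : det A1 != 0 by rewrite det_apex1.
have dA2 : det A2 != 0 by rewrite det_apex2 oppr_eq0.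
have pA1 : pt A1 = pt T1 := pt_apex1 T; have pA2 : pt A2 = pt T2 := pt_apex2 T.
have [eA1 eA2] := energy_apex T.
pose u1 := piola A1 (fun y => c / 2 * y.1) (fun y => c / 2 * y.2).
pose u2 := piola A2 (fun y => - (c / 2) * y.1) (fun y => - (c / 2) * y.2).
have [Cx Cy] := C1_scaled (c / 2); have [Dx Dy] := C1_scaled (- (c / 2)).
have cu1 : continuous (fun x => (u1 x).1) /\ continuous (fun x => (u1 x).2).
  by apply: continuous_piola; [case: Cx|case: Cy].
have cu2 : continuous (fun x => (u2 x).1) /\ continuous (fun x => (u2 x).2).
  by apply: continuous_piola; [case: Dx|case: Dy].
have ind x := indic_bisect_sub x D0; rewrite -/T1 -/T2 in ind.
exists (fun x => \1_(pt A1) x * (u1 x).1 + \1_(pt A2) x * (u2 x).1),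
       (fun x => \1_(pt A1) x * (u1 x).2 + \1_(pt A2) x * (u2 x).2); split.
- by split; apply: bmD; apply: bm_ptM => //; [exact: cu1.1|exact: cu2.1|exact: cu1.2|exact: cu2.2].
- move=> x nx; rewrite pA1 pA2 !indicE !memNset ?mul0r ?addr0 //.
    by move=> /(pt_bisect2 _ D0)[].
  by move=> /(pt_bisect1 _ D0)[].
- move=> S; rewrite !inE => /orP[] /eqP ->.
    exists u1; first by apply: RT_piola => //; exact: RT_scaled.
    move=> x px; have [_ _] := ind x.
    by rewrite pA1 pA2 indicE (mem_set px) mul1r => ->; rewrite !mul1r !mul0r !addr0 -surjective_pairing.
  exists u2; first by apply: RT_piola => //; exact: RT_scaled.
  move=> x px; have [_ _] := ind x.
  by rewrite pA1 pA2 [X in _ * X]indicE (mem_set px) mulr1 => ->; rewrite indicE (mem_set px) !mul1r !mul0r !add0r -surjective_pairing.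
- move=> phi p r Cphi; have [cf cp cr _ _] := Cphi.
  have bw (A : triangle R) (u : R * R -> R * R) : det A != 0 -> continuous (fun x => (u x).1) /\ continuous (fun x => (u x).2) ->
      bm (fun x => \1_(pt A) x * ((u x).1 * p x + (u x).2 * r x)).
    by move=> dA [? ?]; apply: bm_ptM => //; apply: continuousD_plane; exact: continuousM_plane.
  rewrite (_ : (fun x => _ * p x + _ * r x) = (fun x => \1_(pt A1) x * ((u1 x).1 * p x + (u1 x).2 * r x) +
      \1_(pt A2) x * ((u2 x).1 * p x + (u2 x).2 * r x))); last by apply/funext => x; ring.
  rewrite JD; [|exact: bw|exact: bw].
  rewrite /u1 /u2 (green_pt dA1 Cx Cy Cphi) ?(green_pt dA2 Dx Dy Cphi); try by move=> s /=; rewrite mulr0.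
  have bf (A : triangle R) : det A != 0 -> bm (fun x => \1_(pt A) x * phi x) by move=> dA; exact: bm_ptM.
  have -> : J (fun x => \1_(pt T) x * ((c * \1_(pt T1) x - c * \1_(pt T2) x) * phi x)) =
      c * J (fun x => \1_(pt A1) x * phi x) - c * J (fun x => \1_(pt A2) x * phi x).
    rewrite -!JZ; [|exact: bf|exact: bf].
    rewrite -JB; [|by apply: bmZ; exact: bf|by apply: bmZ; exact: bf].
    congr J; apply/funext => x; have [i1 i2 _] := ind x; rewrite pA1 pA2 -[in RHS]i1 -[in RHS]i2; ring.
  have -> : J (fun x => \1_(pt A1) x * ((c / 2 + c / 2) * phi x)) = c * J (fun x => \1_(pt A1) x * phi x).
    by rewrite -JZ; [congr J; apply/funext => x; field|exact: bf].
  have -> : J (fun x => \1_(pt A2) x * ((- (c / 2) + - (c / 2)) * phi x)) = - c * J (fun x => \1_(pt A2) x * phi x).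
    by rewrite -JZ; [congr J; apply/funext => x; field|exact: bf].
  (* Both apex triangles parametrise the median in the same way, so the two boundary integrals are
     opposite. *)
  have -> : \int[@lebesgue_measure R]_(t in `[0, 1]) ((- (c / 2) * (t, 1 - t).1 + - (c / 2) * (t, 1 - t).2) * phi (toT A2 (t, 1 - t)))
    = - \int[@lebesgue_measure R]_(t in `[0, 1]) ((c / 2 * (t, 1 - t).1 + c / 2 * (t, 1 - t).2) * phi (toT A1 (t, 1 - t))).
    have edge (t : R) : toT A2 (t, 1 - t) = toT A1 (t, 1 - t).
      by rewrite /toT /affmap /=; congr pair; ring.
    rewrite -[RHS]mulN1r -RintegralZl //; last first.
      apply: (@continuous_itv01_integrable R (fun t => (c / 2 * (t, 1 - t).1 + c / 2 * (t, 1 - t).2) * phi (toT A1 (t, 1 - t)))).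
      have [? _ _ _ _] := Cx; have [? _ _ _ _] := Cy.
      have cphi' : continuous (fun y => (c / 2 * y.1 + c / 2 * y.2) * phi (toT A1 y)).
        apply: continuousM_plane; first exact: continuousD_plane.
        by move=> y; apply: continuous_comp; [exact: continuous_affmap|exact: cf].
      by apply: (continuous_comp_pair cphi'); [move=> t; exact: cvg_id|exact: continuous_onem].
    by apply: eq_Rintegral => t _; rewrite edge /=; ring.
  rewrite det_apex1 det_apex2 normrN; ring.
- apply: (@le_trans _ _ (J (fun x => ((\1_(pt A1) x * (u1 x).1) ^+ 2 + (\1_(pt A1) x * (u1 x).2) ^+ 2) +
      ((\1_(pt A2) x * (u2 x).1) ^+ 2 + (\1_(pt A2) x * (u2 x).2) ^+ 2)))).
    apply: eq_ler; congr J; apply/funext => x; have [_ _] := ind x; rewrite -pA1 -pA2 => i0.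
    move: (u1 x) (u2 x) (\1_(pt A1) x : R) (\1_(pt A2) x : R) i0 => v w a b i0.
    apply/eqP; rewrite -subr_eq0; apply/eqP.
    transitivity ((a * b) * (2 * (v.1 * w.1 + v.2 * w.2))); first by ring.
    by rewrite i0 mul0r.
  rewrite JD; last 2 first.
  + by case: cu1 => ? ?; apply: bmD; apply: bm_sqr; exact: bm_ptM.
  + by case: cu2 => ? ?; apply: bmD; apply: bm_sqr; exact: bm_ptM.
  have := apex_bound (c / 2) dA1 eA1; have := apex_bound (- (c / 2)) dA2 eA2.
  rewrite -/u1 -/u2 det_apex1 det_apex2 normrN normrM (ger0_norm (x := 2^-1)) ?invr_ge0 //.
  have : 0 <= energy T * c ^+ 2 * `|det T| by do 2?apply: mulr_ge0; rewrite ?energy_ge0 ?sqr_ge0 ?normr_ge0.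
  rewrite sqrrN expr_div_n; set E := energy T; set d := `|det T|; set c2 := c ^+ 2 => h0 h1 h2.
  apply: le_trans (lerD h2 h1) _; rewrite -subr_ge0.
  by rewrite (_ : _ - _ = 3 / 4 * (E * c2 * d)); [lra|field].
Qed.

Lemma refines_sub T L : refines T L -> det T != 0 -> forall S, S \in L -> det S != 0 /\ pt S `<=` pt T.
Proof.
elim=> {T L} [T|T L1 L2 _ IH1 _ IH2] D0 S.
  by rewrite inE => /eqP ->; split.
have [d1 d2] := det_bisect_neq0 D0.
rewrite mem_cat => /orP[/(IH1 d1)[dS sub]|/(IH2 d2)[dS sub]]; split => // x /sub.
  by move=> /(pt_bisect1 _ D0)[].
by move=> /(pt_bisect2 _ D0)[].
Qed.

Definition piecewise k (L : seq (triangle R)) g :=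
  forall S, S \in L -> exists2 q, polynomial2 k q & forall x, pt S x -> g x = q x.

Lemma poly2_cst k (c : R) : polynomial2 k (fun=> c : R).
Proof. by apply: poly2_ext (poly2Z c (@poly2_mono R k 0 0 (leq0n k))) _ => x; rewrite /mono; ring. Qed.

(** Pythagoras: [c] is the mean of [g] on [A], and subtracting a mean is an orthogonal
    projection. *)
Lemma J_indic_sqrB (A : set (R * R)) g (c : R) : bm (\1_A : R * R -> R) -> bm g ->
  J (fun x => \1_A x * g x) = c * J \1_A ->
  J (fun x => \1_A x * (g x - c * \1_A x) ^+ 2) = J (fun x => \1_A x * g x ^+ 2) - c ^+ 2 * J \1_A.
Proof.
move=> bA bg gc.
have b1 : bm (fun x => \1_A x * g x) by exact: bmM.
have b2 : bm (fun x => \1_A x * g x ^+ 2) by apply: bmM => //; exact: bm_sqr.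
rewrite (_ : (fun x => \1_A x * (_ - _) ^+ 2) =
  fun x => \1_A x * g x ^+ 2 - (2 * c) * (\1_A x * g x) + c ^+ 2 * \1_A x).
  rewrite JD ?JB ?JZ //; [rewrite gc; ring|exact: bmZ|by apply: bmB => //; exact: bmZ|exact: bmZ].
apply/funext => x; rewrite indicE; case: (_ \in _) => /=; ring.
Qed.

(** The fluxes of the two subtrees have disjoint supports, but each overlaps the flux of the node,
    whence a weighted inequality for the squares. The contraction of the energy leaves room for the
    weight on the subtrees; the squared means split off by orthogonality cover the node. [K] is thus
    the same at every depth. *)
Lemma tree_solve k : exists K : R, 0 <= K /\ forall T L, refines T L -> det T != 0 ->
  forall g, bm g -> piecewise k L g -> J (fun x => \1_(pt T) x * g x) = 0 ->
  exists t1 t2, localsol k T L g t1 t2 (K * energy T * J (fun x => \1_(pt T) x * g x ^+ 2)).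
Proof.
have [C [C0 HC]] := leaf_solve k.
(* Young's weights 7/6 and 7 satisfy 7/6 * 3/4 < 1, so that the loss in adding the
   flux between the children is absorbed once K >= 14. *)
pose K := Num.max 14 C; have K14 : 14 <= K by rewrite le_max lexx.
have CK : C <= K by rewrite le_max lexx orbT.
have K0 : 0 <= K by lra.
exists K; split => // T L; elim=> {T L} [T|T L1 L2 r1 IH1 r2 IH2] D0 g bg pg g0.
  have [t1 [t2 [h1 h2 h3 h4 h5]]] := HC T g D0 (pg T (mem_head _ _)) g0.
  exists t1, t2; split => //; apply: le_trans h5 _.
  rewrite -!mulrA ler_wpM2r // mulr_ge0 ?energy_ge0 //.
  by apply: J_ge0 => x; rewrite mulr_ge0 ?sqr_ge0 // indicE ler0n.
set T1 := (bisect T).1 in r1 IH1 *; set T2 := (bisect T).2 in r2 IH2 *.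
have [d1 d2] := det_bisect_neq0 D0; rewrite -/T1 -/T2 in d1 d2.
have b1 := bm_pt d1; have b2 := bm_pt d2; have bT := bm_pt D0.
have ind x := indic_bisect_sub x D0; rewrite -/T1 -/T2 in ind.
(* The common area of the two children. *)
set A := `|det T| / 4.
have A0 : 0 < A by rewrite divr_gt0 // normr_gt0.
have JA1 : J \1_(pt T1) = A.
  by rewrite J_pt // det_bisect1 normrM (ger0_norm (x := 2^-1)) ?invr_ge0 // /A; field.
have JA2 : J \1_(pt T2) = A.
  by rewrite J_pt // det_bisect2 normrM (ger0_norm (x := 2^-1)) ?invr_ge0 // /A; field.
have split_J (u : R * R -> R) : bm u -> J (fun x => \1_(pt T) x * u x) =
    J (fun x => \1_(pt T1) x * u x) + J (fun x => \1_(pt T2) x * u x).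
  move=> bu; rewrite -JD; [|exact: bmM|exact: bmM].
  apply: ae_eq_J; [exact: bmM|by apply: bmD; exact: bmM|].
  by apply: ae_leb2W (indic_bisect D0) => x ->; rewrite mulrDl.
(* The mean of [g] on the first child; since [g] has mean zero on [T] and the areas are equal, the
   other mean is [- c]. *)
pose c := J (fun x => \1_(pt T1) x * g x) / A.
have g1c : J (fun x => \1_(pt T1) x * g x) = c * J \1_(pt T1) by rewrite JA1 /c divfK // gt_eqF.
have g2c : J (fun x => \1_(pt T2) x * g x) = (- c) * J \1_(pt T2).
  have := split_J g bg; rewrite g0 g1c JA1 JA2 => /eqP; rewrite eq_sym addr_eq0 => /eqP h.
  by rewrite mulNr h opprK.
pose g1 x := g x - c * \1_(pt T1) x; pose g2 x := g x - (- c) * \1_(pt T2) x.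
have bg1 : bm g1 by apply: bmB => //; exact: bmZ.
have bg2 : bm g2 by apply: bmB => //; exact: bmZ.
have mean0 (S : triangle R) (e : R) : bm (\1_(pt S) : R * R -> R) -> J (fun x => \1_(pt S) x * g x) = e * J \1_(pt S) ->
    J (fun x => \1_(pt S) x * (g x - e * \1_(pt S) x)) = 0.
  move=> bS gS; rewrite (_ : (fun x => _) = fun x => \1_(pt S) x * g x - e * \1_(pt S) x).
    by rewrite JB ?JZ ?gS ?subrr //; [exact: bmM|exact: bmZ].
  by apply/funext => x; rewrite indicE; case: (_ \in _) => /=; ring.
have pg1 : piecewise k L1 g1.
  move=> S SL; have [dS sub] := refines_sub r1 d1 SL.
  have [q pq gq] : exists2 q, polynomial2 k q & forall x, pt S x -> g x = q x by apply: pg; rewrite mem_cat SL.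
  exists (fun x => q x + - c); first by apply: poly2D => //; exact: poly2_cst.
  by move=> x px; rewrite /g1 gq // indicE mem_set ?mulr1 //; exact: sub.
have pg2 : piecewise k L2 g2.
  move=> S SL; have [dS sub] := refines_sub r2 d2 SL.
  have [q pq gq] : exists2 q, polynomial2 k q & forall x, pt S x -> g x = q x by apply: pg; rewrite mem_cat SL orbT.
  exists (fun x => q x + c); first by apply: poly2D => //; exact: poly2_cst.
  by move=> x px; rewrite /g2 gq // indicE mem_set ?mulr1 ?opprK //; exact: sub.
have [a1 [a2 [[ba1 ba2] az aS aw ab]]] := IH1 d1 g1 bg1 pg1 (mean0 _ _ b1 g1c).
have [e1 [e2 [[be1 be2] ez eS ew eb]]] := IH2 d2 g2 bg2 pg2 (mean0 _ _ b2 g2c).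
have [s1 [s2 [[bs1 bs2] sz sS sw sb]]] := node_solve k c D0; rewrite -/T1 -/T2 in sS sw.
exists (fun x => a1 x + e1 x + s1 x), (fun x => a2 x + e2 x + s2 x).
have sub1 x : ~ pt T x -> ~ pt T1 x by move=> nx /(pt_bisect1 _ D0)[].
have sub2 x : ~ pt T x -> ~ pt T2 x by move=> nx /(pt_bisect2 _ D0)[].
have dis x : pt T1 x -> ~ pt T2 x.
  move=> /(pt_bisect1 _ D0)[_ h] /(pt_bisect2 _ D0)[_ h'].
  by have := lt_trans h h'; rewrite ltxx.
split.
- by split; apply: bmD => //; exact: bmD.
- move=> x nx; have [-> ->] := az x (sub1 x nx); have [-> ->] := ez x (sub2 x nx).
  by have [-> ->] := sz x nx; rewrite !addr0.
- move=> S; rewrite mem_cat => /orP[SL|SL].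
    have [dS sub] := refines_sub r1 d1 SL; have [ta fa Ea] := aS S SL.
    have [ts fs Es] := sS T1 (mem_head _ _).
    exists (fun x => ((ta x).1 + (ts x).1, (ta x).2 + (ts x).2)); first exact: RT_D.
    move=> x px; have [-> ->] := ez x (dis x (sub x px)).
    by rewrite -(Ea x px) -(Es x (sub x px)) /= !addr0.
  have [dS sub] := refines_sub r2 d2 SL; have [te fe Ee] := eS S SL.
  have T2in : T2 \in [:: T1; T2] by rewrite inE mem_seq1 eqxx orbT.
  have [ts fs Es] := sS T2 T2in.
  exists (fun x => ((te x).1 + (ts x).1, (te x).2 + (ts x).2)); first exact: RT_D.
  move=> x px; have n1 : ~ pt T1 x by move=> p1; exact: dis p1 (sub x px).
  have [-> ->] := az x n1.
  by rewrite -(Ee x px) -(Es x (sub x px)) /= !add0r.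
- move=> phi p r Cphi; have [cf cp cr _ _] := Cphi.
  have bw (u v : R * R -> R) : bm u -> bm v -> bm (fun x => u x * p x + v x * r x).
    by move=> bu bv; apply: bmD; exact: bmM_continuous.
  rewrite (_ : (fun x => _) = fun x => (a1 x * p x + a2 x * r x) + (e1 x * p x + e2 x * r x) + (s1 x * p x + s2 x * r x)); last first.
    by apply/funext => x; ring.
  rewrite JD; [|by apply: bmD; exact: bw|exact: bw].
  rewrite JD; [|exact: bw|exact: bw].
  rewrite (aw _ _ _ Cphi) (ew _ _ _ Cphi) (sw _ _ _ Cphi).
  have bgp : bm (fun x => g x * phi x) by exact: bmM_continuous.
  have bp (S : triangle R) : bm (\1_(pt S) : R * R -> R) -> bm (fun x => \1_(pt S) x * phi x).
    by move=> bS; exact: bmM_continuous.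
  have mn (S : triangle R) (e : R) : bm (\1_(pt S) : R * R -> R) -> J (fun x => \1_(pt S) x * ((g x - e * \1_(pt S) x) * phi x)) =
      J (fun x => \1_(pt S) x * (g x * phi x)) - e * J (fun x => \1_(pt S) x * phi x).
    move=> bS; rewrite -JZ; last exact: bp.
    rewrite -JB; [|exact: bmM|by apply: bmZ; exact: bp].
    by congr J; apply/funext => x; rewrite indicE; case: (_ \in _) => /=; ring.
  rewrite /g1 /g2 (mn _ _ b1) (mn _ _ b2) (split_J _ bgp).
  have -> : J (fun x => \1_(pt T) x * ((c * \1_(pt T1) x - c * \1_(pt T2) x) * phi x)) =
      c * J (fun x => \1_(pt T1) x * phi x) - c * J (fun x => \1_(pt T2) x * phi x).
    rewrite -!JZ; [|exact: bp|exact: bp].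
    rewrite -JB; [|by apply: bmZ; exact: bp|by apply: bmZ; exact: bp].
    congr J; apply/funext => x; have [i1 i2 _] := ind x; rewrite -[in RHS]i1 -[in RHS]i2; ring.
  move: (J (fun x => \1_(pt T1) x * (g x * phi x))) (J (fun x => \1_(pt T2) x * (g x * phi x)))
    (J (fun x => \1_(pt T1) x * phi x)) (J (fun x => \1_(pt T2) x * phi x)); clear => w1 w2 w3 w4.
  by ring.
- have bsq (u v : R * R -> R) : bm u -> bm v -> bm (fun x => u x ^+ 2 + v x ^+ 2).
    by move=> bu bv; apply: bmD; exact: bm_sqr.
  pose Ja := J (fun x => a1 x ^+ 2 + a2 x ^+ 2); pose Je := J (fun x => e1 x ^+ 2 + e2 x ^+ 2).
  pose Js := J (fun x => s1 x ^+ 2 + s2 x ^+ 2).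
  apply: (@le_trans _ _ (7 / 6 * (Ja + Je) + 7 * Js)).
    rewrite /Ja /Je -JD; [|exact: bsq|exact: bsq].
    rewrite -JZ; last by apply: bmD; exact: bsq.
    rewrite /Js -JZ; last exact: bsq.
    rewrite -JD; [|by apply: bmZ; apply: bmD; exact: bsq|by apply: bmZ; exact: bsq].
    apply: le_J.
    + by apply: bsq; apply: bmD => //; exact: bmD.
    + by apply: bmD; apply: bmZ; [apply: bmD|]; exact: bsq.
    (* The cross term is split as 2uv <= u^2/6 + 6v^2. *)
    have young (u v : R) : (u + v) ^+ 2 <= 7 / 6 * u ^+ 2 + 7 * v ^+ 2.
      have := sqr_ge0 (u - 6 * v); rewrite -subr_ge0 => h; rewrite -subr_ge0.
      rewrite (_ : _ - _ = (u - 6 * v) ^+ 2 / 6); last by field.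
      by rewrite divr_ge0 // sqr_ge0.
    move=> x; have [p1|n1] := pselect (pt T1 x).
      have [-> ->] := ez x (dis x p1); rewrite !addr0 expr0n /= !addr0.
      by move: (young (a1 x) (s1 x)) (young (a2 x) (s2 x)); clear; lra.
    have [-> ->] := az x n1; rewrite !add0r expr0n /= !add0r.
    by move: (young (e1 x) (s1 x)) (young (e2 x) (s2 x)); clear; lra.
  pose Q1 := J (fun x => \1_(pt T1) x * g1 x ^+ 2); pose Q2 := J (fun x => \1_(pt T2) x * g2 x ^+ 2).
  have Q10 : 0 <= Q1 by apply: J_ge0 => x; rewrite mulr_ge0 ?sqr_ge0 // indicE ler0n.
  have Q20 : 0 <= Q2 by apply: J_ge0 => x; rewrite mulr_ge0 ?sqr_ge0 // indicE ler0n.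
  have [en1 en2] := energy_bisect T; rewrite -/T1 -/T2 in en1 en2.
  have E0 := energy_ge0 T; set E := energy T in E0 en1 en2 sb *.
  have hA : Ja <= K * (3 / 4 * E) * Q1.
    by apply: (le_trans ab); apply: ler_wpM2r => //; apply: ler_wpM2l.
  have hE : Je <= K * (3 / 4 * E) * Q2.
    by apply: (le_trans eb); apply: ler_wpM2r => //; apply: ler_wpM2l.
  (* Pythagoras on each child; the term [2 * c ^+ 2 * A] is the part of the norm that pays for the
     node. *)
  have QE : J (fun x => \1_(pt T) x * g x ^+ 2) = Q1 + Q2 + 2 * c ^+ 2 * A.
    rewrite (split_J _ (bm_sqr bg)) /Q1 /Q2 (J_indic_sqrB b1 bg g1c) (J_indic_sqrB b2 bg g2c).
    rewrite JA1 JA2; move: (J _) (J _); clear => w1 w2; ring.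
  rewrite QE; have c20 := sqr_ge0 c; set c2 := c ^+ 2 in sb c20 *.
  have hS : Js <= E * c2 * (4 * A) by apply: le_trans sb _; rewrite /A; apply: eq_ler; field.
  have p1 : 0 <= K * E * Q1 by do 2?apply: mulr_ge0.
  have p2 : 0 <= K * E * Q2 by do 2?apply: mulr_ge0.
  have p3 : 0 <= (K - 14) * (E * c2 * A) by apply: mulr_ge0; [rewrite subr_ge0|do 2?apply: mulr_ge0 => //; exact: ltW].
  (* The number 28 = 2 * 14 equals 7 * 4: Young's weight times the constant 4 in the bound of
     [Js]. *)
  have -> : K * E * (Q1 + Q2 + 2 * c2 * A) = K * E * Q1 + K * E * Q2 + 2 * ((K - 14) * (E * c2 * A)) + 28 * (E * c2 * A) by ring.
  have hA' : Ja <= 3 / 4 * (K * E * Q1) by apply: le_trans hA _; apply: eq_ler; field.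
  have hE' : Je <= 3 / 4 * (K * E * Q2) by apply: le_trans hE _; apply: eq_ler; field.
  have hS' : Js <= 4 * (E * c2 * A) by apply: le_trans hS _; apply: eq_ler; field.
  by move: hA' hE' hS' p1 p2 p3; clear; lra.
Qed.

End tree_problem.

(** * Smooth cutoffs *)

Section bump.
Context {R : realType}.
Implicit Types (f g p q : R * R -> R) (t : R).

(** The classical flat function exp(-1/t) multiplied by negative powers of t: a family whose linear
    span is closed under differentiation. *)
Definition eta (m : nat) t : R := if 0 < t then t^-1 ^+ m * expR (- t^-1) else 0.

Lemma eta_ge0 m t : 0 <= eta m t.
Proof.
rewrite /eta; case: ltP => // t0.
by rewrite mulr_ge0 ?expR_ge0 // exprn_ge0 // invr_ge0 ltW.
Qed.

(** The exponential of [1/t] exceeds the term of order [m.+1] of its series. The linear bound yields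
    the limit 0 at the origin. *)
Lemma eta_le m t : eta m t <= m.+1`!%:R * `|t|.
Proof.
rewrite /eta; case: ltP => [t0|_]; last by rewrite mulr_ge0.
have u0 : 0 < t^-1 by rewrite invr_gt0.
have H : t^-1 ^+ m.+1 / m.+1`!%:R <= expR t^-1.
  by apply: le_trans (expR_ge1Dxn m (ltW u0)); rewrite lerDr.
have F0 : 0 < m.+1`!%:R :> R by rewrite ltr0n fact_gt0.
rewrite expRN (ger0_norm (ltW t0)) ler_pdivrMr ?expR_gt0 //.
rewrite -mulrA -ler_pdivrMl // -ler_pdivrMl // mulrCA mulrC.
by rewrite -exprS.
Qed.

Lemma eta0_le1 t : eta 0 t <= 1.
Proof.
rewrite /eta; case: ltP => // t0; rewrite expr0 mul1r -expR0 ler_expR oppr_le0.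
by rewrite invr_ge0 ltW.
Qed.

Lemma eta0_ge t : 0 < t -> 1 - t^-1 <= eta 0 t.
Proof. by move=> t0; rewrite /eta t0 expr0 mul1r; exact: expR_ge1Dx. Qed.

Lemma is_derive_eta m t :
  is_derive t 1 (eta m) (eta m.+2 t - m%:R * eta m.+1 t).
Proof.
have [t0|t0|->] := ltgtP t 0.
- rewrite {2 3}/eta !ltNge (ltW t0) /= mulr0 subr0.
  apply: (@near_eq_is_derive _ _ _ (fun=> 0 : R)).
  by near=> s; rewrite /eta ltNge ltW //; near: s; exact: lt_nbhsl.
- have tn0 : t != 0 by rewrite gt_eqF.
  have dV : is_derive t 1 (fun s : R => s^-1) (- t ^- 2 *: 1).
    exact: (@is_deriveV _ id t 1 1).
  have dN : is_derive t 1 (fun s : R => - s^-1) (t^-1 ^+ 2).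
    by apply: is_derive_eq (is_deriveN dV) _; rewrite scaler1 opprK exprVn.
  have dE := @is_derive1_comp _ _ (fun s : R => - s^-1) _ _ _ (is_derive_expR (- t^-1)) dN.
  apply: (near_eq_is_derive (f := (fun s : R => s^-1) ^+ m * (expR \o (fun s : R => - s^-1)))).
    by near=> s; rewrite /eta ifT ?fctE ?fctE //; near: s; exact: lt_nbhsr.
  apply: is_derive_eq (is_deriveM (is_deriveX m dV) dE) _.
  rewrite /eta t0 /= scaler1 -!/(GRing.scale _ _) /GRing.scale /= -exprVn.
  rewrite exprfctE; case: m => [|m]; first by rewrite expr0; ring.
  by rewrite !exprS; ring.
- have E0 : eta m 0 = 0 by rewrite /eta ltxx.
  (* At the origin the difference quotient of [eta m] is exactly [eta m.+1]. *)
  have E : (fun h : R => h^-1 *: ((eta m \o shift 0) (h *: (1 : R)) - eta m 0)) = eta m.+1.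
    apply/funext => h; rewrite E0 /= [h *: 1]mulr1 addr0 subr0 /eta.
    case: ltP => _; last exact: scaler0.
    by rewrite exprS -mulrA.
  have C : eta m.+1 h @[h --> 0^'] --> (0 : R).
    apply/cvgrPdist_lt => e e0; near=> h.
    rewrite sub0r normrN (ger0_norm (eta_ge0 _ _)); apply: le_lt_trans (eta_le _ _) _.
    rewrite -ltr_pdivlMl ?ltr0n ?fact_gt0 //; near: h; apply: dnbhs0_lt.
    by rewrite mulr_gt0 // invr_gt0 ltr0n fact_gt0.
  apply: DeriveDef; first by rewrite /derivable E; apply/cvg_ex; exists 0.
  rewrite /derive E; apply: cvg_lim => //.
  by rewrite /eta ltxx mulr0 subr0.
Unshelve. all: by end_near. Qed.

Lemma C1_eta m : C1 (fun x : R * R => eta m x.1) (fun x => eta m.+2 x.1 - m%:R * eta m.+1 x.1)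
  (fun=> 0 : R).
Proof.
have ce l : continuous (fun x : R * R => eta l x.1).
  move=> x; apply: (@continuous_comp _ _ _ fst (eta l)); first exact: continuous_fst.
  exact: (is_derive_continuous (is_derive_eta l)).
split => //.
- by move=> x; apply: cvgB; [exact: ce|apply: cvgM; [exact: cvg_cst|exact: ce]].
- by move=> x; exact: cvg_cst.
- by move=> x; exact: is_derive_eta.
- by move=> x /=; exact: is_derive_cst.
Qed.

(** A syntactic class containing the partial derivatives of its members, so that [Ck k] follows for
    all [k] by induction. Composition with affine maps transports the one-variable [eta] to any
    direction. *)
Inductive smooth : (R * R -> R) -> Prop :=
| smooth_cst c : smooth (fun=> c)
| smooth_fst : smooth fst
| smooth_snd : smooth snd
| smooth_eta m : smooth (fun x => eta m x.1)
| smooth_affmap f a b e c d h : smooth f -> smooth (f \o affmap a b e c d h)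
| smoothD f g : smooth f -> smooth g -> smooth (fun x => f x + g x)
| smoothM f g : smooth f -> smooth g -> smooth (fun x => f x * g x).

Lemma smooth_C1 f : smooth f -> exists p q, [/\ smooth p, smooth q & C1 f p q].
Proof.
elim=> {f} [c| | |m|f a b e c d h _ [p [q [sp sq H]]]|f g sf [p [q [sp sq H]]] sg [r [s [sr ss K]]]|
  f g sf [p [q [sp sq H]]] sg [r [s [sr ss K]]]].
- by exists (fun=> 0), (fun=> 0); split; [exact: smooth_cst|exact: smooth_cst|exact: C1_cst].
- by exists (fun=> 1), (fun=> 0); split; [exact: smooth_cst|exact: smooth_cst|exact: C1_fst].
- by exists (fun=> 0), (fun=> 1); split; [exact: smooth_cst|exact: smooth_cst|exact: C1_snd].
- exists (fun x => eta m.+2 x.1 + (- m%:R) * eta m.+1 x.1), (fun=> 0); split.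
  + by apply: smoothD; [|apply: smoothM; first exact: smooth_cst]; exact: smooth_eta.
  + exact: smooth_cst.
  + by apply: C1_ext (C1_eta m) _ _ _ => x //; rewrite mulNr.
- have := C1_affmap a b e c d h H; set A := affmap a b e c d h => HA.
  exists (fun z => a * (p \o A) z + c * (q \o A) z), (fun z => b * (p \o A) z + d * (q \o A) z).
  split; last exact: HA.
  + by apply: smoothD; (apply: smoothM; [exact: smooth_cst|exact: smooth_affmap]).
  + by apply: smoothD; (apply: smoothM; [exact: smooth_cst|exact: smooth_affmap]).
- exists (fun z => p z + r z), (fun z => q z + s z).
  by split; [exact: smoothD|exact: smoothD|exact: C1D].
- exists (fun z => f z * r z + g z * p z), (fun z => f z * s z + g z * q z).
  by split; [apply: smoothD; exact: smoothM|apply: smoothD; exact: smoothM|exact: C1M].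
Qed.

Lemma C1_derive f p q : C1 f p q ->
  [/\ forall x, derivable f x ((1, 0) : R * R), forall x, derivable f x ((0, 1) : R * R),
      d1 f = p & d2 f = q].
Proof.
move=> [_ _ _ fp fq].
split.
- by move=> x; have [+ _] := fp x; rewrite /derivable slice1_quotient.
- by move=> x; have [+ _] := fq x; rewrite /derivable slice2_quotient.
- by apply/funext => x; have [_ <-] := fp x; rewrite /d1 /derive slice1_quotient.
- by apply/funext => x; have [_ <-] := fq x; rewrite /d2 /derive slice2_quotient.
Qed.

Lemma smooth_Ck k f : smooth f -> Ck k f.
Proof.
elim: k f => [|k IH] f /smooth_C1[p [q [sp sq H]]]; first by case: H.
have [df1 df2 E1 E2] := C1_derive H.
by case: H => cf _ _ _ _; split; [exact: cf|exact: df1|exact: df2|rewrite E1; exact: IH|rewrite E2; exact: IH].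
Qed.

Lemma smooth_poly k q : polynomial2 k q -> smooth q.
Proof.
apply: poly2_ind; first exact: smooth_cst.
- exact: smoothD.
- by move=> a r sr; apply: smoothM => //; exact: smooth_cst.
- move=> i j _; apply: smoothM.
    elim: i => [|i IH]; first exact: smooth_cst.
    by under eq_fun do rewrite exprS; apply: smoothM => //; exact: smooth_fst.
  elim: j => [|j IH]; first exact: smooth_cst.
  by under eq_fun do rewrite exprS; apply: smoothM => //; exact: smooth_snd.
Qed.

End bump.

(** * Cutoffs exhausting a triangle *)

Section cutoff.
Context {R : realType}.
Implicit Types (T : triangle R) (Om : set (R * R)) (q : R * R -> R) (y : R * R).

(** One factor per side, zero as soon as the corresponding barycentric coordinate is at most
    [1 / n.+1]. There is no plateau: the values lie in [0, 1] and tend to 1 inside the triangle,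
    which suffices for dominated convergence. *)
Definition cutoff (n : nat) y : R :=
  eta 0 (n.+1%:R * y.1 - 1) * eta 0 (n.+1%:R * y.2 - 1) *
  eta 0 (n.+1%:R * (1 - y.1 - y.2) - 1).

Lemma smooth_cutoff n : smooth (cutoff n).
Proof.
pose k : R := n.+1%:R; pose e := fun y : R * R => eta 0 y.1.
have -> : cutoff n = fun y => (e \o affmap k 0 (-1) 0 0 0) y * (e \o affmap 0 k (-1) 0 0 0) y *
    (e \o affmap (- k) (- k) (k - 1) 0 0 0) y.
  by apply/funext => y; rewrite /cutoff /e /= -/k; do 2?congr (_ * _); congr eta; ring.
by apply: smoothM; first apply: smoothM; apply: smooth_affmap; exact: smooth_eta.
Qed.

Lemma cutoff_ge0_le1 n y : 0 <= cutoff n y <= 1.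
Proof.
rewrite /cutoff !mulr_ge0 ?eta_ge0 //=.
by do 2?[rewrite mulr_ile1 ?mulr_ge0 ?eta_ge0 ?eta0_le1 //].
Qed.

Definition core (n : nat) : set (R * R) :=
  [set y | [/\ 1 <= n.+1%:R * y.1, 1 <= n.+1%:R * y.2 & 1 <= n.+1%:R * (1 - y.1 - y.2)]].

Lemma core_Rf n : core n `<=` Rf.
Proof.
move=> y [y1 y2 y3]; have n0 : 0 < n.+1%:R :> R by rewrite ltr0n.
have pos (s : R) : 1 <= n.+1%:R * s -> 0 < s.
  by move=> h; rewrite -(pmulr_rgt0 _ n0); exact: lt_le_trans h.
by split; [exact: pos|exact: pos|have := pos _ y3; lra].
Qed.

Lemma cutoff_supp n y : cutoff n y != 0 -> core n y.
Proof.
rewrite /cutoff !mulf_eq0 !negb_or => /andP[/andP[h1 h2] h3].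
have pos (s : R) : eta 0 (s - 1) != 0 -> 1 <= s.
  by rewrite /eta; case: ltP; [lra|rewrite eqxx].
by split; exact: pos.
Qed.

Lemma closed_core n : closed (core n).
Proof.
have cl (u : R * R -> R) : continuous u -> closed [set y | 1 <= n.+1%:R * u y].
  move=> cu; rewrite (_ : [set _ | _] = (fun y => n.+1%:R * u y) @^-1` [set s | 1 <= s]) //.
  apply: preimage_closed; last exact: closed_ge.
  by move=> y _; apply: cvgM; [exact: cvg_cst|exact: cu].
have -> : core n = [set y | 1 <= n.+1%:R * y.1] `&` ([set y | 1 <= n.+1%:R * y.2] `&`
    [set y | 1 <= n.+1%:R * (1 - y.1 - y.2)]).
  by rewrite predeqE => y; split => [[]|[? []]].
apply: closedI; first by apply: cl; exact: continuous_fst.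
apply: closedI; first by apply: cl; exact: continuous_snd.
apply: cl => y; apply: cvgB; last exact: continuous_snd.
by apply: cvgB; [exact: cvg_cst|exact: continuous_fst].
Qed.

Lemma cutoff_cvg y : Rf y -> cutoff n y @[n --> \oo] --> (1 : R).
Proof.
move=> [y1 y2 y3].
have F (a b c : R) : a <= 1 -> 1 - b <= a -> b < c -> 0 < c -> `|1 - a| < c.
  by rewrite ltr_norml => *; apply/andP; split; lra.
have c1 (s : R) : 0 < s -> eta 0 (n.+1%:R * s - 1) @[n --> \oo] --> (1 : R).
  move=> s0; apply/cvgrPdist_lt => e e0; near=> n.
  have hw : e^-1 < n.+1%:R * s - 1.
    rewrite ltrBrDr -ltr_pdivrMr // -natr1 (le_lt_trans (y := n%:R)) ?ltrDl //.
    by near: n; exact: nbhs_infty_ger.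
  have w0 : 0 < n.+1%:R * s - 1 by rewrite (lt_trans _ hw) // invr_gt0.
  have wV : (n.+1%:R * s - 1)^-1 < e by rewrite invf_plt.
  exact: F (eta0_le1 _) (eta0_ge w0) wV e0.
have h3 : 0 < 1 - y.1 - y.2 by lra.
rewrite -[1 in X in _ --> X]mulr1 -{1}[1]mulr1.
by apply: cvgM; [apply: cvgM; exact: c1|exact: c1].
Unshelve. all: by end_near. Qed.

Lemma test_cutoff Om T k q n : det T != 0 -> pt T `<=` Om -> polynomial2 k q ->
  test_function Om (fun x => q x * cutoff n (ofT T x)).
Proof.
move=> D0 TOm pq; set phi := (fun x => _).
have sub : closure [set x | phi x != 0] `<=` ofT T @^-1` core n.
  rewrite closureEbigcap => x; apply; split.
    by apply: preimage_closed; [move=> z _; exact: continuous_ofT|exact: closed_core].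
  by move=> z; rewrite /= /phi mulf_eq0 negb_or => /andP[_]; exact: cutoff_supp.
split.
- move=> l; apply: smooth_Ck; apply: smoothM; first exact: smooth_poly pq.
  by apply: (@smooth_affmap _ (cutoff n)); exact: smooth_cutoff.
- have [M HM] := tri_bounded T.
  apply: (@subclosed_compact _ _ (box M)).
  + exact: closed_closure.
  + by apply: compact_setX; exact: segment_compact.
  + move=> x /sub /core_Rf Rx; apply/boxP; apply: HM; apply: pt_sub_tri; exact/ptE.
- by move=> x /sub /core_Rf Rx; apply: TOm; exact/ptE.
Qed.
End cutoff.

(** * Square integrable functions *)

Section square_integrable.
Context {R : realType} (Om : set (R * R)) 
  (mO : @measurable _ (measurableTypeR R * measurableTypeR R)%type Om).
Implicit Types (f g h : R * R -> R) (s t : R * R -> R * R).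

(** The product is dominated by [f ^+ 2 + g ^+ 2]. *)
Lemma L2_mul_integrable f g : L2 Om f -> L2 Om g ->
  (leb2 R).-integrable Om (EFin \o (fun x => f x * g x)).
Proof.
move=> [mf f2] [mg g2]; have H := integrableD mO f2 g2.
apply: (@le_integrable _ _ _ (leb2 R) Om mO (EFin \o (fun x => f x * g x)) _ _ _ H).
  by apply/measurable_EFinP; exact: measurable_funM.
move=> x _ /=; rewrite lee_fin [leRHS]ger0_norm ?addr_ge0 ?sqr_ge0 //.
rewrite ler_norml.
have := sqr_ge0 (f x + g x); have := sqr_ge0 (f x - g x).
have := sqr_ge0 (f x); have := sqr_ge0 (g x).
by move: (f x) (g x) => a b; clear; nra.
Qed.

Lemma L2D f g : L2 Om f -> L2 Om g -> L2 Om (fun x => f x + g x).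
Proof.
move=> Lf Lg; have [mf f2] := Lf; have [mg g2] := Lg; split; first exact: measurable_funD.
have fg := L2_mul_integrable Lf Lg.
have := integrableD mO (integrableD mO f2 g2) (integrableD mO fg fg).
apply: eq_integrable => // x _ /=; rewrite -!EFinD; congr EFin; ring.
Qed.

Lemma L2Z k f : L2 Om f -> L2 Om (fun x => k * f x).
Proof.
move=> [mf f2]; split; first exact: measurable_funM.
have := integrableZl mO (k ^+ 2) f2.
by apply: eq_integrable => // x _ /=; rewrite -EFinM exprMn.
Qed.

Lemma L2B f g : L2 Om f -> L2 Om g -> L2 Om (fun x => f x - g x).
Proof.
move=> Lf Lg; have -> : (fun x => f x - g x) = (fun x => f x + (-1) * g x).
  by apply/funext => x; rewrite mulN1r.
by apply: L2D => //; exact: L2Z.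
Qed.

Lemma bm_L2 f : bm f -> L2 Om f.
Proof.
move=> bf; split; first by apply: measurable_funTS; case: bf.
exact: integrableS (bm_integrable (bm_sqr bf)).
Qed.

Lemma ipC f g : ip Om f g = ip Om g f.
Proof. by apply: eq_Rintegral => x _; rewrite mulrC. Qed.

Lemma ipBl f g h : L2 Om f -> L2 Om g -> L2 Om h ->
  ip Om (fun x => f x - g x) h = ip Om f h - ip Om g h.
Proof.
move=> Lf Lg Lh; rewrite /ip -RintegralB //; try exact: L2_mul_integrable.
by apply: eq_Rintegral => x _; rewrite mulrBl.
Qed.

Lemma ipDr f g h : L2 Om f -> L2 Om g -> L2 Om h ->
  ip Om h (fun x => f x + g x) = ip Om h f + ip Om h g.
Proof.
move=> Lf Lg Lh; rewrite /ip -RintegralD //; try exact: L2_mul_integrable.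
by apply: eq_Rintegral => x _; rewrite mulrDr.
Qed.

Lemma ae_eq_Rintegral f g : measurable_fun Om f -> measurable_fun Om g ->
  {ae leb2 R, forall x, Om x -> f x = g x} ->
  \int[leb2 R]_(x in Om) f x = \int[leb2 R]_(x in Om) g x.
Proof.
move=> mf mg fg; rewrite /Rintegral; congr fine.
apply: ae_eq_integral => //; try exact/measurable_EFinP.
by apply: ae_leb2W fg => x H /H ->.
Qed.

Lemma ip_ae_eqr f g h : L2 Om f -> L2 Om g -> L2 Om h ->
  {ae leb2 R, forall x, Om x -> f x = g x} -> ip Om h f = ip Om h g.
Proof.
move=> [mf _] [mg _] [mh _] fg; apply: ae_eq_Rintegral; try exact: measurable_funM.
by apply: ae_leb2W fg => x H /H ->.
Qed.

Lemma ip_ge0 f : 0 <= ip Om f f.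
Proof. by apply: Rintegral_ge0 => x _; rewrite -expr2 sqr_ge0. Qed.

Lemma Rintegral_J h : \int[leb2 R]_(x in Om) h x = J (fun x => \1_Om x * h x).
Proof.
rewrite Rintegral_mkcond; apply: eq_Rintegral => x _.
by rewrite patchE indicE; case: ifP => _; rewrite ?mul1r ?mul0r.
Qed.

Lemma Rintegral_J0 h : (forall x, ~ Om x -> h x = 0) -> \int[leb2 R]_(x in Om) h x = J h.
Proof.
move=> H; rewrite Rintegral_J; congr J; apply/funext => x; rewrite indicE.
by have [/mem_set ->|n] := pselect (Om x); rewrite ?mul1r // H // mulr0.
Qed.

Lemma vipE s t : L2vec Om s -> L2vec Om t ->
  vip Om s t = ip Om (fun x => (s x).1) (fun x => (t x).1) +
               ip Om (fun x => (s x).2) (fun x => (t x).2).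
Proof.
move=> [s1 s2] [t1 t2]; rewrite /vip /ip -RintegralD //; exact: L2_mul_integrable.
Qed.

Lemma L2vecB s t : L2vec Om s -> L2vec Om t -> L2vec Om (fun x => s x - t x).
Proof. by move=> [s1 s2] [t1 t2]; split; exact: L2B. Qed.

Lemma vipC s t : vip Om s t = vip Om t s.
Proof. by apply: eq_Rintegral => x _; congr (_ + _); rewrite mulrC. Qed.

Lemma vipBl s t v : L2vec Om s -> L2vec Om t -> L2vec Om v ->
  vip Om (fun x => s x - t x) v = vip Om s v - vip Om t v.
Proof.
move=> Ls Lt Lv; rewrite !vipE //; last exact: L2vecB.
have [s1 s2] := Ls; have [t1 t2] := Lt; have [v1 v2] := Lv.
by rewrite /= (ipBl s1 t1 v1) (ipBl s2 t2 v2); ring.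
Qed.

Lemma vip_ge0 s : 0 <= vip Om s s.
Proof. by apply: Rintegral_ge0 => x _; rewrite addr_ge0 // -expr2 sqr_ge0. Qed.

(** Under the orthogonality (s, s) = (s, t), the difference |t|^2 - |s|^2 equals |s - t|^2. *)
Lemma vip_le s t : L2vec Om s -> L2vec Om t -> vip Om s s = vip Om s t ->
  vip Om s s <= vip Om t t.
Proof.
move=> Ls Lt E; have := vip_ge0 (fun x => s x - t x).
have Lb := L2vecB Ls Lt.
rewrite (vipBl Ls Lt Lb) (vipC s) (vipC t (fun x => _)) (vipBl Ls Lt Ls) (vipBl Ls Lt Lt) (vipC t s) E.
by move: (vip _ s t) (vip _ t t) => a b; lra.
Qed.

End square_integrable.

(** * Uniqueness of the weak divergence *)

Section weak_divergence.
Context {R : realType} (Om : set (R * R))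
  (mO : @measurable _ (measurableTypeR R * measurableTypeR R)%type Om).
Implicit Types (f g h w q : R * R -> R) (T : triangle R).

(** The polynomial multiplied by cutoffs of [T] gives test functions which converge pointwise to
    [\1_(pt T) * q] and are dominated by it. *)
Lemma ip_test_eq0 w T k q : L2 Om w -> det T != 0 -> pt T `<=` Om -> polynomial2 k q ->
  (forall phi, test_function Om phi -> ip Om w phi = 0) ->
  ip Om w (fun x => \1_(pt T) x * q x) = 0.
Proof.
move=> Lw D0 TOm pq Hw.
pose phi n x := q x * cutoff n (ofT T x).
have tphi n : test_function Om (phi n) by exact: test_cutoff pq.
have Lq : L2 Om (fun x => \1_(pt T) x * q x).
  by apply: bm_L2 => //; apply: bmM_continuous; [exact: bm_pt|exact: poly2_continuous pq].
have cut0 n x : ~ pt T x -> cutoff n (ofT T x) = 0.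
  by move=> nx; apply/eqP; apply: contra_notT nx => /cutoff_supp /core_Rf ?; exact/ptE.
have I := L2_mul_integrable mO Lw Lq.
have mw := Lw.1.
have mphi n : @measurable_fun _ _ (measurableTypeR R * measurableTypeR R)%type R Om (phi n).
  by apply: measurable_funTS; apply: continuous_measurable_plane; have [/(_ 0%N)] := tphi n.
have D := @dominated_cvg _ _ _ (leb2 R) Om mO (fun n x => (w x * phi n x)%:E)
  (fun x => (w x * (\1_(pt T) x * q x))%:E) (fun x => `|w x * (\1_(pt T) x * q x)|%:E).
have {D} : (\int[leb2 R]_(x in Om) (w x * phi n x)%:E)%E @[n --> \oo] -->
    (\int[leb2 R]_(x in Om) (w x * (\1_(pt T) x * q x))%:E)%E.
  apply: D.
  - by move=> n; apply/measurable_EFinP; exact: measurable_funM.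
  - move=> x _; apply: cvg_EFin; first by near=> n.
    apply: cvgM; first exact: cvg_cst.
    rewrite /= mulrC; apply: cvgM; first exact: cvg_cst.
    rewrite indicE; have [Tx|nx] := pselect (pt T x).
      by rewrite mem_set //; apply: cutoff_cvg; exact/ptE.
    rewrite memNset //=; under eq_cvg do rewrite cut0 //.
    exact: cvg_cst.
  - by [].
  - by have := integrable_abse I.
  - move=> n x _ /=; rewrite lee_fin normrM [in leRHS]normrM ler_wpM2l // /phi mulrC normrM [in leRHS]normrM.
    rewrite ler_wpM2r //.
    rewrite indicE; have [Tx|nx] := pselect (pt T x); last by rewrite cut0 ?normr0 ?memNset.
    by rewrite mem_set // normr1; have /andP[? ?] := cutoff_ge0_le1 n (ofT T x); rewrite ger0_norm.
have -> : (\int[leb2 R]_(x in Om) (w x * (\1_(pt T) x * q x))%:E)%E =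
    (ip Om w (fun x => \1_(pt T) x * q x))%:E.
  by rewrite /ip /Rintegral fineK //; exact: (integrable_fin_num mO I).
move/fine_cvg => /= C.
have C0 : (fun n : nat => ip Om w (phi n)) @ \oo --> ip Om w (fun x => \1_(pt T) x * q x) := C.
move: C0; rewrite (_ : (fun n => _) = cst 0); last by apply/funext => n; exact: Hw.
by move/cvg_lim => <- //; rewrite lim_cst.
Unshelve. all: by end_near. Qed.
Lemma test_function_bm phi : test_function Om phi -> bm phi.
Proof.
move=> [/(_ 0%N) cphi cK _].
have [M [_ HM]] := compact_bounded cK.
have N0 : M < M + 1 by rewrite ltrDl.
have bB : bm (\1_(box (M + 1)) : R * R -> R) by apply: (bm_indic (M := M + 1)) => //; exact: measurable_box.
have -> : phi = fun x => \1_(box (M + 1)) x * phi x; last exact: bmM_continuous.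
apply/funext => x; have [->|nx] := eqVneq (phi x) 0; first by rewrite mulr0.
rewrite indicE mem_set ?mul1r //; apply/boxP.
have : `|x| <= M + 1 by apply: HM N0 _ _; exact: subset_closure.
by rewrite prod_normE ge_max => /andP[].
Qed.

End weak_divergence.

(** * Lifting over a triangulation *)

Lemma sum_pick (V : nmodType) (I : eqType) (s : seq I) (i : I) (F : I -> V) :
  uniq s -> i \in s -> (forall j, j \in s -> j != i -> F j = 0) -> \sum_(j <- s) F j = F i.
Proof.
move=> us si H; rewrite (bigD1_seq i) //= big_seq_cond big1 ?addr0 // => j /andP[sj].
exact: H.
Qed.

Lemma uniq_map_inj (A B : eqType) (f : A -> B) (s : seq A) :
  uniq (map f s) -> {in s &, injective f}.
Proof.
elim: s => // a s IH /= /andP[nfa us] x y; rewrite !inE => /orP[/eqP ->|xs] /orP[/eqP ->|ys] // E.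
- by rewrite E map_f in nfa.
- by rewrite -E map_f in nfa.
- exact: IH.
Qed.

(** * Tilings up to null sets and piecewise polynomials *)

Section tiling.
Context {R : realType}.
Implicit Types (Om : set (R * R)) (f g h w v : R * R -> R) (T : triangle R) (TT : seq (triangle R)).

Lemma ae_leb2_seq (I : eqType) (s : seq I) (P : I -> R * R -> Prop) :
  (forall i, i \in s -> {ae leb2 R, forall x, P i x}) ->
  {ae leb2 R, forall x, forall i, i \in s -> P i x}.
Proof.
elim: s => [_|i s IH H].
  have : (leb2 R).-negligible (set0 : set (R * R)) by exact: negligible_set0.
  by apply: negligibleS => x /= /existsNP[i /not_implyP[]].
have := ae_leb2I (H i (mem_head _ _)) (IH (fun j sj => H j (@mem_behead _ (i :: s) j sj))).
by apply: ae_leb2W => x [Pi Ps] j; rewrite inE => /orP[/eqP ->|/Ps].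
Qed.

Lemma ae_tri_pt TT : (forall T, T \in TT -> det T != 0) ->
  {ae leb2 R, forall x, forall T, T \in TT -> tri T x -> pt T x}.
Proof.
move=> D0; apply: (ae_leb2_seq (P := fun T x => tri T x -> pt T x)) => T TTT.
by apply: negligibleS (tri_pt_null (D0 _ TTT)) => x /= /not_implyP.
Qed.

(** The measure-theoretic content of a triangulation: disjoint open triangles in the domain that
    cover it almost everywhere. *)
Definition tiling Om TT := [/\ uniq TT, forall T, T \in TT -> det T != 0 /\ pt T `<=` Om,
  forall T T', T \in TT -> T' \in TT -> T <> T' -> forall x, pt T x -> ~ pt T' x &
  {ae leb2 R, forall x, Om x -> exists2 T, T \in TT & pt T x}].

Lemma triangulation_tiling Om TT : conforming_triangulation Om TT -> tiling Om TT.
Proof.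
move=> [uT nd cl sub cf].
have D0 T : T \in TT -> det T != 0 by move=> /nd /nondegenerateE.
split => //.
- by move=> T TTT; split; [exact: D0|apply: subset_trans (sub _ TTT); apply: pt_sub_otri; exact: D0].
- by move=> T T'; exact: conforming_pt_disjoint.
- apply: ae_leb2W (ae_tri_pt D0) => x H Omx.
  have : closure Om x by exact: subset_closure.
  by rewrite cl => -[T /= TTT Tx]; exists T => //; exact: H.
Qed.

(** A representative defined everywhere and zero off the open triangles, so that later identities
    hold pointwise instead of almost everywhere. *)
Definition pwpoly TT (q : triangle R -> R * R -> R) : R * R -> R :=
  fun x => \sum_(T <- TT) \1_(pt T) x * q T x.

Lemma bm_pwpoly Om TT k q : tiling Om TT -> (forall T, T \in TT -> polynomial2 k (q T)) ->
  bm (pwpoly TT q).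
Proof.
move=> [_ D0 _ _] pq; apply: bm_sum => T TTT.
by apply: bmM_continuous; [apply: bm_pt; case: (D0 _ TTT)|apply: poly2_continuous (pq _ TTT)].
Qed.

Lemma pwpoly_pt Om TT q T x : tiling Om TT -> T \in TT -> pt T x -> pwpoly TT q x = q T x.
Proof.
move=> [uT _ dis _] TTT Tx; rewrite /pwpoly (@sum_pick _ _ _ T) //.
  by rewrite indicE mem_set // mul1r.
move=> S TTS ST; rewrite indicE memNset ?mul0r //.
by apply: dis Tx => //; move/eqP: ST => nST E; apply: nST.
Qed.

Lemma pwpoly_out TT q x : (forall T, T \in TT -> ~ pt T x) -> pwpoly TT q x = 0.
Proof.
move=> H; rewrite /pwpoly big_seq big1 // => T /H nx.
by rewrite indicE memNset ?mul0r.
Qed.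

Lemma scalar_space_pwpoly fam p Om TT v : tiling Om TT -> scalar_space fam p Om TT v ->
  exists2 q, forall T, T \in TT -> polynomial2 (scalar_degree fam p) (q T) &
    {ae leb2 R, forall x, Om x -> v x = pwpoly TT q x}.
Proof.
move=> tO [_ H]; have [_ D0 _ cov] := tO.
have /choice[q Hq] T : exists q, T \in TT -> polynomial2 (scalar_degree fam p) q /\
    {ae leb2 R, forall x, otri T x -> v x = q x}.
  have [TTT|nT] := boolP (T \in TT); last by exists (fun=> 0).
  by have [q ? ?] := H _ TTT; exists q.
exists q => [T /Hq[]//|].
have A : {ae leb2 R, forall x, forall T, T \in TT -> otri T x -> v x = q T x}.
  by apply: (ae_leb2_seq (P := fun T x => otri T x -> v x = q T x)) => T /Hq[].
apply: ae_leb2W (ae_leb2I A cov) => x [Ax cx] /cx[T TTT Tx].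
rewrite (pwpoly_pt q tO TTT Tx); apply: Ax => //.
by apply: pt_sub_otri => //; case: (D0 _ TTT).
Qed.

Lemma otri_pt T (P : R * R -> Prop) : det T != 0 -> (forall x, pt T x -> P x) ->
  {ae leb2 R, forall x, otri T x -> P x}.
Proof.
move=> D0 H; apply: negligibleS (tri_pt_null D0) => x /= /not_implyP[/otri_sub_tri Tx nP].
by split => // /H.
Qed.

Lemma scalar_space_bm fam p Om TT v :
  @measurable _ (measurableTypeR R * measurableTypeR R)%type Om -> tiling Om TT -> bm v ->
  (forall T, T \in TT -> exists2 q, polynomial2 (scalar_degree fam p) q &
     forall x, pt T x -> v x = q x) ->
  scalar_space fam p Om TT v.
Proof.
move=> mO [_ D0 _ _] bv H; split; first exact: bm_L2.
move=> T TTT; have [q pq vq] := H _ TTT; exists q => //.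
by apply: otri_pt vq; case: (D0 _ TTT).
Qed.

(** A discrete scalar is almost everywhere a finite sum of polynomials cut to triangles, and each of
    these is a limit of test functions. *)
Lemma ip_test_scalar_space fam p Om TT w v :
  @measurable _ (measurableTypeR R * measurableTypeR R)%type Om -> tiling Om TT ->
  L2 Om w -> (forall phi, test_function Om phi -> ip Om w phi = 0) ->
  scalar_space fam p Om TT v -> ip Om w v = 0.
Proof.
move=> mO tO Lw Hw sv; have [Lv _] := sv.
have [q pq vq] := scalar_space_pwpoly tO sv.
have bq := bm_pwpoly tO pq.
rewrite (ip_ae_eqr mO Lv (bm_L2 mO bq) Lw vq) /pwpoly.
have [_ D0 _ _] := tO.
have bT T : T \in TT -> bm (fun x => \1_(pt T) x * q T x).
  move=> TTT; have [dT _] := D0 _ TTT.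
  by apply: bmM_continuous; [exact: bm_pt|apply: poly2_continuous (pq _ TTT)].
have : {subset TT <= TT} by [].
elim: {1 3}TT => [_|T s IH Hs].
  rewrite /ip; under eq_Rintegral do rewrite big_nil mulr0.
  by rewrite Rintegral_cst // mul0r.
have TTT := Hs _ (mem_head _ _); have [dT TO] := D0 _ TTT.
have Ss : {subset s <= TT} by move=> S sS; apply: Hs; rewrite inE sS orbT.
have bs := bm_sum (fun S sS => bT S (Ss S sS)).
under [X in ip _ _ X]eq_fun do rewrite big_cons.
rewrite (ipDr mO (bm_L2 mO (bT _ TTT)) (bm_L2 mO bs) Lw) (IH Ss) addr0.
exact: (ip_test_eq0 mO Lw dT TO (pq _ TTT) Hw).
Qed.

End tiling.

(** * The global lifting and the discrete divergence *)

Section lifting.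
Context {R : realType}.
Implicit Types (Om : set (R * R)) (f g h w v : R * R -> R) (T : triangle R) (TH Th : seq (triangle R)).

Lemma sum_indic Om TH g x : tiling Om TH -> ((forall T, T \in TH -> ~ pt T x) -> g x = 0) ->
  \sum_(T <- TH) \1_(pt T) x * g x = g x.
Proof.
move=> tO gx; have [[T TTH Tx]|nT] := pselect (exists2 T, T \in TH & pt T x).
  exact: (pwpoly_pt (fun=> g) tO TTH Tx).
have nT' T : T \in TH -> ~ pt T x by move=> TTH Tx; apply: nT; exists T.
by rewrite gx //; exact: (pwpoly_out (fun=> fun=> 0) nT').
Qed.

(** The solutions on the coarse triangles have disjoint supports and no normal trace, so they add up
    to a field with divergence [g] on the domain, and their squared norms add up as well. *)
Lemma flux_lift fam p : (fam = BDM -> (1 <= p)%N) -> exists2 K : R, 0 <= K &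
  forall Om TH Th, @measurable _ (measurableTypeR R * measurableTypeR R)%type Om ->
  tiling Om TH -> nvb_refinement TH Th ->
  forall g, bm g -> piecewise (scalar_degree fam p) Th g ->
  (forall x, (forall T, T \in TH -> ~ pt T x) -> g x = 0) ->
  (forall T, T \in TH -> J (fun x => \1_(pt T) x * g x) = 0) ->
  exists t, [/\ flux_space fam p Om Th t, is_weak_div Om t g &
    vip Om t t <= K * \sum_(T <- TH) energy T * J (fun x => \1_(pt T) x * g x ^+ 2)].
Proof.
move=> hp; have [K [K0 HK]] := @tree_solve R (scalar_degree fam p).
exists K => // Om TH Th mO tO /nvb_refines[LL [eTH rLL eTh]] g bg pg g0 mg.
have [uT D0 dis cov] := tO.
have uLL : uniq LL by apply: (@map_uniq _ _ fst); rewrite eTH.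
have LLT i : i \in LL -> i.1 \in TH by move=> iL; rewrite -eTH map_f.
(* A tree is determined by its root, since [TH] has no repetition; distinct trees therefore have
   disjoint roots. *)
have disL i j x : i \in LL -> j \in LL -> j != i -> pt i.1 x -> ~ pt j.1 x.
  move=> iL jL /eqP ji; apply: dis; [exact: LLT|exact: LLT|].
  by move=> E; apply: ji; rewrite -eTH in uT; rewrite (uniq_map_inj uT iL jL E).
have /choice[t Ht] i : exists t : (R * R -> R) * (R * R -> R), i \in LL ->
    localsol (scalar_degree fam p) i.1 i.2 g t.1 t.2
      (K * energy i.1 * J (fun x => \1_(pt i.1) x * g x ^+ 2)).
  have [iL|_] := boolP (i \in LL); last by exists (fun=> 0, fun=> 0).
  have [dT _] := D0 _ (LLT _ iL).
  have [|t1 [t2 H]] := HK _ _ (rLL _ iL) dT g bg _ (mg _ (LLT _ iL)); last by exists (t1, t2).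
  move=> S Si; apply: pg; rewrite eTh; apply/flattenP; exists i.2 => //.
  by apply/mapP; exists i.
pose tau x := (\sum_(i <- LL) (t i).1 x, \sum_(i <- LL) (t i).2 x).
have out i x : i \in LL -> ~ pt i.1 x -> (t i).1 x = 0 /\ (t i).2 x = 0.
  by move=> /Ht[_ + _ _ _]; apply.
have pick i x : i \in LL -> pt i.1 x -> tau x = ((t i).1 x, (t i).2 x).
  move=> iL ix; rewrite /tau !(@sum_pick _ _ _ i) // => j jL ji;
    by have [] := out _ _ jL (disL _ _ _ iL jL ji ix).
have off x : (forall T, T \in TH -> ~ pt T x) -> tau x = (0, 0).
  by move=> H; rewrite /tau !big_seq !big1 // => i iL; have [] := out _ _ iL (H _ (LLT _ iL)).
have b1 i : i \in LL -> bm (t i).1 by move=> /Ht[[]].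
have b2 i : i \in LL -> bm (t i).2 by move=> /Ht[[]].
have Lt : L2vec Om tau by split; apply: bm_L2 => //; exact: bm_sum.
have offO x : ~ Om x -> forall T, T \in TH -> ~ pt T x.
  by move=> nO T TTH Tx; apply: nO; have [_ ] := D0 _ TTH; apply.
have wd : is_weak_div Om tau g.
  split; first exact: bm_L2.
  move=> phi [/(_ 1%N)/Ck_C1 C _ _]; have [_ c1 c2 _ _] := C; have [cphi _ _ _ _] := C.
  rewrite /vip /ip !Rintegral_J0; last 2 first.
  - by move=> x /offO /g0 ->; rewrite mul0r.
  - by move=> x /offO /off -> /=; rewrite !mul0r addr0.
  have -> : (fun x => (tau x).1 * d1 phi x + (tau x).2 * d2 phi x) =
            (fun x => \sum_(i <- LL) ((t i).1 x * d1 phi x + (t i).2 x * d2 phi x)).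
    by apply/funext => x; rewrite /tau /= !mulr_suml -big_split.
  rewrite Jsum; last first.
    by move=> i iL; apply: bmD; apply: bmM_continuous => //; [exact: b1|exact: b2].
  rewrite (_ : (fun x => g x * phi x) = (fun x => \sum_(T <- TH) \1_(pt T) x * (g x * phi x))).
    rewrite Jsum -?eTH ?big_map -?sumrN.
      by rewrite !big_seq; apply: eq_bigr => i /Ht[_ _ _ + _]; apply; exact: C.
    move=> T; rewrite eTH => /D0[dT _]; apply: bmM; first exact: bm_pt.
    exact: bmM_continuous.
  by apply/funext => x; rewrite (sum_indic (g := fun x => g x * phi x) tO) // => /g0 ->; rewrite mul0r.
exists tau; split => //.
- split; first by split => //; exists g.
  move=> S; rewrite eTh => /flattenP[L /mapP[i iL ->] Si].
  have [_ _ /(_ _ Si)[q sq Hq] _ _] := Ht _ iL.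
  have [dS Si1] := refines_sub (rLL _ iL) (D0 _ (LLT _ iL)).1 Si.
  exists q; first exact: RT_sub_flux.
  apply: otri_pt => // x Sx; rewrite (pick i) //; [exact: Hq|exact: Si1].
- rewrite /vip Rintegral_J0; last by move=> x /offO /off -> /=; rewrite !mul0r addr0.
  have -> : (fun x => (tau x).1 * (tau x).1 + (tau x).2 * (tau x).2) =
            (fun x => \sum_(i <- LL) ((t i).1 x ^+ 2 + (t i).2 x ^+ 2)).
    apply/funext => x; have [[i iL ix]|nx] := pselect (exists2 i, i \in LL & pt i.1 x).
      rewrite (pick i) // (@sum_pick _ _ _ i) //= => j jL ji.
      by have [-> ->] := out _ _ jL (disL _ _ _ iL jL ji ix); rewrite expr0n addr0.
    rewrite off ?mul0r ?addr0; last first.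
      by move=> T; rewrite -eTH => /mapP[i iL ->] ix; apply: nx; exists i.
    rewrite big_seq big1 ?mul0r ?addr0 // => i iL.
    have [|-> ->] := out i x iL; last by rewrite expr0n addr0.
    by move=> ix; apply: nx; exists i.
  rewrite Jsum; last by move=> i iL; apply: bmD; apply: bm_sqr; [exact: b1|exact: b2].
  rewrite -eTH big_map mulr_sumr !big_seq; apply: ler_sum => i /Ht[_ _ _ _].
  by rewrite mulrA.
Qed.

(** [wdiv] chooses one weak divergence. Any other differs from it by a function orthogonal to all
    test functions, hence to all discrete scalars, and the mixed system only pairs with these. *)
Lemma wdiv_ip fam p Om Th t g v :
  @measurable _ (measurableTypeR R * measurableTypeR R)%type Om -> tiling Om Th ->
  is_weak_div Om t g -> scalar_space fam p Om Th v -> ip Om (wdiv Om t) v = ip Om g v.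
Proof.
move=> mO tO wg sv; have [Lg Hg] := wg.
have [Lw Hw] : is_weak_div Om t (wdiv Om t) := xgetPex (cst 0) (ex_intro _ g wg).
apply/eqP; rewrite -subr_eq0 -ipBl //; last by case: sv.
apply/eqP; apply: ip_test_scalar_space sv => //; first exact: L2B.
move=> phi tphi; have Lphi := bm_L2 mO (test_function_bm tphi).
rewrite (ipBl mO Lw Lg Lphi); have := Hw _ tphi.
by rewrite (Hg _ tphi) => /oppr_inj ->; exact: subrr.
Qed.

End lifting.

(** * The stability estimate *)

Theorem theorem4p3 (R : realType) (fam : mixed_family) (p : nat)
    (hp : fam = BDM -> (1 <= p)%N) (gamma : R) :
  exists C0 : R, 0 < C0 /\
  forall (Om : set (R * R)) (TH : seq (triangle R)),
    polygonal_domain Om -> simply_connected Om ->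
    conforming_triangulation Om TH -> shape_regular gamma TH ->
  forall Th : seq (triangle R),
    nvb_refinement TH Th -> conforming_triangulation Om Th ->
  forall f fH fh : R * R -> R,
    L2 Om f ->
    is_L2_projection Om (scalar_space fam p Om TH) f fH ->
    is_L2_projection Om (scalar_space fam p Om Th) f fh ->
  forall (sh st : R * R -> R * R) (uh ut : R * R -> R),
    mixed_solution fam p Om Th fh sh uh ->
    mixed_solution fam p Om Th fH st ut ->
  L2vnorm Om (fun x => sh x - st x) <= Num.sqrt C0 * osc fh fH TH.
Proof.
have [K K0 HK] := @flux_lift R fam p hp.
(* The factor 9 converts energies into squared diameters; adding 1 keeps the constant positive when
   [K] is 0. *)
exists (9 * K + 1); split; first by rewrite ltr_wpDl ?mulr_ge0.
move=> Om TH [[oO _ _ _] _] _ cTH _ Th ref /triangulation_tiling th f fH fh Lf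
  [sfH pfH] [sfh pfh] sh st uh ut [fsh suh eh1 eh2] [fst sut et1 et2].
have mO : @measurable _ (measurableTypeR R * measurableTypeR R)%type Om := open_measurable_plane oO.
have tH := triangulation_tiling cTH.
have [qH pqH aH] := scalar_space_pwpoly tH sfH.
have [qh pqh ah] := scalar_space_pwpoly th sfh.
have [_ DH disH _] := tH; have [_ Dh _ _] := th.
(* A representative of [fh - fH] that is polynomial at every point of each fine open triangle and
   vanishes off the coarse ones. *)
pose g x := pwpoly Th qh x - pwpoly TH qH x.
have bh := bm_pwpoly th pqh; have bH := bm_pwpoly tH pqH.
have bg : bm g := bmB bh bH.
have ag : {ae leb2 R, forall x, Om x -> fh x - fH x = g x}.
  by apply: ae_leb2W (ae_leb2I aH ah) => x [h1 h2] Ox; rewrite /g h1 // h2.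
have [LfH _] := sfH; have [Lfh _] := sfh.
have parent S : S \in Th -> exists2 T, T \in TH & pt S `<=` pt T.
  have [LL [eTH rLL ->]] := nvb_refines ref => /flattenP[L /mapP[i iL ->] Si].
  have iT : i.1 \in TH by rewrite -eTH map_f.
  by exists i.1 => //; have [] := refines_sub (rLL _ iL) (DH _ iT).1 Si.
have ipg v : L2 Om v -> ip Om g v = ip Om fh v - ip Om fH v.
  move=> Lv; rewrite -ipBl // ![ip Om _ v]ipC; symmetry.
  by apply: ip_ae_eqr => //; [exact: L2B|exact: bm_L2].
have g0 x : (forall T, T \in TH -> ~ pt T x) -> g x = 0.
  move=> nx; rewrite /g !pwpoly_out ?subrr // => S /parent[T TTH ST] /ST.
  exact: nx.
have mean T : T \in TH -> J (fun x => \1_(pt T) x * g x) = 0.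
  move=> TTH; have [dT TO] := DH _ TTH.
  have bT := bm_pt dT.
  (* The indicator of a coarse triangle is constant on every triangle of either mesh, hence an
     admissible test function for both projections, which give the integral of [f] over [T]. *)
  have s1 (TT : seq (triangle R)) : tiling Om TT ->
      (forall S, S \in TT -> exists2 T', T' \in TH & pt S `<=` pt T') ->
      scalar_space fam p Om TT \1_(pt T).
    move=> tTT HS; apply: scalar_space_bm => // S /HS[T' T'H ST'].
    have [E|nT] := pselect (T' = T).
      exists (fun=> 1); first exact: poly2_cst.
      by move=> x /ST'; rewrite E indicE => Tx; rewrite mem_set.
    exists (fun=> 0); first exact: poly2_cst.
    by move=> x /ST' T'x; rewrite indicE memNset //; exact: disH T'x.
  have sH : scalar_space fam p Om TH \1_(pt T) by apply: s1 => // S SH; exists S.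
  have sh1 : scalar_space fam p Om Th \1_(pt T) by exact: s1.
  have : ip Om g \1_(pt T) = 0 by rewrite ipg ?pfH ?pfh ?subrr //; case: sH.
  rewrite /ip Rintegral_J0; last by move=> x nO; rewrite indicE memNset ?mulr0 // => /TO.
  by move=> E; rewrite -[RHS]E; congr J; apply/funext => x; rewrite mulrC.
have pg : piecewise (scalar_degree fam p) Th g.
  move=> S STh; have [T TTH ST] := parent _ STh.
  exists (fun x => qh S x + (-1) * qH T x).
    by apply: poly2D; [exact: pqh|apply: poly2Z; exact: pqH].
  move=> x Sx; rewrite /g (pwpoly_pt qh th STh Sx) (pwpoly_pt qH tH TTH (ST _ Sx)) mulN1r //.
have [t [ft wt Bt]] := HK Om TH Th mO tH ref g bg pg g0 mean.
have [[Lsh _] _] := fsh; have [[Lst _] _] := fst.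
pose e x := sh x - st x.
have Le : L2vec Om e by exact: L2vecB.
have [[Lt _] _] := ft.
have [Luh _] := suh; have [Lut _] := sut.
(* Both sides equal the inner product of [g] with the difference [uh - ut] of the scalar
   unknowns. *)
have E : vip Om e e = vip Om e t.
  have e1 := eh1 _ fsh; have e2 := eh1 _ fst; have e3 := et1 _ fsh; have e4 := et1 _ fst.
  have e5 := eh1 _ ft; have e6 := et1 _ ft.
  rewrite (wdiv_ip mO th wt suh) (ipg _ Luh) in e5.
  rewrite (wdiv_ip mO th wt sut) (ipg _ Lut) in e6.
  rewrite (eh2 _ suh) in e1; rewrite (et2 _ suh) in e2.
  rewrite (eh2 _ sut) in e3; rewrite (et2 _ sut) in e4.
  rewrite /e (vipBl mO Lsh Lst Le) (vipC Om sh) (vipC Om st) (vipBl mO Lsh Lst Lsh) (vipBl mO Lsh Lst Lst).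
  rewrite (vipBl mO Lsh Lst Lt).
  move: e1 e2 e3 e4 e5 e6 => /subr0_eq -> /subr0_eq -> /subr0_eq -> /subr0_eq -> /subr0_eq -> /subr0_eq ->.
  ring.
have Bd T : T \in TH ->
    J (fun x => \1_(pt T) x * g x ^+ 2) = L2norm (otri T) (fun x => fh x - fH x) ^+ 2.
  move=> TTH; have [dT _] := DH _ TTH; have [_ _ _ /(_ _ TTH) oT _] := cTH.
  have mo : @measurable _ (measurableTypeR R * measurableTypeR R)%type (otri T).
    by apply: open_measurable_plane; exact: open_interior.
  have [M HM] := tri_bounded T.
  have bo : bm (\1_(otri T) : R * R -> R).
    by apply: (bm_indic (M := M)) => // x /otri_sub_tri /HM ?; exact/boxP.
  rewrite /L2norm sqr_sqrtr ?ip_ge0 // /ip.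
  have [md _] := L2B mO Lfh LfH; have [mg _] := bm_L2 mO bg.
  rewrite (@ae_eq_Rintegral _ _ mo _ (fun x => g x * g x)); last first.
  - by apply: ae_leb2W ag => x H /oT /H ->.
  - by apply: (measurable_funS mO oT); exact: measurable_funM.
  - by apply: (measurable_funS mO oT); exact: measurable_funM.
  rewrite Rintegral_J; apply: ae_eq_J.
  - by apply: bmM; [exact: bm_pt|exact: bm_sqr].
  - by apply: bmM => //; exact: bmM.
  (* The interior of the closed triangle and its open affine image differ at most by boundary
     points, a null set. *)
  apply: negligibleS (tri_pt_null dT) => x /=; rewrite !indicE -expr2.
  have [Tx|nx] := pselect (pt T x).
    by rewrite !mem_set //; exact: pt_sub_otri.
  rewrite [x \in pt T]memNset //; have [ox _|no] := pselect (otri T x).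
    by split => //; exact: otri_sub_tri.
  by rewrite memNset.
rewrite /L2vnorm /osc -sqrtrM; last by rewrite addr_ge0 ?mulr_ge0.
apply: ler_wsqrtr; apply: le_trans (vip_le mO Le Lt E) _; apply: le_trans Bt _.
set S := \sum_(T <- TH) diam _ ^+ 2 * _.
have S0 : 0 <= S by apply: sumr_ge0 => T _; rewrite mulr_ge0 ?sqr_ge0.
have H : \sum_(T <- TH) energy T * J (fun x => \1_(pt T) x * g x ^+ 2) <= 9 * S.
  rewrite mulr_sumr !big_seq; apply: ler_sum => T TTH.
  by rewrite (Bd T TTH) mulrA ler_wpM2r ?sqr_ge0 ?energy_diam.
apply: le_trans (ler_wpM2l K0 H) _.
by rewrite (mulrDl (9 * K)) mul1r mulrA (mulrC K 9) lerDl.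
Qed.
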